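(* In the setting described in the context, let $(\mathbf{A}_N)_{N\ge1}$ be a sequence of deterministic $ML\times ML$ matrices and $(\mathbf{G}_N)_{N\ge1}$ a sequence of deterministic $N\times N$ matrices with $\sup_N\|\mathbf{G}_N\|<+\infty$. Then there exist nice polynomials $P_1,P_2$ such that, with $C(z)=P_1(|z|)P_2(1/\delta_z)$, for every $N$ and every $z\in\mathbb{C}\setminus\mathbb{R}^+$, $$\mathrm{Var}\left(\frac{1}{ML}\mathrm{tr}\,\mathbf{A}_N\mathbf{Q}_N(z)\right)\le\frac{C(z)}{MN}\,\frac{1}{ML}\mathrm{tr}(\mathbf{A}_N\mathbf{A}_N^H),$$ $$\mathrm{Var}\left(\frac{1}{ML}\mathrm{tr}\,\mathbf{A}_N\mathbf{Q}_N(z)\mathbf{W}_N\mathbf{G}_N\mathbf{W}_N^H\right)\le\frac{C(z)}{MN}\,\frac{1}{ML}\mathrm{tr}(\mathbf{A}_N\mathbf{A}_N^H).$$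
   Context: Dimensions: $M=M_N$ and $L=L_N$ are positive integers indexed by $N\ge 1$, with $M\to+\infty$ and $c_N=\frac{ML}{N}\to c$, $0<c<+\infty$, as $N\to+\infty$. Spectral densities: for each $M$, $\mathcal{S}_1,\ldots,\mathcal{S}_M$ are positive functions on $[0,1]$ and $r_m(k)=\int_0^1\mathcal{S}_m(\nu)e^{2\mathrm{i}\pi\nu k}d\nu$, $k\in\mathbb{Z}$. It is assumed that $\sup_M\sum_{n\in\mathbb{Z}}\left(\frac1M\sum_{m=1}^M|r_m(n)|^2\right)^{1/2}<+\infty$ (so each $\mathcal{S}_m$ is continuous), $\sup_M\sup_{m\le M}\max_{\nu}\mathcal{S}_m(\nu)<+\infty$ and $\inf_M\inf_{m\le M}\min_{\nu}\mathcal{S}_m(\nu)>0$. Random matrix: for each $N$, $(w_{m,N}(n))_{m=1,\ldots,M,\,n=1,\ldots,N+L-1}$ are jointly (circularly symmetric) complex Gaussian zero-mean random variables with $\mathbb{E}[w_{m,N}(k)w_{m',N}^*(k')]=\frac{r_m(k-k')}{N}\delta_{m-m'}$ (so different $m$ are independent). $\mathbf{W}_{m,N}$ is the $L\times N$ Hankel matrix with entries $\{\mathbf{W}_{m,N}\}_{i,j}=w_{m,N}(i+j-1)$, and $\mathbf{W}_N=[\mathbf{W}_{1,N}^T,\ldots,\mathbf{W}_{M,N}^T]^T$ is $ML\times N$. $\mathbf{Q}_N(z)=(\mathbf{W}_N\mathbf{W}_N^H-z\mathbf{I}_{ML})^{-1}$. $(\cdot)^H$ is conjugate transpose, $\|\cdot\|$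 the spectral norm, $\mathrm{Var}(x)=\mathbb{E}|x|^2-|\mathbb{E}x|^2$. $\delta_z=\mathrm{dist}(z,\mathbb{R}^+)$. A nice constant is a positive constant independent of $L,M,N$ and $z$; a nice polynomial is a polynomial whose degree is independent of $L,M,N$ and whose coefficients are nice constants. *)

(* Defs.v *)
From HB Require Import structures.
From mathcomp Require Import all_boot all_order all_algebra.
From mathcomp Require Import all_classical all_reals all_analysis.
From mathcomp Require Import complex.

Set Implicit Arguments.
Unset Strict Implicit.
Unset Printing Implicit Defensive.

Import Order.TTheory GRing.Theory Num.Theory.
Import numFieldNormedType.Exports.

Local Open Scope classical_set_scope.
Local Open Scope ring_scope.

Section complex_numbers.
Variable R : realType.
Local Notation C := R[i].

(* The modulus as an element of R; the norm `|z| of R[i] lives in R[i]. *)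
Definition cmod (z : C) : R := Normc.normc z.

Definition cis (t : R) : C := Complex (cos t) (sin t).

(* R^+ = [0, +oo[ ; in the partial order of R[i], 0 <= z means that z is real
   and nonnegative. *)
Definition Rnonneg : set C := [set z | 0 <= z].

Definition dist (z : C) (D : set C) : R := inf [set cmod (z - x) | x in D].

Definition ctrmx (m n : nat) (A : 'M[C]_(m, n)) : 'M[C]_(n, m) :=
  map_mx Num.conj A^T.

Definition l2norm (n : nat) (x : 'cV[C]_n) : R :=
  Num.sqrt (\sum_(i < n) cmod (x i 0) ^+ 2).

Definition spectral_norm (m n : nat) (A : 'M[C]_(m, n)) : R :=
  sup [set l2norm (A *m x) | x in [set x : 'cV[C]_n | l2norm x <= 1]].

(* The Fourier coefficient \int_0^1 f(nu) e^{2 i pi nu k} dnu. *)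
Definition fourier_coef (f : R -> R) (k : int) : C :=
  Complex
    (\int[lebesgue_measure]_(nu in `[0, 1]) (f nu * cos (2 * pi * nu * k%:~R)))%R
    (\int[lebesgue_measure]_(nu in `[0, 1]) (f nu * sin (2 * pi * nu * k%:~R)))%R.

Definition nice_poly (p : {poly R}) : Prop :=
  p != 0 /\ forall i, (i < size p)%N -> 0 < p`_i.

End complex_numbers.

Section complex_random_variables.
Context {R : realType} {d : measure_display} {T : measurableType d}.
Variable P : probability T R.
Local Notation C := R[i].

Definition cexpectation (X : T -> C) : C :=
  Complex (fine ('E_P[fun t => complex.Re (X t)])%E)
          (fine ('E_P[fun t => complex.Im (X t)])%E).

(* Extended-real valued: it is +oo when X is not square integrable, so that an
   upper bound on it also asserts square integrability. *)
Definition cvariance (X : T -> C) : \bar R :=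
  ('E_P[fun t => (cmod (X t) ^+ 2)%R] - (cmod (cexpectation X) ^+ 2)%:E)%E.

(* As A i may be setT, the product rule for the whole (finite) family contains
   that of every subfamily. *)
Definition mutually_independent (I : finType) (X : I -> T -> R) : Prop :=
  forall A : I -> set R, (forall i, measurable (A i)) ->
    P [set t | forall i, A i (X i t)] = (\prod_(i : I) P (X i @^-1` A i))%E.

Definition standard_normal (Z : T -> R) : Prop :=
  forall A : set R, measurable A -> P (Z @^-1` A) = normal_prob 0 1 A.

(* The vector X is almost surely an affine image of a vector of independent
   standard normal variables. Degenerate vectors are included. *)
Definition jointly_gaussian (I : finType) (X : I -> T -> R) : Prop :=
  (forall i, measurable_fun setT (X i)) /\
  exists (k : nat) (Z : 'I_k -> {RV P >-> R}) (mu : I -> R)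
         (a : I -> 'I_k -> R),
    [/\ forall j, standard_normal (Z j),
        mutually_independent (fun j t => Z j t) &
        forall i, {ae P, forall t, X i t = mu i + \sum_(j < k) a i j * Z j t}].

(* The real and imaginary parts, as a single real family. *)
Definition re_im (I : Type) (X : I -> T -> C) (i : I + I) (t : T) : R :=
  match i with
  | inl i => complex.Re (X i t)
  | inr i => complex.Im (X i t)
  end.

Definition jointly_complex_gaussian (I : finType) (X : I -> T -> C) : Prop :=
  jointly_gaussian (re_im X).

(* (X i)_i and (Y i)_i have the same joint law: their real and imaginary parts
   agree on measurable boxes, which form a generating pi-system. *)
Definition same_joint_law (I : finType) (X Y : I -> T -> C) : Prop :=
  forall B : I + I -> set R, (forall i, measurable (B i)) ->
    P [set t | forall i, B i (re_im X i t)] =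
    P [set t | forall i, B i (re_im Y i t)].

Definition circularly_symmetric (I : finType) (X : I -> T -> C) : Prop :=
  forall theta : R, same_joint_law (fun i t => cis theta * X i t) X.

End complex_random_variables.

Section block_hankel.
Variable R : realType.
Local Notation C := R[i].

(* The M Hankel matrices of size L * N stacked on top of each other. With
   indices counted from 0, row m * L + i is row i of the m-th Hankel matrix,
   whose (i, j) entry is x m (i + j). *)
Definition block_hankel (M L N : nat) (x : nat -> nat -> C) :
    'M[C]_(M * L, N) :=
  \matrix_(i < M * L, j < N) x (i %/ L)%N (i %% L + j)%N.

Definition resolvent (n m : nat) (W : 'M[C]_(n, m)) (z : C) : 'M[C]_n :=
  invmx (W *m ctrmx W - z%:M).

Definition ntr (n : nat) (A : 'M[C]_n) : C := n%:R^-1 * \tr A.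

End block_hankel.

(* Main.v *)
(* Almost surely the w's are linear images of a standard Gaussian vector Z, so
   both traces are smooth functions F(Z) of polynomial growth. Let Z' be an
   independent copy. Cutting the rotation that carries Z to Z' into small arcs
   (Pisier) gives the Poincare inequality E|F(Z) - F(Z')|^2 <= 8 E|DF(Z) Z'|^2,
   whose left-hand side is 2 Var F(Z). Given Z, DF(Z) Z' is a sum of two traces
   tr(B1 W') and tr(W'^H B2) divided by ML. Grouping the entries of W' along
   antidiagonals, at most L per block, and bounding the Toeplitz covariances by
   sup S / N shows that the variances of these traces are at most
   sup S * L / N times |B1|_F^2 and |B2|_F^2. As Q, QW and W^H Q W are bounded in
   terms of |z| and 1/delta_z alone, |B1|_F and |B2|_F are controlled by |A|_F and
   |W^H A|_F, and E|W^H A|_F^2 <= sup S * |A|_F^2, so that no bound on the norm of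
   W is needed. *)
Require Import Defs.
From HB Require Import structures.
From mathcomp Require Import all_boot all_order all_algebra.
From mathcomp Require Import all_classical all_reals all_analysis.
From mathcomp Require Import complex measurable_realfun.
From mathcomp Require Import ring lra zify.

Set Implicit Arguments.
Unset Strict Implicit.
Unset Printing Implicit Defensive.

Import Order.TTheory GRing.Theory Num.Theory.
Import numFieldNormedType.Exports.

Local Open Scope classical_set_scope.
Local Open Scope ring_scope.

(** * Complex random variables *)

(** The rate comes from [(1 / (ML)) ^ 2 * L / N = (1 / (MN)) * (1 / (ML))]: the factor [L] paid for
    repeated Hankel entries is exactly what the normalisation has to spare. The rotation argument
    asks only for a first-order expansion whose remainder is quadratic in the increment and of
    polynomial growth. The constants of these expansions depend on the dimensions and on [z], but
    they enter through a term that tends to [0] as the arcs shrink; sharp estimates are needed for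
    the first derivative alone. Rotation invariance of [(Z, Z')] is a planar fact applied to each
    pair of coordinates, laws being compared on boxes. In the second functional the outer [W^H] is
    separated from [Q] by [G] on one side and, cyclically, by [A] on the other, so that no resolvent
    can absorb it. This is why the product [W^H A] is kept together and controlled by its second
    moment. *)

Section modulus.
Variable R : realType.
Local Notation C := R[i].
Implicit Types (z : C) (x : R).

Lemma cmod_ge0 z : 0 <= cmod z.
Proof. by case: z => a b; rewrite /cmod /= sqrtr_ge0. Qed.

Lemma cmod_sqr z : cmod z ^+ 2 = complex.Re z ^+ 2 + complex.Im z ^+ 2.
Proof. by case: z => a b; rewrite /cmod /= sqr_sqrtr// addr_ge0// sqr_ge0. Qed.

Lemma cmodM z1 z2 : cmod (z1 * z2) = cmod z1 * cmod z2.
Proof. exact: Normc.normcM. Qed.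

Lemma cmodD_le z1 z2 : cmod (z1 + z2) <= cmod z1 + cmod z2.
Proof. exact: le_normcD. Qed.

Lemma cmodN z : cmod (- z) = cmod z.
Proof. exact: normcN. Qed.

Lemma cmod0 : cmod (0 : C) = 0.
Proof. exact: Normc.normc0. Qed.

Lemma cmod_real x : cmod (x%:C)%C = `|x|.
Proof. by rewrite /cmod /= expr0n /= addr0 sqrtr_sqr. Qed.

Lemma cmodV z : cmod z^-1 = (cmod z)^-1.
Proof. exact: Normc.normcV. Qed.

Lemma cmod_nat n : cmod (n%:R : C) = n%:R.
Proof. by rewrite -(rmorph_nat (real_complex R)) cmod_real normr_nat. Qed.

(** Two conjugations live on [R[i]]: that of numeric closed fields and the componentwise one. Both
    multiply [z] into its squared modulus, so they agree after cancelling [z]. *)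
Lemma conjC_conjc z : Num.conj z = (z^*)%C.
Proof.
have [->|z0] := eqVneq z 0; first by rewrite conjC0 conjc0.
by apply: (mulfI z0); rewrite -normCK sqr_normc.
Qed.

Lemma cmod_conj z : cmod (Num.conj z) = cmod z.
Proof. by rewrite conjC_conjc; case: z => a b; rewrite /cmod /= sqrrN. Qed.

Lemma mulr_conjC z : z * Num.conj z = ((cmod z ^+ 2)%:C)%C.
Proof. by rewrite -normCK -rmorphXn. Qed.

Lemma cmod_sum (I : Type) (r : seq I) (P : pred I) (F : I -> C) :
  cmod (\sum_(i <- r | P i) F i) <= \sum_(i <- r | P i) cmod (F i).
Proof.
elim/big_ind2: _ => [|z1 y1 z2 y2 h1 h2|//]; first by rewrite cmod0.
exact: (le_trans (cmodD_le _ _) (lerD h1 h2)).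
Qed.

Lemma Re_le_cmod z : complex.Re z <= cmod z.
Proof.
apply: (le_trans (ler_norm _)).
by rewrite -ler_sqr ?nnegrE ?cmod_ge0// real_normK ?num_real// cmod_sqr lerDl sqr_ge0.
Qed.

Lemma ReM_conj z : complex.Re (z * Num.conj z) = cmod z ^+ 2.
Proof. by rewrite mulr_conjC. Qed.

Lemma ReD z1 z2 : complex.Re (z1 + z2) = complex.Re z1 + complex.Re z2.
Proof. by case: z1 z2 => [? ?] [? ?]. Qed.

Lemma ImD z1 z2 : complex.Im (z1 + z2) = complex.Im z1 + complex.Im z2.
Proof. by case: z1 z2 => [? ?] [? ?]. Qed.

Lemma Re_sum (I : Type) (r : seq I) (P : pred I) (F : I -> C) :
  complex.Re (\sum_(i <- r | P i) F i) = \sum_(i <- r | P i) complex.Re (F i).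
Proof. exact: (big_morph _ ReD). Qed.

Lemma Im_sum (I : Type) (r : seq I) (P : pred I) (F : I -> C) :
  complex.Im (\sum_(i <- r | P i) F i) = \sum_(i <- r | P i) complex.Im (F i).
Proof. exact: (big_morph _ ImD). Qed.

(** Summing [2 F i F j <= F i ^+ 2 + F j ^+ 2] over all pairs gives twice the claim. *)
Lemma sqr_sum_le (I : finType) (P : {pred I}) (F : I -> R) :
  (\sum_(i in P) F i) ^+ 2 <= #|P|%:R * \sum_(i in P) F i ^+ 2.
Proof.
have E1 : \sum_(i in P) \sum_(j in P) F i ^+ 2 = #|P|%:R * \sum_(i in P) F i ^+ 2.
  by under eq_bigr do rewrite sumr_const; rewrite sumrMnl mulr_natl.
have E2 : \sum_(i in P) \sum_(j in P) F j ^+ 2 = #|P|%:R * \sum_(i in P) F i ^+ 2.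
  by rewrite sumr_const mulr_natl.
suff : (\sum_(i in P) F i) ^+ 2 *+ 2 <=
    \sum_(i in P) \sum_(j in P) (F i ^+ 2 + F j ^+ 2).
  under [X in _ <= X]eq_bigr do rewrite big_split.
  by rewrite big_split/= E1 E2 -mulr2n ler_pMn2r.
rewrite expr2 mulr_suml -sumrMnl; apply: ler_sum => i _.
rewrite mulr_sumr -sumrMnl; apply: ler_sum => j _.
by have := sqr_ge0 (F i - F j); rewrite sqrrB; lra.
Qed.

Lemma cmod_sqr_sum_le (I : finType) (P : {pred I}) (F : I -> C) :
  cmod (\sum_(i in P) F i) ^+ 2 <= #|P|%:R * \sum_(i in P) cmod (F i) ^+ 2.
Proof.
apply: le_trans (sqr_sum_le P (fun i => cmod (F i))).
by rewrite ler_sqr ?nnegrE ?cmod_ge0 ?sumr_ge0//; [exact: cmod_sum|move=> *; exact: cmod_ge0].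
Qed.

End modulus.

(** * Measurability of complex-valued maps *)

Section complex_measurability.
Variables (R : realType) (d : measure_display) (T : measurableType d).
Local Notation C := R[i].
Implicit Types X Y : T -> C.

(** Real and imaginary parts are tested separately, in accordance with [cexpectation], so that no
    sigma-algebra on [C] is involved. *)
Definition cmeasurable X := measurable_fun setT (fun t => complex.Re (X t)) /\
  measurable_fun setT (fun t => complex.Im (X t)).

Lemma cmeasurable_cst (z : C) : cmeasurable (fun=> z).
Proof. by split; exact: measurable_cst. Qed.

Lemma eq_cmeasurable X Y : X =1 Y -> cmeasurable X -> cmeasurable Y.
Proof. by move=> /funext ->. Qed.

Lemma cmeasurableD X Y : cmeasurable X -> cmeasurable Y ->
  cmeasurable (fun t => X t + Y t).
Proof.
by move=> [X1 X2] [Y1 Y2]; split; [under eq_fun do rewrite ReD|under eq_fun do rewrite ImD];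
  exact: measurable_funD.
Qed.

Lemma cmeasurableM X Y : cmeasurable X -> cmeasurable Y ->
  cmeasurable (fun t => X t * Y t).
Proof.
move=> [X1 X2] [Y1 Y2]; split.
  have -> : (fun t => complex.Re (X t * Y t)) = (fun t => complex.Re (X t) * complex.Re (Y t) -
      complex.Im (X t) * complex.Im (Y t)).
    by apply/funext => t; case: (X t) (Y t) => [? ?] [? ?].
  by apply: measurable_funB; exact: measurable_funM.
have -> : (fun t => complex.Im (X t * Y t)) = (fun t => complex.Re (X t) * complex.Im (Y t) +
    complex.Im (X t) * complex.Re (Y t)).
  by apply/funext => t; case: (X t) (Y t) => [? ?] [? ?].
by apply: measurable_funD; exact: measurable_funM.
Qed.

Lemma cmeasurable_sum (I : Type) (r : seq I) (P : pred I) (F : I -> T -> C) :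
  (forall i, P i -> cmeasurable (F i)) ->
  cmeasurable (fun t => \sum_(i <- r | P i) F i t).
Proof.
move=> mF; elim: r => [|i r IH].
  by apply: (@eq_cmeasurable (fun=> 0)) => [t|]; rewrite ?big_nil//; exact: cmeasurable_cst.
case: (boolP (P i)) => Pi; last first.
  by apply: (eq_cmeasurable _ IH) => t; rewrite big_cons (negPf Pi).
apply: (@eq_cmeasurable (fun t => F i t + \sum_(j <- r | P j) F j t)).
  by move=> t; rewrite big_cons Pi.
by apply: cmeasurableD => //; exact: mF.
Qed.

Lemma cmeasurable_prod (I : Type) (r : seq I) (P : pred I) (F : I -> T -> C) :
  (forall i, P i -> cmeasurable (F i)) ->
  cmeasurable (fun t => \prod_(i <- r | P i) F i t).
Proof.
move=> mF; elim: r => [|i r IH].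
  by apply: (@eq_cmeasurable (fun=> 1)) => [t|]; rewrite ?big_nil//; exact: cmeasurable_cst.
case: (boolP (P i)) => Pi; last first.
  by apply: (eq_cmeasurable _ IH) => t; rewrite big_cons (negPf Pi).
apply: (@eq_cmeasurable (fun t => F i t * \prod_(j <- r | P j) F j t)).
  by move=> t; rewrite big_cons Pi.
by apply: cmeasurableM => //; exact: mF.
Qed.

Lemma cmeasurable_conj X : cmeasurable X -> cmeasurable (fun t => Num.conj (X t)).
Proof.
move=> [X1 X2]; split.
  by apply: eq_measurable_fun X1 => t _; rewrite conjC_conjc; case: (X t).
apply: (@eq_measurable_fun _ _ _ _ _ (fun t => - complex.Im (X t))).
  by move=> t _; rewrite conjC_conjc; case: (X t).
exact: measurable_funN.
Qed.

Lemma measurable_cmod_sqr X : cmeasurable X ->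
  measurable_fun setT (fun t => cmod (X t) ^+ 2).
Proof.
move=> [X1 X2]; under eq_fun do rewrite cmod_sqr.
by apply: measurable_funD; exact: measurable_funX.
Qed.

(** The inverse is the conjugate divided by the squared modulus, also at [0], where both expressions
    are [0]. *)
Lemma cmeasurableV X : cmeasurable X -> cmeasurable (fun t => (X t)^-1).
Proof.
move=> mX.
(* The real inverse is read as the power with exponent [-1], which is measurable. *)
have mV : measurable_fun setT (fun t => (cmod (X t) ^+ 2)^-1 : R).
  have := measurableT_comp (measurable_powR (-1 : R)) (measurable_cmod_sqr mX).
  by apply: eq_measurable_fun => t _ /=; rewrite powR_inv1 ?sqr_ge0.
apply: (@eq_cmeasurable (fun t => (((cmod (X t) ^+ 2)^-1)%:C)%C * Num.conj (X t))).
  move=> t; have [->|z0] := eqVneq (X t) 0; first by rewrite conjC0 mulr0 invr0.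
  apply: (mulfI z0); rewrite mulrCA mulr_conjC divff//.
  rewrite -rmorphM mulVf// expf_eq0/=; apply: contra z0 => /eqP/Normc.eq0_normc.
  by move=> ->.
by apply: cmeasurableM; [split|exact: cmeasurable_conj].
Qed.

Lemma cmeasurable_det n (A : T -> 'M[C]_n) :
  (forall i j, cmeasurable (fun t => A t i j)) -> cmeasurable (fun t => \det (A t)).
Proof.
move=> mA; rewrite /determinant; apply: cmeasurable_sum => s _.
apply: cmeasurableM; first exact: cmeasurable_cst.
by apply: cmeasurable_prod => i _; exact: mA.
Qed.

(** By Cramer's rule each entry is a cofactor over the determinant, hence a rational function of the
    entries. *)
Lemma cmeasurable_invmx n (A : T -> 'M[C]_n) :
  (forall t, A t \in unitmx) ->
  (forall i j, cmeasurable (fun t => A t i j)) ->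
  forall i j, cmeasurable (fun t => invmx (A t) i j).
Proof.
move=> uA mA i j.
apply: (@eq_cmeasurable (fun t => (\det (A t))^-1 * cofactor (A t) j i)).
  by move=> t; rewrite /invmx uA !mxE.
apply: cmeasurableM; first by apply: cmeasurableV; exact: cmeasurable_det.
rewrite /cofactor; apply: cmeasurableM; first exact: cmeasurable_cst.
apply: cmeasurable_det => i' j'.
by apply: (@eq_cmeasurable (fun t => A t (lift j i') (lift i j'))) => // t; rewrite !mxE.
Qed.

Lemma cmeasurable_mulmx m n p (A : T -> 'M[C]_(m, n)) (B : T -> 'M[C]_(n, p)) :
  (forall i j, cmeasurable (fun t => A t i j)) ->
  (forall i j, cmeasurable (fun t => B t i j)) ->
  forall i j, cmeasurable (fun t => (A t *m B t) i j).
Proof.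
move=> mA mB i j; apply: (@eq_cmeasurable (fun t => \sum_k A t i k * B t k j)).
  by move=> t; rewrite mxE.
by apply: cmeasurable_sum => k _; exact: cmeasurableM.
Qed.

Lemma cmeasurable_ctrmx m n (A : T -> 'M[C]_(m, n)) :
  (forall i j, cmeasurable (fun t => A t i j)) ->
  forall i j, cmeasurable (fun t => ctrmx (A t) i j).
Proof.
move=> mA i j; apply: (@eq_cmeasurable (fun t => Num.conj (A t j i))).
  by move=> t; rewrite !mxE.
exact: cmeasurable_conj.
Qed.

Lemma cmeasurable_ntr n (A : T -> 'M[C]_n) :
  (forall i j, cmeasurable (fun t => A t i j)) -> cmeasurable (fun t => ntr (A t)).
Proof.
move=> mA; apply: cmeasurableM; first exact: cmeasurable_cst.
by apply: cmeasurable_sum => i _; exact: mA.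
Qed.

End complex_measurability.

(** * Rotation invariance of Gaussian vectors *)

Section rotation.
Variable R : realType.
Local Notation mu := (@lebesgue_measure R).
Local Notation gamma := (@normal_prob R 0 1).
Local Open Scope ereal_scope.
Import HBNNSimple.

(** The Radon-Nikodym change of variables asks for an integrable integrand. It is applied to the
    simple functions increasing to [f], and monotone convergence on both sides then allows infinite
    integrals. *)
Lemma ge0_integral_normal_prob (f : R -> \bar R) :
  measurable_fun setT f -> (forall x, 0 <= f x) ->
  \int[gamma]_x f x = \int[mu]_x (f x * (normal_pdf 0 1 x)%:E).
Proof.
move=> mf f0.
have mpdf : measurable_fun setT (EFin \o @normal_pdf R 0 1).
  by apply/measurableT_comp => //; exact: measurable_normal_pdf.
have bounded g : measurable_fun setT g -> \int[gamma]_x `|g x| < +oo ->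
    \int[gamma]_x g x = \int[mu]_x (g x * (normal_pdf 0 1 x)%:E).
  move=> mg gfin; have dom : gamma `<< mu by exact: normal_prob_dominates.
  rewrite -(Radon_Nikodym_change_of_variables dom)//=; last first.
    by apply/integrableP; split.
  apply: ae_eq_integral => //.
  - by apply: emeasurable_funM => //; exact: measurable_int (Radon_Nikodym_integrable dom).
  - exact: emeasurable_funM.
  (* The abstract derivative and the normal density have the same integral over every measurable
     set, hence agree almost everywhere. *)
  - apply: ae_eqe_mul2l => /=; rewrite Radon_NikodymE.
    case: cid => /= h [_ h2 h3]; apply: integral_ae_eq => //= E _ mE.
    by rewrite -h3.
pose f_ := nnsfun_approx measurableT mf.
have mf_ n : measurable_fun setT (EFin \o f_ n) by exact/measurable_EFinP.
have nd_f x a b : (a <= b)%N -> (f_ a x <= f_ b x)%R.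
  by move=> ab; have /lefP := nd_nnsfun_approx measurableT mf ab; exact.
have pdf0 x : 0 <= (@normal_pdf R 0 1 x)%:E by rewrite lee_fin normal_pdf_ge0.
transitivity (lim (\int[gamma]_x (f_ n x)%:E @[n --> \oo])).
  rewrite -monotone_convergence//=.
  - apply: eq_integral => x _; apply/esym/cvg_lim => //=.
    exact: cvg_nnsfun_approx.
  - by move=> n x _; rewrite lee_fin.
  - by move=> x _ a b ab; rewrite lee_fin nd_f.
transitivity (lim (\int[mu]_x ((f_ n x)%:E * (normal_pdf 0 1 x)%:E) @[n --> \oo])).
  apply: congr_lim; apply/funext => n /=.
  have intf : gamma.-integrable setT (EFin \o f_ n).
    apply: measurable_bounded_integrable => //.
    - by rewrite -ge0_fin_numE ?fin_num_measure.
    - by have /measurable_EFinP := mf_ n.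
    - exact: (simple_bounded (f_ n)).
  by apply: bounded; case/integrableP: intf.
transitivity (\int[mu]_x limn (fun n => (f_ n x)%:E * (normal_pdf 0 1 x)%:E)).
  apply/esym; apply: (@monotone_convergence _ _ _ mu setT measurableT
      (fun n x => (f_ n x)%:E * (normal_pdf 0 1 x)%:E)).
  - by move=> n; apply: emeasurable_funM; [exact: mf_|exact: mpdf].
  - by move=> n x _; rewrite mule_ge0// lee_fin.
  - by move=> x _ a b ab; apply: lee_wpmul2r => //; rewrite lee_fin nd_f.
apply: eq_integral => x _; apply/cvg_lim => //.
by apply: cvgeZr => //; exact: cvg_nnsfun_approx.
Qed.

(** The image of Lebesgue measure under a translation gives half-open intervals their length, and
    this characterises Lebesgue measure. *)
Lemma ge0_integral_shift (f : R -> \bar R) (a : R) :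
  measurable_fun setT f -> (forall x, 0 <= f x) ->
  \int[mu]_x f (x + a)%R = \int[mu]_x f x.
Proof.
move=> mf f0.
pose t (x : measurableTypeR R) : measurableTypeR R := (x + a)%R.
have mt : measurable_fun setT t by exact: measurable_funD.
transitivity (\int[pushforward mu t]_x f x).
  by rewrite ge0_integral_pushforward.
apply: eq_measure_integral => /= A mA _.
apply/esym/lebesgue_measure_unique => //= _ [[u v]] _ <- /=.
rewrite /pushforward/=.
have -> : t @^-1` `]u, v]%classic = `](u - a)%R, (v - a)%R]%classic.
  by apply/seteqP; split => x /=; rewrite !in_itv/= ltrBlDr lerBrDr.
by rewrite !lebesgue_measure_itv/= !lte_fin ltrD2r -!EFinD opprB addrA subrK.
Qed.

End rotation.

(** * Planar rotations and the product of two normal laws *)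

Section rotation2.
Variable R : realType.
Local Open Scope ereal_scope.
Local Notation pdf := (@normal_pdf R 0 1).
Local Notation RR := (measurableTypeR R * measurableTypeR R)%type.

(* Instantiated with Lebesgue measure and the standard normal law. *)
Variable mu : {sigma_finite_measure set (measurableTypeR R) -> \bar R}.
Variable gamma : probability (measurableTypeR R) R.
Hypothesis mu_shift : forall (f : measurableTypeR R -> \bar R) (a : R),
  measurable_fun setT f -> (forall x, 0 <= f x) ->
  \int[mu]_x f (x + a)%R = \int[mu]_x f x.
Hypothesis gammaE : forall f : measurableTypeR R -> \bar R,
  measurable_fun setT f -> (forall x, 0 <= f x) ->
  \int[gamma]_x f x = \int[mu]_x (f x * (normal_pdf 0 1 x)%:E).

(** On each line [z.2 = y] the shear is a translation, so Tonelli reduces the claim to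
    [mu_shift]. *)
Lemma ge0_integral_shear1 (h : RR -> \bar R) (a : R) :
  measurable_fun setT h -> (forall z, 0 <= h z) ->
  \int[mu \x mu]_z h (z.1 + a * z.2, z.2)%R = \int[mu \x mu]_z h z.
Proof.
move=> mh h0.
have ms : measurable_fun setT (fun z : RR => (z.1 + a * z.2, z.2)%R : RR).
  apply/measurable_fun_pairP; split => /=; last exact: measurable_snd.
  apply: measurable_funD; first exact: measurable_fst.
  by apply: measurable_funM => //; exact: measurable_snd.
rewrite fubini_tonelli2//; last exact: (measurableT_comp mh ms).
rewrite (fubini_tonelli2 _ mh h0); apply: eq_integral => y _; rewrite /fubini_G/=.
by rewrite (mu_shift (f := fun x => h (x, y)))//; exact: measurableT_comp.
Qed.

Lemma ge0_integral_shear2 (h : RR -> \bar R) (a : R) :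
  measurable_fun setT h -> (forall z, 0 <= h z) ->
  \int[mu \x mu]_z h (z.1, z.2 + a * z.1)%R = \int[mu \x mu]_z h z.
Proof.
move=> mh h0.
have ms : measurable_fun setT (fun z : RR => (z.1, z.2 + a * z.1)%R : RR).
  apply/measurable_fun_pairP; split => /=; first exact: measurable_fst.
  apply: measurable_funD; first exact: measurable_snd.
  by apply: measurable_funM => //; exact: measurable_fst.
rewrite fubini_tonelli1//; last exact: (measurableT_comp mh ms).
rewrite (fubini_tonelli1 _ mh h0); apply: eq_integral => x _; rewrite /fubini_F/=.
by rewrite (mu_shift (f := fun y => h (x, y)))//; exact: measurableT_comp.
Qed.

(** For [c = cos th] and [s = sin th], the first component is the point at angle [th] on the arc
    from [z.1] to [z.2], and the second is the velocity at that point. *)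
Definition rot (c s : R) (z : RR) : RR := (c * z.1 + s * z.2, c * z.2 - s * z.1)%R.

Lemma measurable_rot c s : measurable_fun setT (rot c s).
Proof.
apply/measurable_fun_pairP; split => /=.
  by apply: measurable_funD; apply: measurable_funM => //.
by apply: measurable_funB; apply: measurable_funM => //.
Qed.

(* A rotation is a product of three shears, each of which preserves Lebesgue
   measure by Fubini. *)
Lemma ge0_integral_rot (h : RR -> \bar R) (c s : R) :
  (c ^+ 2 + s ^+ 2 = 1)%R -> (1 + c != 0)%R ->
  measurable_fun setT h -> (forall z, 0 <= h z) ->
  \int[mu \x mu]_z h (rot c s z) = \int[mu \x mu]_z h z.
Proof.
(* [a] is the tangent of the half angle. The shears have coefficients [a], [- s], [a]; the half turn
   [c = -1], for which [a] is infinite, is excluded. *)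
move=> cs c1 mh h0; pose a := (s / (1 + c))%R.
have m1 : measurable_fun setT (fun z : RR => (z.1 + a * z.2, z.2)%R : RR).
  apply/measurable_fun_pairP; split => /=; last exact: measurable_snd.
  apply: measurable_funD; first exact: measurable_fst.
  by apply: measurable_funM => //; exact: measurable_snd.
have m2 : measurable_fun setT (fun z : RR => (z.1, z.2 - s * z.1)%R : RR).
  apply/measurable_fun_pairP; split => /=; first exact: measurable_fst.
  apply: measurable_funB; first exact: measurable_snd.
  by apply: measurable_funM => //; exact: measurable_fst.
rewrite -[RHS](@ge0_integral_shear1 _ a)//.
rewrite -[RHS](@ge0_integral_shear2 _ (- s))//=; last first.
  exact: (measurableT_comp mh m1).
rewrite -[RHS](@ge0_integral_shear1 _ a)//=; last first.
  have := measurableT_comp (measurableT_comp mh m1) m2.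
  by apply: eq_measurable_fun => z _ /=; rewrite mulNr.
apply: eq_integral => -[x y] _ /=; congr h; rewrite /rot/=.
have as_ : (a * (1 + c) = s)%R by rewrite divfK.
have as2 : (a * s = 1 - c)%R.
  apply: (mulfI c1); transitivity (a * (1 + c) * s)%R; first by ring.
  by rewrite as_; move: cs; lra.
congr pair; last by rewrite mulNr mulrDr opprD addrA mulrA [(s * a)%R]mulrC as2; ring.
have -> : (x + a * y + a * (y + - s * (x + a * y)) =
  x + a * y + a * y - (a * s) * (x + a * y))%R by ring.
by rewrite as2 -as_; ring.
Qed.

Lemma ge0_integral_normal_prob2 (h : RR -> \bar R) :
  measurable_fun setT h -> (forall z, 0 <= h z) ->
  \int[gamma \x gamma]_z h z =
  \int[mu \x mu]_z (h z * (pdf z.1 * pdf z.2)%:E).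
Proof.
move=> mh h0.
have pdf0 x : 0 <= (pdf x)%:E by rewrite lee_fin normal_pdf_ge0.
have mpdf : measurable_fun setT (EFin \o pdf).
  by apply/measurableT_comp => //; exact: measurable_normal_pdf.
have mh1 (x : measurableTypeR R) : measurable_fun setT (fun y : measurableTypeR R => h (x, y)).
  exact: measurableT_comp.
have mhp : measurable_fun setT (fun z : RR => h z * (pdf z.1 * pdf z.2)%:E).
  apply: emeasurable_funM => //; apply/measurable_EFinP; apply: measurable_funM.
    by apply: measurableT_comp; [exact: measurable_normal_pdf|exact: measurable_fst].
  by apply: measurableT_comp; [exact: measurable_normal_pdf|exact: measurable_snd].
rewrite fubini_tonelli1//= fubini_tonelli1//; last first.
  by move=> z; rewrite mule_ge0// EFinM mule_ge0.
rewrite gammaE; last 2 first.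
- exact: measurable_fun_fubini_tonelli_F.
- by move=> x; apply: integral_ge0.
apply: eq_integral => x _; rewrite /fubini_F/=.
rewrite gammaE//.
rewrite -ge0_integralZr//; last 2 first.
- by apply: emeasurable_funM.
- by move=> y _; rewrite mule_ge0.
by apply: eq_integral => y _; rewrite EFinM -muleA; congr (_ * _); rewrite muleC.
Qed.

(** The product density depends on [z] only through the sum of the two squares, which a rotation
    preserves. *)
Lemma pdf_rot c s (z : RR) : (c ^+ 2 + s ^+ 2 = 1)%R ->
  (pdf (rot c s z).1 * pdf (rot c s z).2 = pdf z.1 * pdf z.2)%R.
Proof.
move=> cs; rewrite normal_pdfE ?oner_neq0// mulrACA [RHS]mulrACA; congr (_ * _)%R.
rewrite /normal_fun -!expRD; congr expR; rewrite -!mulrDl; congr (_ / _)%R.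
case: z => x y /=; rewrite !subr0 -[RHS]mul1r -cs; ring.
Qed.

(** Both the joint density and [mu \x mu] are invariant; sets are tested through their
    indicators. *)
Lemma product_rot c s (C : set RR) :
  (c ^+ 2 + s ^+ 2 = 1)%R -> (1 + c != 0)%R -> measurable C ->
  (gamma \x gamma) (rot c s @^-1` C) = (gamma \x gamma) C.
Proof.
move=> cs c1 mC.
have mrC : measurable (rot c s @^-1` C).
  by rewrite -[X in measurable X]setTI; exact: measurable_rot.
have E (B : set RR) : measurable B ->
    (gamma \x gamma) B = \int[gamma \x gamma]_z (\1_B z)%:E.
  by move=> mB; rewrite integral_indic// setIT.
have mpdf2 : measurable_fun setT (fun z : RR => (pdf z.1 * pdf z.2)%:E).
  apply/measurable_EFinP; apply: measurable_funM.
    by apply: measurableT_comp; [exact: measurable_normal_pdf|exact: measurable_fst].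
  by apply: measurableT_comp; [exact: measurable_normal_pdf|exact: measurable_snd].
have mind (B : set RR) : measurable B -> measurable_fun setT (fun z : RR => (\1_B z)%:E : \bar R).
  by move=> mB; apply/measurable_EFinP.
have ind0 (B : set RR) z : 0 <= (\1_B z : R)%:E by rewrite lee_fin.
rewrite (E _ mrC) (E _ mC).
rewrite (ge0_integral_normal_prob2 (mind _ mrC) (ind0 _)).
rewrite (ge0_integral_normal_prob2 (mind _ mC) (ind0 _)).
pose H (z : RR) : \bar R := (\1_C z)%:E * (pdf z.1 * pdf z.2)%:E.
have mH : measurable_fun setT H.
  by apply: emeasurable_funM; [exact: mind|exact: mpdf2].
have H0 z : 0 <= H z.
  by rewrite mule_ge0// lee_fin mulr_ge0// normal_pdf_ge0.
rewrite -[RHS](ge0_integral_rot cs c1 mH H0).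
apply: eq_integral => z _; rewrite /H (pdf_rot _ cs); congr (_%:E * _).
Qed.

End rotation2.

Lemma normal_prob2_rot (R : realType) (c s : R)
    (C : set (measurableTypeR R * measurableTypeR R)) :
  c ^+ 2 + s ^+ 2 = 1 -> 1 + c != 0 -> measurable C ->
  (normal_prob 0 1 \x normal_prob 0 1)%E (rot c s @^-1` C) =
  (normal_prob 0 1 \x normal_prob 0 1)%E C.
Proof.
apply: (@product_rot _ (@lebesgue_measure R) (normal_prob 0 1)).
- exact: ge0_integral_shift.
- exact: ge0_integral_normal_prob.
Qed.

(** * Laws of finite families, determined on boxes *)

Section box_laws.
Variables (R : realType) (I : finType).

Definition boxes : set (set (I -> R)) :=
  [set X | exists2 A : I -> set R, (forall i, measurable (A i)) &
    X = [set x | forall i, A i (x i)]].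

(** This is the product sigma-algebra on [I -> R], generated by the very sets on which
    [mutually_independent] is stated. *)
Definition family_space := g_sigma_algebraType boxes.

Lemma measurable_coord (i : I) : measurable_fun setT (fun x : family_space => x i).
Proof.
move=> _ B mB; rewrite setTI; apply: sub_sigma_algebra.
exists (fun j => if j == i then B else setT); first by move=> j; case: ifP.
apply/seteqP; split => x /= h; last by have := h i; rewrite eqxx.
by move=> j; case: eqP => // ->.
Qed.

Lemma measurable_family d (T : measurableType d) (X : T -> family_space) :
  (forall i, measurable_fun setT (fun t => X t i)) -> measurable_fun setT X.
Proof.
move=> mX; apply: (@measurability _ _ T family_space setT X boxes) => //.
move=> _ [_ [A mA ->] <-]; rewrite setTI.
have -> : X @^-1` [set x | forall i, A i (x i)] =
    \bigcap_(i in [set: I]) ((fun t => X t i) @^-1` A i).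
  by apply/seteqP; split => t /= h i; [move=> _; exact: h|exact: h].
apply: fin_bigcap_measurable => // i _.
by rewrite -[X in measurable X]setTI; exact: mX.
Qed.

(** Boxes are stable under intersection and generate the sigma-algebra, so two laws that agree on
    them are equal; both integrals are integrals against this law. *)
Lemma ge0_integral_eq_law d1 d2 (T1 : measurableType d1) (T2 : measurableType d2)
    (P1 : probability T1 R) (P2 : probability T2 R)
    (X1 : T1 -> family_space) (X2 : T2 -> family_space)
    (f : family_space -> \bar R) :
  (forall i, measurable_fun setT (fun t => X1 t i)) ->
  (forall i, measurable_fun setT (fun t => X2 t i)) ->
  (forall A : I -> set R, (forall i, measurable (A i)) ->
    P1 [set t | forall i, A i (X1 t i)] = P2 [set t | forall i, A i (X2 t i)]) ->
  measurable_fun setT f -> (forall x, 0 <= f x)%E ->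
  (\int[P1]_t f (X1 t) = \int[P2]_t f (X2 t))%E.
Proof.
move=> /measurable_family mX1 /measurable_family mX2 eqP mf f0.
pose Y1 : {RV P1 >-> family_space} := mfun_Sub (mem_set mX1).
pose Y2 : {RV P2 >-> family_space} := mfun_Sub (mem_set mX2).
rewrite -[LHS]/(\int[P1]_t (f \o Y1) t)%E -[RHS]/(\int[P2]_t (f \o Y2) t)%E.
rewrite -!ge0_integral_distribution//.
apply: eq_measure_integral => A mA _.
apply: (@g_sigma_algebra_measure_unique _ R family_space boxes _ (fun=> setT) _ _
  (distribution P1 Y1) (distribution P2 Y2)) => //.
- by move=> B bB; exact: sub_sigma_algebra.
- move=> _; exists (fun=> setT) => //.
  by apply/seteqP; split.
- by apply/seteqP; split => // x _; exists 0%N.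
- move=> _ _ [A1 mA1 ->] [A2 mA2 ->]; exists (fun i => A1 i `&` A2 i).
    by move=> i; exact: measurableI.
  apply/seteqP; split => x /=; first by move=> [h1 h2] i; split.
  by move=> h; split => i; case: (h i).
- by move=> _ [B mB ->]; exact: eqP.
- by move=> _; rewrite -ge0_fin_numE ?fin_num_measure.
Qed.

End box_laws.

(** * Joint law of a family and its independent copy *)

Section independent_pairs.
Variables (R : realType) (d : measure_display) (T : measurableType d).
Variable P : probability T R.
Local Notation RR := (measurableTypeR R * measurableTypeR R)%type.
Variables (I : finType) (Z : I -> {RV P >-> R}).
Variables (gamma : set (measurableTypeR R) -> \bar R) (gamma2 : probability RR R).
Hypothesis gamma2E : forall A B, measurable A -> measurable B ->
  gamma2 (A `*` B) = (gamma A * gamma B)%E.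
Hypothesis Z_law : forall j A, measurable A -> P (Z j @^-1` A) = gamma A.
Hypothesis Z_indep : mutually_independent P (fun j t => Z j t).

Let pairZ i (t : T * T) : RR := (Z i t.1, Z i t.2).

Let mpairZ i : measurable_fun setT (pairZ i).
Proof.
apply/measurable_fun_pairP; split => /=.
  by apply: (measurableT_comp (f := Z i)) => //; exact: measurable_fst.
by apply: (measurableT_comp (f := Z i)) => //; exact: measurable_snd.
Qed.

Let measurable_pairs (J : {pred I}) (C : I -> set RR) :
  (forall i, measurable (C i)) ->
  measurable [set t | forall i, i \in J -> C i (pairZ i t)].
Proof.
move=> mC.
have -> : [set t | forall i, i \in J -> C i (pairZ i t)] =
    \bigcap_(i in [set i | i \in J]) (pairZ i @^-1` C i).
  by apply/seteqP; split => t /= h i; exact: h.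
apply: fin_bigcap_measurable => // i _.
by rewrite -[X in measurable X]setTI; exact: mpairZ.
Qed.

(* Rectangles are replaced by arbitrary sets one index at a time: for fixed
   other factors both sides are finite measures in the remaining one. *)
Lemma independent_pairs (C : I -> set RR) : (forall i, measurable (C i)) ->
  (P \x P)%E [set t | forall i, C i (Z i t.1, Z i t.2)] =
  (\prod_(i : I) gamma2 (C i))%E.
Proof.
move=> mC.
(* [s] lists the indices whose factor may be an arbitrary planar set; outside it the factors are
   rectangles. The induction starts from rectangles only and ends with [s] exhausting [I]. *)
suff H (s : seq I) : forall C : I -> set RR, (forall i, measurable (C i)) ->
    (exists A B : I -> set R, [/\ forall i, measurable (A i),
      forall i, measurable (B i) & forall i, i \notin s -> C i = A i `*` B i]) ->
    (P \x P)%E [set t | forall i, C i (Z i t.1, Z i t.2)] =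
    (\prod_(i : I) gamma2 (C i))%E.
  apply: (H (enum I)) => //; exists (fun=> setT), (fun=> setT); split => // i.
  by rewrite mem_enum.
elim: s => [|i0 s IH] {mC}C mC [A [B [mA mB CE]]].
  have -> : [set t | forall i, C i (Z i t.1, Z i t.2)] =
      [set t | forall i, A i (Z i t)] `*` [set t | forall i, B i (Z i t)].
    apply/seteqP; split => -[t t'] /=.
      by move=> h; split => i; have := h i; rewrite CE// => -[].
    by move=> [h h'] i; rewrite CE//.
  have mE (D : I -> set R) : (forall i, measurable (D i)) ->
      measurable [set t | forall i, D i (Z i t)].
    move=> mD; have -> : [set t | forall i, D i (Z i t)] =
        \bigcap_(i in [set: I]) (Z i @^-1` D i).
      by apply/seteqP; split => t /= h i; [move=> _; exact: h|exact: h].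
    apply: fin_bigcap_measurable => // i _.
    by rewrite -[X in measurable X]setTI; exact: measurable_funP.
  transitivity (P [set t | forall i, A i (Z i t)] *
      P [set t | forall i, B i (Z i t)])%E.
    by apply: product_measure1E; exact: mE.
  rewrite (Z_indep mA) (Z_indep mB) -big_split/=; apply: eq_bigr => i _.
  rewrite CE// (gamma2E (mA i) (mB i)); congr (_ * _)%E; exact: Z_law.
pose J : {pred I} := predC1 i0.
pose E0 := [set t | forall i, i \in J -> C i (pairZ i t)].
have mE0 : measurable E0 by exact: measurable_pairs.
pose C' (D : set RR) i := if i == i0 then D else C i.
have mC' D : measurable D -> forall i, measurable (C' D i).
  by move=> mD i; rewrite /C'; case: ifP.
have splitE (D : set RR) :
    [set t | forall i, C' D i (Z i t.1, Z i t.2)] = (pairZ i0 @^-1` D) `&` E0.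
  apply/seteqP; split => t /=.
    move=> h; split; first by have := h i0; rewrite /C' eqxx.
    by move=> i; rewrite !inE => /negPf ii0; have := h i; rewrite /C' ii0.
  move=> [h1 h2] i; rewrite /C'; case: eqP => [->//|/eqP ii0]; exact: h2.
pose K := (\prod_(i | i \in J) gamma2 (C i))%E.
have K0 : (0 <= K)%E by apply: prode_ge0 => i _.
have Kfin : K \is a fin_num.
  apply: (big_ind (fun x => x \is a fin_num)) => [//|x y xf yf|i _].
    exact: fin_numM.
  exact: fin_num_measure.
have prodE (D : set RR) :
    (\prod_(i : I) gamma2 (C' D i) = gamma2 D * K)%E.
  rewrite [LHS](bigD1 i0 isT); congr (_ * _)%E; first by rewrite /C' eqxx.
  by apply: eq_bigr => i /negPf ii0; rewrite /C' ii0.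
pose K' : {nonneg R} := NngNum (fine_ge0 K0).
pose m1 : {measure set RR -> \bar R} := mscale K' gamma2.
pose push : {measure set RR -> \bar R} :=
  pushforward (mrestr (P \x P)%E mE0) (pairZ i0).
pose m2 := push (mpairZ i0).
have m1E (D : set RR) : m1 D = (gamma2 D * K)%E.
  by rewrite /m1 /= /mscale /= fineK// muleC.
have m2E (D : set RR) : m2 D = (P \x P)%E [set t | forall i, C' D i (Z i t.1, Z i t.2)].
  by rewrite splitE.
pose G : set (set RR) := [set A `*` B | A in measurable & B in measurable].
have CE0 : C = C' (C i0) by apply/funext => i; rewrite /C'; case: eqP => // ->.
rewrite CE0 prodE -m2E -m1E.
apply: (@g_sigma_algebra_measure_unique _ R RR G _ (fun=> setT) _ _ m2 m1).
- by move=> _ [A1 mA1 [B1 mB1 <-]]; exact: measurableX.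
- by move=> _; exists setT => //; exists setT => //; rewrite setXTT.
- by apply/seteqP; split => // x _; exists 0%N.
- move=> _ _ [A1 mA1 [B1 mB1 <-]] [A2 mA2 [B2 mB2 <-]].
  exists (A1 `&` A2); first exact: measurableI.
  by exists (B1 `&` B2); [exact: measurableI|rewrite setXI].
- move=> _ [A1 mA1 [B1 mB1 <-]]; rewrite m1E m2E -prodE; apply: IH.
    by apply: mC'; exact: measurableX.
  exists (fun i => if i == i0 then A1 else A i), (fun i => if i == i0 then B1 else B i).
  split=> [i|i|i is_]; [by case: ifP|by case: ifP|].
  by rewrite /C'; case: (eqVneq i i0) => // ii0; rewrite CE// inE negb_or ii0.
- move=> _; rewrite m2E; apply: (le_lt_trans (probability_le1 _ _)); last exact: ltry.
  rewrite splitE; apply: measurableI => //.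
  by rewrite -[X in measurable X]setTI; exact: mpairZ.
- by rewrite -measurable_prod_measurableType.
Qed.

End independent_pairs.

Section rotated_pairs.
Variables (R : realType) (d : measure_display) (T : measurableType d).
Variable P : probability T R.
Variables (I : finType) (Z : I -> {RV P >-> R}).
Hypothesis Z_normal : forall j, standard_normal P (Z j).
Hypothesis Z_indep : mutually_independent P (fun j t => Z j t).

(** Joins two vectors into one family over [I + I], so that functions of a pair are measured on a
    single [family_space]. *)
Definition pairing (x y : I -> R) (i : I + I) : R :=
  match i with inl i => x i | inr i => y i end.

Let Zv (t : T) (i : I) : R := Z i t.

Let mZ1 i : measurable_fun setT (fun t : T * T => Z i t.1).
Proof. by apply: (measurableT_comp (f := Z i)) => //; exact: measurable_fst. Qed.

Let mZ2 i : measurable_fun setT (fun t : T * T => Z i t.2).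
Proof. by apply: (measurableT_comp (f := Z i)) => //; exact: measurable_snd. Qed.

(** A box over [I + I] is one rectangle for each [i]. The rotation acts on each pair
    [(Z i t.1, Z i t.2)] separately and preserves its planar normal law, so the product over [i] is
    unchanged. *)
Lemma ge0_integral_rotated_pairs (c s : R) (g : (I -> R) -> (I -> R) -> \bar R) :
  c ^+ 2 + s ^+ 2 = 1 -> 1 + c != 0 ->
  measurable_fun setT (fun u : family_space R (I + I)%type =>
    g (u \o inl) (u \o inr)) ->
  (forall x y, 0 <= g x y)%E ->
  (\int[P \x P]_t g (fun i => c * Z i t.1 + s * Z i t.2)%R
                  (fun i => c * Z i t.2 - s * Z i t.1)%R =
   \int[P \x P]_t g (Zv t.1) (Zv t.2))%E.
Proof.
move=> cs c1 mg g0.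
pose RR := (measurableTypeR R * measurableTypeR R)%type.
pose gamma2 : probability RR R := (normal_prob 0 1 \x normal_prob 0 1)%E.
have pairs := @independent_pairs R d T P I Z (normal_prob 0 1) gamma2
  (@product_measure1E _ _ _ _ _ _ _) Z_normal Z_indep.
pose U (t : T * T) : family_space R (I + I)%type := pairing (Zv t.1) (Zv t.2).
pose V (t : T * T) : family_space R (I + I)%type :=
  pairing (fun i => c * Z i t.1 + s * Z i t.2)
          (fun i => c * Z i t.2 - s * Z i t.1).
pose f (u : family_space R (I + I)%type) := g (u \o inl) (u \o inr).
rewrite -[LHS]/(\int[P \x P]_t f (V t))%E -[RHS]/(\int[P \x P]_t f (U t))%E.
apply: ge0_integral_eq_law => //.
- move=> [i|i] /=.
    by apply: measurable_funD; apply: measurable_funM.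
  by apply: measurable_funB; apply: measurable_funM.
- by move=> [i|i]; [exact: mZ1|exact: mZ2].
- move=> A mA.
  pose C (i : I) : set RR := A (inl i) `*` A (inr i).
  have mC i : measurable (C i) by apply: measurableX; exact: mA.
  have -> : [set t | forall i, A i (V t i)] =
      [set t | forall i, (rot c s @^-1` C i) (Z i t.1, Z i t.2)].
    apply/seteqP; split => t /= h i; first by split; [exact: (h (inl i))|exact: (h (inr i))].
    by case: i => i; case: (h i).
  have -> : [set t | forall i, A i (U t i)] =
      [set t | forall i, C i (Z i t.1, Z i t.2)].
    apply/seteqP; split => t /= h i; first by split; [exact: (h (inl i))|exact: (h (inr i))].
    by case: i => i; case: (h i).
  have mrC i : measurable (rot c s @^-1` C i).
    by rewrite -[X in measurable X]setTI; apply: measurable_rot.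
  apply: (etrans (pairs _ mrC)); apply/esym/(etrans (pairs _ mC)).
  by apply: eq_bigr => i _; apply/esym; exact: normal_prob2_rot.
- by move=> u; exact: g0.
Qed.

End rotated_pairs.

(** * The Gaussian Poincare inequality *)

Section normal_moments.
Variables (R : realType) (d : measure_display) (T : measurableType d).
Variables (P : probability T R) (Z : {RV P >-> R}).
Hypothesis Z_normal : standard_normal P Z.
Local Notation mu := (@lebesgue_measure R).
Local Notation pdf := (@normal_pdf R 0 1).

Lemma ge0_integral_standard_normal (f : R -> \bar R) :
  measurable_fun setT f -> (forall x, 0 <= f x)%E ->
  (\int[P]_t f (Z t) = \int[mu]_x (f x * (pdf x)%:E))%E.
Proof.
move=> mf f0; rewrite -ge0_integral_normal_prob//.
have mZ : @measurable_fun _ _ T (measurableTypeR R) setT Z := measurable_funP Z.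
apply: (etrans (esym (@ge0_integral_pushforward _ _ T (measurableTypeR R) R Z mZ P
  setT f measurableT mf (fun x _ => f0 x)))).
by apply: eq_measure_integral => A mA _; exact: Z_normal.
Qed.

(** Half of the Gaussian exponent absorbs the power: [expR (x ^+ 2 / 4)] dominates
    [(x ^+ 2 / 4) ^+ n] divided by the factorial of [n], and the other half is the exponent of the
    normal density of variance [2]. The term [pdf x] takes care of the points with modulus at most
    [1]. *)
Lemma sqr_exp_pdf_le (n : nat) (x : R) :
  `|x| ^+ n * pdf x <= pdf x + 4 ^+ n * n`!%:R * (normal_peak 1 / normal_peak (Num.sqrt 2))
     * normal_pdf 0 (Num.sqrt 2) x.
Proof.
have s2 : Num.sqrt 2 != 0 :> R by rewrite sqrtr_eq0 -ltNge ltr0n.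
rewrite (normal_pdfE 0 s2) (normal_pdfE 0 (oner_neq0 R))/=.
have -> : normal_fun 0 (Num.sqrt 2) x = expR (- (x ^+ 2 / 4)) :> R.
  by rewrite /normal_fun subr0 sqr_sqrtr// mulNr; congr (expR (- (_ / _))); rewrite -mulr_natr; ring.
have -> : normal_fun 0 1 x = expR (- (x ^+ 2 / 4)) * expR (- (x ^+ 2 / 4)) :> R.
  rewrite /normal_fun subr0 -expRD expr1n; congr expR; by field.
set e := expR (- (x ^+ 2 / 4)); set p := @normal_peak R 1; set p2 := @normal_peak R (Num.sqrt 2).
have p0 : 0 < p by apply: normal_peak_gt0; exact: oner_neq0.
have p20 : 0 < p2 by exact: normal_peak_gt0.
have e0 : 0 < e by exact: expR_gt0.
have -> : 4 ^+ n * n`!%:R * (p / p2) * (p2 * e) = p * (4 ^+ n * n`!%:R * e).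
  by field; rewrite gt_eqF.
suff H : `|x| ^+ n <= 1 + 4 ^+ n * n`!%:R * expR (x ^+ 2 / 4).
  have -> : `|x| ^+ n * (p * (e * e)) = p * e * (`|x| ^+ n * e) by ring.
  have -> : p * (e * e) + p * (4 ^+ n * n`!%:R * e) = p * e * (e + 4 ^+ n * n`!%:R).
    by ring.
  rewrite ler_pM2l ?mulr_gt0// (le_trans (ler_wpM2r (ltW e0) H))//.
  have ee : expR (x ^+ 2 / 4) * e = 1 by rewrite /e -expRD subrr expR0.
  by rewrite mulrDl mul1r -(mulrA (4 ^+ n * n`!%:R)) ee mulr1.
have [x1|x1] := leP `|x| 1.
  rewrite (@le_trans _ _ 1)//; first exact: exprn_ile1.
  by rewrite lerDl mulr_ge0 ?expR_ge0// mulr_ge0// exprn_ge0.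
apply: (@le_trans _ _ ((x ^+ 2) ^+ n)).
  rewrite -[x ^+ 2]real_normK ?num_real// -exprM mulnC.
  by apply: ler_weXn2l; [exact: ltW|rewrite muln2 -addnn leq_addr].
case: n => [|n]; first by rewrite !expr0 fact0 !mul1r lerDl expR_ge0.
have u0 : 0 <= x ^+ 2 / 4 by rewrite divr_ge0 ?sqr_ge0.
have h := expR_ge1Dxn n u0; rewrite expr_div_n -mulrA -invfM in h.
have pos : 0 < 4 ^+ n.+1 * (n.+1)`!%:R :> R.
  by rewrite mulr_gt0 ?exprn_gt0// ltr0n fact_gt0.
apply: (@le_trans _ _ (4 ^+ n.+1 * (n.+1)`!%:R * expR (x ^+ 2 / 4))); last by rewrite lerDr.
by rewrite -ler_pdivrMl// mulrC; apply: le_trans h; rewrite lerDr.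
Qed.

(** The dominating function is a combination of two densities, each of integral [1]. *)
Lemma standard_normal_moment (n : nat) :
  (\int[P]_t (`|Z t| ^+ n)%:E < +oo)%E.
Proof.
have mf : measurable_fun setT (fun x : R => (`|x| ^+ n)%:E).
  by apply/measurable_EFinP; apply: measurable_funX; exact: normr_measurable.
rewrite (@ge0_integral_standard_normal (fun x => (`|x| ^+ n)%:E))//.
pose c : R := 4 ^+ n * n`!%:R * (normal_peak 1 / normal_peak (Num.sqrt 2)).
have c0 : 0 <= c.
  by apply: mulr_ge0; [exact: mulr_ge0|rewrite divr_ge0 ?normal_peak_ge0].
have mpdf m s : measurable_fun setT (fun x : R => (@normal_pdf R m s x)%:E).
  by apply/measurable_EFinP; exact: measurable_normal_pdf.
apply: (@le_lt_trans _ _ (\int[mu]_x ((pdf x)%:E + c%:E * (normal_pdf 0 (Num.sqrt 2) x)%:E))%E).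
  apply: ge0_le_integral => //=.
  - by move=> x _; rewrite mule_ge0// lee_fin ?normal_pdf_ge0 ?exprn_ge0.
  - by apply: emeasurable_funM; [exact: mf|exact: mpdf].
  - by apply: emeasurable_funD; [exact: mpdf|apply: emeasurable_funM; [exact: measurable_cst|exact: mpdf]].
  - by move=> x _; rewrite -!EFinM -EFinD lee_fin; exact: sqr_exp_pdf_le.
have pdf0 m s x : (0 <= (@normal_pdf R m s x)%:E)%E by rewrite lee_fin normal_pdf_ge0.
rewrite ge0_integralD//.
- rewrite ge0_integralZl_EFin//; last exact: mpdf.
  by rewrite !integral_normal_pdf mule1 -EFinD ltry.
- exact: mpdf.
- by move=> x _; rewrite mule_ge0.
- by apply: emeasurable_funM; [exact: measurable_cst|exact: mpdf].
Qed.

Lemma ge0_integral_standard_normalN (f : R -> \bar R) :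
  measurable_fun setT f -> (forall x, 0 <= f x)%E ->
  (\int[P]_t f (- Z t)%R = \int[P]_t f (Z t))%E.
Proof.
move=> mf f0.
have mfN : measurable_fun setT (fun x : R => f (- x)%R).
  by apply: (measurableT_comp mf); exact: oppr_measurable.
rewrite (@ge0_integral_standard_normal (fun x => f (- x)%R))// ge0_integral_standard_normal//.
pose t (x : measurableTypeR R) : measurableTypeR R := (- x)%R.
have mt : measurable_fun setT t by exact: oppr_measurable.
have mpdf : measurable_fun setT (fun x : R => (pdf x)%:E).
  by apply/measurable_EFinP; exact: measurable_normal_pdf.
have pdf0 x : (0 <= (pdf x)%:E)%E by rewrite lee_fin normal_pdf_ge0.
transitivity (\int[pushforward mu t]_x (f x * (pdf x)%:E))%E; last first.
  by apply: eq_measure_integral => A mA _; exact: lebesgue_measureN.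
pose g (x : measurableTypeR R) : \bar R := (f x * (pdf x)%:E)%E.
have mg : measurable_fun setT g by apply: emeasurable_funM; [exact: mf|exact: mpdf].
have g0 x : (0 <= g x)%E by rewrite mule_ge0.
apply: (etrans _ (esym (@ge0_integral_pushforward _ _ (measurableTypeR R) (measurableTypeR R)
  R t mt mu setT g measurableT mg (fun x _ => g0 x)))).
apply: eq_integral => x _; rewrite /g/=; congr (_ * _%:E)%E.
by rewrite !(normal_pdfE _ (oner_neq0 _)) /normal_fun/= !subr0 sqrrN.
Qed.

Lemma standard_normal_integrable : P.-integrable setT (fun t => (Z t)%:E).
Proof.
apply/integrableP; split; first by apply/measurable_EFinP.
have := standard_normal_moment 1; by under eq_integral do rewrite expr1.
Qed.

(** By symmetry of the law the positive and negative parts have the same integral, finite by the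
    first moment. *)
Lemma standard_normal_mean : (\int[P]_t (Z t)%:E = 0)%E.
Proof.
have intZ := standard_normal_integrable.
rewrite integralE.
have -> : (\int[P]_t ((fun t => (Z t)%:E)^\- t) = \int[P]_t ((fun t => (Z t)%:E)^\+ t))%E.
  pose f (x : R) : \bar R := maxe x%:E 0%E.
  have mf : measurable_fun setT f by apply: measurable_maxe => //.
  have f0 x : (0 <= f x)%E by rewrite le_max lexx orbT.
  transitivity (\int[P]_t f (- Z t)%R)%E.
    by apply: eq_integral => t _; rewrite funenegE /f EFinN.
  rewrite (ge0_integral_standard_normalN mf f0).
  by apply: eq_integral => t _; rewrite funeposE.
rewrite subee// fin_numElt.
apply/andP; split; last exact: integral_funepos_lt_pinfty.
by apply: lt_le_trans (integral_ge0 _ _).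
Qed.

End normal_moments.

(** * Increment of a function under a small rotation *)

Section small_rotation.
Variable R : realType.
Local Notation C := R[i].

Lemma normr_sin_le (h : R) : 0 <= h -> `|sin h| <= h.
Proof.
move=> h0; have [c _] : exists2 c, c \in `[0, h] & sin h - sin 0 = cos c * (h - 0).
  apply: MVT_segment => //.
  by apply: continuous_subspaceT => x; exact: continuous_sin.
rewrite sin0 !subr0 => ->; rewrite normrM (ger0_norm h0).
by rewrite -[leRHS]mul1r ler_wpM2r// cos_max.
Qed.

Lemma normr_cosB1_le (h : R) : 0 <= h -> `|cos h - 1| <= h ^+ 2 / 2.
Proof.
move=> h0; have -> : cos h - 1 = - (sin (h / 2) ^+ 2 *+ 2).
  rewrite {1}(splitr h) -mulr2n cos_mulr2n cos2sin2.
  by ring.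
rewrite normrN ger0_norm; last by rewrite mulrn_wge0// sqr_ge0.
have h20 : 0 <= h / 2 by rewrite divr_ge0.
have := normr_sin_le h20; rewrite -ler_sqr ?nnegrE// real_normK ?num_real// => H.
by rewrite -mulr_natr; nra.
Qed.

Variable I : finType.
Implicit Types x y v : I -> R.

(** Growth is measured in this norm because, being a sum over coordinates, its moments reduce to
    those of one normal variable. *)
Definition l1 x : R := \sum_i `|x i|.

Lemma l1_ge0 x : 0 <= l1 x.
Proof. by apply: sumr_ge0. Qed.

Lemma l1_lincomb_le (a b : R) x y : l1 (fun i => a * x i + b * y i) <= `|a| * l1 x + `|b| * l1 y.
Proof.
rewrite /l1 !mulr_sumr -big_split/=; apply: ler_sum => i _.
by rewrite -!normrM ler_normD.
Qed.

(** The displacement is [(cos h - 1) x + sin h y], of which only the part along [y] is of first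
    order in [h]. It yields [h DF x y]; the rest is of order [h ^+ 2] with polynomial growth.
    Squaring a sum of two terms gives the factors [2]. *)
Lemma small_rotation_le (F : (I -> R) -> C) (DF : (I -> R) -> (I -> R) -> C)
    (K : R) (p : nat) :
  0 <= K ->
  (forall x y v a b, DF x (fun i => a * y i + b * v i) =
    (a%:C)%C * DF x y + (b%:C)%C * DF x v) ->
  (forall x v, cmod (DF x v) <= K * l1 v * (1 + l1 x + l1 v) ^+ p) ->
  (forall x v, cmod (F (fun i => x i + v i) - F x - DF x v) <=
    K * l1 v ^+ 2 * (1 + l1 x + l1 v) ^+ p) ->
  forall (h : R) x y, 0 <= h <= 2 ->
  cmod (F (fun i => cos h * x i + sin h * y i) - F x) ^+ 2 <=
  2 * h ^+ 2 * cmod (DF x y) ^+ 2 +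
  2 * h ^+ 4 * (2 * K * 3 ^+ p * (1 + l1 x + l1 y) ^+ (p + 2)) ^+ 2.
Proof.
move=> K0 DFlin DFle Fle h x y /andP[h0 h2].
pose a := l1 x; pose b := l1 y; pose m := 1 + a + b.
have a0 : 0 <= a by exact: l1_ge0.
have b0 : 0 <= b by exact: l1_ge0.
have m0 : 0 <= m by rewrite !addr_ge0.
have ch := normr_cosB1_le h0; have sh := normr_sin_le h0.
(* With [h <= 2] both coefficients of the displacement [v] are at most [h]. *)
have hh : h ^+ 2 / 2 <= h by nra.
pose v i := (cos h - 1) * x i + sin h * y i.
have -> : (fun i => cos h * x i + sin h * y i) = (fun i => x i + v i).
  by apply/funext => i; rewrite /v; ring.
have vle : l1 v <= h * m.
  apply: (le_trans (l1_lincomb_le _ _ _ _)); rewrite -/a -/b.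
  apply: (@le_trans _ _ (h * a + h * b)).
    by apply: lerD; apply: ler_wpM2r => //; apply: le_trans hh.
  by rewrite -mulrDr ler_wpM2l// /m; lra.
have v0 : 0 <= l1 v by exact: l1_ge0.
have mp : (0 <= (3 * m) ^+ p) by rewrite exprn_ge0// mulr_ge0.
(* As [l1 v <= h * m <= 2 * m], the base [1 + l1 x + l1 v] is at most [3 * m]; this is the origin of
   [3 ^+ p]. *)
have r1 : cmod (F (fun i => x i + v i) - F x - DF x v) <= K * (h * m) ^+ 2 * (3 * m) ^+ p.
  apply: (le_trans (Fle x v)); apply: ler_pM.
  - by rewrite mulr_ge0// exprn_ge0.
  - by rewrite exprn_ge0// !addr_ge0.
  - by rewrite ler_wpM2l// ler_sqr ?nnegrE ?mulr_ge0.
  - rewrite lerXn2r ?nnegrE ?mulr_ge0 ?addr_ge0// -/a.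
    have : h * m <= 2 * m by rewrite ler_wpM2r.
    by rewrite /m in vle *; lra.
have r2 : cmod (DF x x) <= K * m * (3 * m) ^+ p.
  apply: (le_trans (DFle x x)); rewrite -/a; apply: ler_pM.
  - by rewrite mulr_ge0.
  - by rewrite exprn_ge0// !addr_ge0.
  - by rewrite ler_wpM2l// /m; lra.
  - by rewrite lerXn2r ?nnegrE ?mulr_ge0 ?addr_ge0// /m; lra.
have m1 : 1 <= m by rewrite /m; lra.
set E := 2 * K * 3 ^+ p * _.
have EE : E = 2 * K * m ^+ 2 * (3 * m) ^+ p.
  by rewrite /E -/a -/b -/m exprMn exprD; ring.
have key : cmod (F (fun i => x i + v i) - F x) <= h * cmod (DF x y) + h ^+ 2 * E.
  have -> : F (fun i => x i + v i) - F x =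
      (F (fun i => x i + v i) - F x - DF x v) +
      (((cos h - 1)%:C)%C * DF x x + ((sin h)%:C)%C * DF x y).
    by rewrite -DFlin subrK.
  apply: (le_trans (cmodD_le _ _)); apply: (le_trans (lerD r1 (cmodD_le _ _))).
  rewrite !cmodM !cmod_real.
  have t1 : `|cos h - 1| * cmod (DF x x) <= h ^+ 2 / 2 * (K * m * (3 * m) ^+ p).
    by apply: ler_pM => //; exact: cmod_ge0.
  have t2 : `|sin h| * cmod (DF x y) <= h * cmod (DF x y).
    by rewrite ler_wpM2r// cmod_ge0.
  have t3 : h ^+ 2 / 2 * (K * m * (3 * m) ^+ p) <= h ^+ 2 * (K * m ^+ 2 * (3 * m) ^+ p).
    have A0 : 0 <= h ^+ 2 * (K * m * (3 * m) ^+ p).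
      by rewrite mulr_ge0 ?sqr_ge0// !mulr_ge0.
    have -> : h ^+ 2 / 2 * (K * m * (3 * m) ^+ p) = h ^+ 2 * (K * m * (3 * m) ^+ p) * 2^-1.
      by ring.
    have -> : h ^+ 2 * (K * m ^+ 2 * (3 * m) ^+ p) = h ^+ 2 * (K * m * (3 * m) ^+ p) * m.
      by ring.
    by rewrite ler_wpM2l//; lra.
  rewrite EE.
  have -> : K * (h * m) ^+ 2 * (3 * m) ^+ p = h ^+ 2 * (K * m ^+ 2 * (3 * m) ^+ p) by ring.
  have -> : h ^+ 2 * (2 * K * m ^+ 2 * (3 * m) ^+ p) =
     h ^+ 2 * (K * m ^+ 2 * (3 * m) ^+ p) + h ^+ 2 * (K * m ^+ 2 * (3 * m) ^+ p) by ring.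
  by lra.
have E0 : 0 <= E by rewrite EE !mulr_ge0 ?sqr_ge0.
have d0 := cmod_ge0 (DF x y).
apply: (@le_trans _ _ ((h * cmod (DF x y) + h ^+ 2 * E) ^+ 2)).
  by rewrite ler_sqr ?nnegrE ?cmod_ge0// addr_ge0// mulr_ge0// sqr_ge0.
have := sqr_ge0 (h * cmod (DF x y) - h ^+ 2 * E).
have -> : h ^+ 4 = h ^+ 2 * h ^+ 2 by rewrite -exprD.
by nra.
Qed.

End small_rotation.

Section power_means.
Variables (R : realType) (J : finType).

(** Both sides are compared with the largest of [1] and the [b j]: the base on the left is at most
    [1 + #|J|] times it, and its power is one of the terms on the right. *)
Lemma expr_1Dsum_le (b : J -> R) (q : nat) : (forall j, 0 <= b j) ->
  (1 + \sum_j b j) ^+ q <= (1 + #|J|%:R) ^+ q * (1 + \sum_j b j ^+ q).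
Proof.
move=> b0; pose M := \big[Num.max/1]_j b j.
have M1 : 1 <= M by exact: bigmax_ge_id.
have Mb j : b j <= M by exact: le_bigmax.
have S0 : 0 <= \sum_j b j ^+ q by apply: sumr_ge0 => j _; exact: exprn_ge0.
have ME : M = 1 \/ exists j, M = b j.
  rewrite /M; elim/big_ind: _ => [|x y hx hy|j _]; [by left| |by right; exists j].
  by case: (leP x y).
have Mq : M ^+ q <= 1 + \sum_j b j ^+ q.
  case: ME => [->|[j ->]]; first by rewrite expr1n lerDl.
  rewrite (bigD1 j)//= addrCA lerDl addr_ge0//.
  by apply: sumr_ge0 => i _; exact: exprn_ge0.
apply: (@le_trans _ _ (((1 + #|J|%:R) * M) ^+ q)).
  rewrite lerXn2r ?nnegrE ?addr_ge0 ?mulr_ge0 ?addr_ge0 ?(le_trans _ M1)//.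
    exact: sumr_ge0.
  rewrite mulrDl mul1r lerD// mulr_natl -sumr_const; exact: ler_sum.
by rewrite exprMn ler_wpM2l// exprn_ge0// addr_ge0.
Qed.

End power_means.

Section gaussian_pairs.
Variables (R : realType) (d : measure_display) (T : measurableType d).
Variable P : probability T R.
Variables (I : finType) (Z : I -> {RV P >-> R}).
Hypothesis Z_normal : forall j, standard_normal P (Z j).
Hypothesis Z_indep : mutually_independent P (fun j t => Z j t).
Local Notation C := R[i].
Let Zv (t : T) (i : I) : R := Z i t.

Lemma measurable_fst_RV i : measurable_fun setT (fun t : T * T => Z i t.1).
Proof. by apply: (measurableT_comp (f := Z i)) => //; exact: measurable_fst. Qed.

Lemma measurable_snd_RV i : measurable_fun setT (fun t : T * T => Z i t.2).
Proof. by apply: (measurableT_comp (f := Z i)) => //; exact: measurable_snd. Qed.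

Lemma ge0_integral_fst (f : T -> \bar R) : measurable_fun setT f ->
  (forall t, 0 <= f t)%E -> (\int[P \x P]_t f t.1 = \int[P]_t f t)%E.
Proof.
move=> mf f0.
have mf1 : measurable_fun setT (fun t : T * T => f t.1) by apply: measurableT_comp.
rewrite (fubini_tonelli1 _ mf1 (fun t => f0 t.1)); apply: eq_integral => x _.
by rewrite /fubini_F/= integral_cst//= probability_setT mule1.
Qed.

Lemma ge0_integral_snd (f : T -> \bar R) : measurable_fun setT f ->
  (forall t, 0 <= f t)%E -> (\int[P \x P]_t f t.2 = \int[P]_t f t)%E.
Proof.
move=> mf f0.
have mf1 : measurable_fun setT (fun t : T * T => f t.2) by apply: measurableT_comp.
rewrite (fubini_tonelli2 _ mf1 (fun t => f0 t.2)); apply: eq_integral => x _.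
by rewrite /fubini_G/= integral_cst//= probability_setT mule1.
Qed.

(** After [expr_1Dsum_le] every term involves one coordinate of one copy, so only one-dimensional
    moments remain. *)
Lemma gaussian_moment_lty (q : nat) :
  (\int[P \x P]_t ((1 + l1 (Zv t.1) + l1 (Zv t.2)) ^+ q)%:E < +oo)%E.
Proof.
pose b (j : I + I) (t : T * T) : R := match j with inl i => `|Z i t.1| | inr i => `|Z i t.2| end.
have mb j : measurable_fun setT (b j).
  case: j => i /=.
    by apply: (measurableT_comp (@normr_measurable R setT)); exact: measurable_fst_RV.
  by apply: (measurableT_comp (@normr_measurable R setT)); exact: measurable_snd_RV.
have b0 j t : 0 <= b j t by case: j => i; rewrite /b.
have sumb t : l1 (Zv t.1) + l1 (Zv t.2) = \sum_j b j t by rewrite big_sumType.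
pose c : R := (1 + #|{: I + I}|%:R) ^+ q.
have c0 : 0 <= c by rewrite exprn_ge0// addr_ge0.
have mbq j : measurable_fun setT (fun t => (b j t ^+ q)%:E).
  by apply/measurable_EFinP; exact: measurable_funX.
have bq0 j t : (0 <= (b j t ^+ q)%:E)%E by rewrite lee_fin exprn_ge0.
apply: (@le_lt_trans _ _ (\int[P \x P]_t (c%:E * (1%:E + \sum_j (b j t ^+ q)%:E)))%E).
  apply: ge0_le_integral => //.
  - by move=> t _; rewrite lee_fin exprn_ge0// !addr_ge0// l1_ge0.
  - under eq_fun do rewrite -addrA sumb.
    apply/measurable_EFinP; apply: measurable_funX; apply: measurable_funD => //.
    exact: measurable_sum.
  - apply: emeasurable_funM => //; apply: emeasurable_funD => //.
    by apply: emeasurable_sum.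
  - move=> t _; rewrite sumEFin -EFinD -EFinM lee_fin -addrA sumb.
    by apply: expr_1Dsum_le => j.
have S0 t : (0 <= \sum_j (b j t ^+ q)%:E)%E by apply: sume_ge0.
rewrite ge0_integralZl_EFin//; last 2 first.
- by move=> t _; rewrite adde_ge0.
- by apply: emeasurable_funD => //; apply: emeasurable_sum.
rewrite ge0_integralD//; last by apply: emeasurable_sum.
rewrite integral_cst//= probability_setT mul1e.
rewrite ge0_integral_sum//.
have fin : (\sum_j \int[P \x P]_t (b j t ^+ q)%:E < +oo)%E.
  apply: lte_sum_pinfty => -[i|i] _ /=.
    have := @ge0_integral_fst (fun t => (`|Z i t| ^+ q)%:E) _ _ => ->.
    - exact: standard_normal_moment.
    - apply/measurable_EFinP; apply: measurable_funX.
      exact: (measurableT_comp (@normr_measurable R setT)).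
    - by move=> t; rewrite lee_fin exprn_ge0.
  have := @ge0_integral_snd (fun t => (`|Z i t| ^+ q)%:E) _ _ => ->.
  - exact: standard_normal_moment.
  - apply/measurable_EFinP; apply: measurable_funX.
    exact: (measurableT_comp (@normr_measurable R setT)).
  - by move=> t; rewrite lee_fin exprn_ge0.
by rewrite lte_mul_pinfty// lte_add_pinfty// ltry.
Qed.

End gaussian_pairs.

(** * The quarter circle between two independent copies *)

Section poincare.
Variables (R : realType) (d : measure_display) (T : measurableType d).
Variable P : probability T R.
Variables (I : finType) (Z : I -> {RV P >-> R}).
Hypothesis Z_normal : forall j, standard_normal P (Z j).
Hypothesis Z_indep : mutually_independent P (fun j t => Z j t).
Local Notation C := R[i].
Let Zv (t : T) (i : I) : R := Z i t.

Variables (F : (I -> R) -> C) (DF : (I -> R) -> (I -> R) -> C) (K : R) (p : nat).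
Hypothesis K_ge0 : 0 <= K.
Hypothesis DF_linear : forall x y v a b, DF x (fun i => a * y i + b * v i) =
    (a%:C)%C * DF x y + (b%:C)%C * DF x v.
Hypothesis DF_le : forall x v, cmod (DF x v) <= K * l1 v * (1 + l1 x + l1 v) ^+ p.
Hypothesis F_taylor : forall x v, cmod (F (fun i => x i + v i) - F x - DF x v) <=
    K * l1 v ^+ 2 * (1 + l1 x + l1 v) ^+ p.
Hypothesis F_meas : cmeasurable (F : family_space R I -> C).
Hypothesis DF_meas : cmeasurable (fun u : family_space R (I + I)%type => DF (u \o inl) (u \o inr)).

Let dist2 x y : \bar R := (cmod (F x - F y) ^+ 2)%:E.

Let dist2_ge0 x y : (0 <= dist2 x y)%E.
Proof. by rewrite lee_fin sqr_ge0. Qed.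

Let cmeasurable_F d' (T' : measurableType d') (X : T' -> I -> R) :
  (forall i, measurable_fun setT (fun t => X t i)) -> cmeasurable (fun t => F (X t)).
Proof.
move=> /measurable_family mX; case: F_meas => m1 m2; split.
  exact: (measurableT_comp m1 mX).
exact: (measurableT_comp m2 mX).
Qed.

Let measurable_dist2 d' (T' : measurableType d') (X Y : T' -> I -> R) :
  (forall i, measurable_fun setT (fun t => X t i)) ->
  (forall i, measurable_fun setT (fun t => Y t i)) ->
  measurable_fun setT (fun t => dist2 (X t) (Y t)).
Proof.
move=> mX mY; apply/measurable_EFinP; apply: measurable_cmod_sqr.
apply: cmeasurableD; first exact: cmeasurable_F.
apply: (@eq_cmeasurable _ _ _ (fun t => (-1) * F (Y t))); first by move=> t; rewrite mulN1r.
by apply: cmeasurableM; [exact: cmeasurable_cst|exact: cmeasurable_F].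
Qed.

Let mZ1 := measurable_fst_RV Z.
Let mZ2 := measurable_snd_RV Z.

Let lincomb (a b : R) (t : T * T) (i : I) : R := a * Z i t.1 + b * Z i t.2.

Let measurable_lincomb a b i : measurable_fun setT (fun t => lincomb a b t i).
Proof. by apply: measurable_funD; apply: measurable_funM. Qed.

(** By the addition formulas the arc from [th] to [th + h] is the arc from [0] to [h] for the pair
    rotated by [th]. The range of [th] gives [cos th >= 0], which keeps away from the excluded half
    turn. *)
Let step_integral (h th : R) : 0 <= th <= pi / 2 ->
  (\int[P \x P]_t dist2 (lincomb (cos (th + h)) (sin (th + h)) t)
                        (lincomb (cos th) (sin th) t) =
   \int[P \x P]_t dist2 (lincomb (cos h) (sin h) t) (Zv t.1))%E.
Proof.
move=> /andP[th0 th1].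
pose g (x y : I -> R) := dist2 (fun i => cos h * x i + sin h * y i) x.
rewrite -[RHS]/(\int[P \x P]_t g (Zv t.1) (Zv t.2))%E.
rewrite -(@ge0_integral_rotated_pairs _ _ _ P I Z Z_normal Z_indep (cos th) (sin th) g).
- apply: eq_integral => t _; rewrite /g; congr dist2; apply/funext => i.
  by rewrite /lincomb cosD sinD; ring.
- exact: cos2Dsin2.
- rewrite gt_eqF// ltr_wpDr// cos_ge0_pihalf//.
  by rewrite th1 andbT (le_trans _ th0)// oppr_le0 divr_ge0// pi_ge0.
- apply: measurable_dist2 => i; last exact: measurable_coord.
  by apply: measurable_funD; apply: measurable_funM => //; exact: measurable_coord.
- by move=> x y; exact: dist2_ge0.
Qed.

Let B := (\int[P \x P]_t (cmod (DF (Zv t.1) (Zv t.2)) ^+ 2)%:E)%E.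
Let E := (\int[P \x P]_t
  ((2 * K * 3 ^+ p * (1 + l1 (Zv t.1) + l1 (Zv t.2)) ^+ (p + 2)) ^+ 2)%:E)%E.

Let measurable_l1s : measurable_fun setT (fun t : T * T => 1 + l1 (Zv t.1) + l1 (Zv t.2)).
Proof.
have mn (f : T * T -> R) : measurable_fun setT f -> measurable_fun setT (fun t => `|f t|).
  by move=> mf; exact: (measurableT_comp (@normr_measurable R setT)).
apply: measurable_funD; first apply: measurable_funD => //.
  by apply: measurable_sum => i; apply: mn; exact: mZ1.
by apply: measurable_sum => i; apply: mn; exact: mZ2.
Qed.

Let E_ge0 : (0 <= E)%E.
Proof. by apply: integral_ge0 => t _; rewrite lee_fin sqr_ge0. Qed.

Let E_fin : E \is a fin_num.
Proof.
rewrite ge0_fin_numE//.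
have -> : E = (\int[P \x P]_t (((2 * K * 3 ^+ p) ^+ 2)%:E *
    ((1 + l1 (Zv t.1) + l1 (Zv t.2)) ^+ ((p + 2) * 2))%:E))%E.
  by apply: eq_integral => t _; rewrite -EFinM exprMn exprM.
rewrite ge0_integralZl_EFin//.
- apply: lte_mul_pinfty; rewrite ?lee_fin ?sqr_ge0//.
  exact: gaussian_moment_lty.
- by move=> t _; rewrite lee_fin exprn_ge0// !addr_ge0// l1_ge0.
- by apply/measurable_EFinP; apply: measurable_funX; exact: measurable_l1s.
- exact: sqr_ge0.
Qed.

Let measurable_DF : measurable_fun setT (fun t : T * T => (cmod (DF (Zv t.1) (Zv t.2)) ^+ 2)%:E).
Proof.
apply/measurable_EFinP; apply: measurable_cmod_sqr.
have mU : measurable_fun setT (fun t : T * T => pairing (Zv t.1) (Zv t.2) : family_space R (I + I)%type).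
  by apply: measurable_family => -[i|i]; [exact: mZ1|exact: mZ2].
by case: DF_meas => m1 m2; split; [exact: (measurableT_comp m1 mU)|exact: (measurableT_comp m2 mU)].
Qed.

Let small_step (h : R) : 0 <= h <= 2 ->
  (\int[P \x P]_t dist2 (lincomb (cos h) (sin h) t) (Zv t.1) <=
   (2 * h ^+ 2)%:E * B + (2 * h ^+ 4)%:E * E)%E.
Proof.
move=> h02; have /andP[h0 _] := h02.
have a0 : 0 <= 2 * h ^+ 2 by rewrite mulr_ge0// sqr_ge0.
have b0 : 0 <= 2 * h ^+ 4 by rewrite mulr_ge0// exprn_ge0.
have mE : measurable_fun setT (fun t : T * T =>
    ((2 * K * 3 ^+ p * (1 + l1 (Zv t.1) + l1 (Zv t.2)) ^+ (p + 2)) ^+ 2)%:E).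
  apply/measurable_EFinP; apply: measurable_funX; apply: measurable_funM => //.
  by apply: measurable_funX; exact: measurable_l1s.
rewrite -ge0_integralZl_EFin//; last by move=> t _; rewrite lee_fin sqr_ge0.
rewrite -ge0_integralZl_EFin//; last by move=> t _; rewrite lee_fin sqr_ge0.
rewrite -ge0_integralD//; last 4 first.
- by move=> t _; rewrite mule_ge0// lee_fin// sqr_ge0.
- by apply: emeasurable_funM => //; exact: measurable_cst.
- by move=> t _; rewrite mule_ge0// lee_fin// sqr_ge0.
- by apply: emeasurable_funM => //; exact: measurable_cst.
apply: ge0_le_integral => //.
- by apply: measurable_dist2 => i; [exact: measurable_lincomb|exact: mZ1].
- by apply: emeasurable_funD; apply: emeasurable_funM => //; exact: measurable_cst.
- move=> t _; rewrite -!EFinM -EFinD lee_fin.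
  exact: small_rotation_le K_ge0 DF_linear DF_le F_taylor _ _ _ h02.
Qed.

(* Pisier's argument: the quarter circle from X to an independent copy Y is cut
   into n arcs; by rotation invariance all of them contribute equally. *)
Lemma gaussian_poincare :
  (\int[P \x P]_t (cmod (F (Zv t.1) - F (Zv t.2)) ^+ 2)%:E <= 8%:E * B)%E.
Proof.
rewrite -[leLHS]/(\int[P \x P]_t dist2 (Zv t.1) (Zv t.2))%E.
have B0 : (0 <= B)%E by apply: integral_ge0 => t _; rewrite lee_fin sqr_ge0.
(* With [n.+1] arcs of angle [h = pi / 2 / n.+1], the main term is
   [2 (n.+1 h) ^+ 2 = 2 (pi / 2) ^+ 2], at most [8] because [pi / 2 < 2]; the remainder is
   [2 (pi / 2) ^+ 4 / n.+1 ^+ 2], with numerator at most [32]. *)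
have H (n : nat) : (\int[P \x P]_t dist2 (Zv t.1) (Zv t.2) <=
    8%:E * B + (32 * n.+1%:R ^- 2)%:E * E)%E.
  pose h : R := pi / 2 / n.+1%:R.
  pose X (j : nat) := lincomb (cos (j%:R * h)) (sin (j%:R * h)).
  have pi2 : 0 <= pi / 2 :> R by rewrite divr_ge0// pi_ge0.
  have h0 : 0 <= h by rewrite divr_ge0.
  have nh : n.+1%:R * h = pi / 2 by rewrite /h mulrC divfK.
  have h2 : 0 <= h <= 2.
    rewrite h0/= ler_pdivrMr// (le_trans (ltW (pihalf_lt2 R)))//.
    by rewrite ler_peMr// ler1n.
  have X0 t : X 0%N t = Zv t.1.
    by apply/funext => i; rewrite /X /lincomb mul0r cos0 sin0 mul1r mul0r addr0.
  have Xn t : X n.+1 t = Zv t.2.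
    apply/funext => i; rewrite /X /lincomb nh cos_pihalf sin_pihalf.
    by rewrite mul1r mul0r add0r.
  have mX j i : measurable_fun setT (fun t => X j t i) by exact: measurable_lincomb.
  have mXX (j : nat) : measurable_fun setT (fun t => dist2 (X j.+1 t) (X j t)).
    exact: measurable_dist2.
  (* Squaring the telescoping sum costs one factor [n.+1]; adding up the equal bounds of the arcs
     will cost another. *)
  apply: (@le_trans _ _ (\int[P \x P]_t (n.+1%:R%:E * \sum_(j < n.+1) dist2 (X j.+1 t) (X j t)))%E).
    apply: ge0_le_integral => //.
    - by apply: measurable_dist2.
    - by apply: emeasurable_funM => //; exact: emeasurable_sum.
    - move=> t _; rewrite -X0 -Xn /dist2 sumEFin -EFinM lee_fin.
      have := cmod_sqr_sum_le 'I_n.+1 (fun j => F (X j.+1 t) - F (X j t)).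
      rewrite card_ord -(big_mkord xpredT (fun j => F (X j.+1 t) - F (X j t))).
      by rewrite telescope_sumr// -cmodN opprB.
  rewrite ge0_integralZl_EFin//; last 2 first.
  - by move=> t _; exact: sume_ge0.
  - exact: emeasurable_sum.
  rewrite ge0_integral_sum//.
  have step (j : 'I_n.+1) : (\int[P \x P]_t dist2 (X j.+1 t) (X j t) <=
      (2 * h ^+ 2)%:E * B + (2 * h ^+ 4)%:E * E)%E.
    apply: le_trans (small_step h2); rewrite /X.
    have -> : j.+1%:R * h = j%:R * h + h by rewrite -natr1 mulrDl mul1r.
    rewrite step_integral// mulr_ge0//= -nh ler_wpM2r// ler_nat.
    exact: ltnW.
  apply: (@le_trans _ _ (n.+1%:R%:E * \sum_(j < n.+1) ((2 * h ^+ 2)%:E * B + (2 * h ^+ 4)%:E * E))%E).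
    by apply: lee_wpmul2l => //; apply: lee_sum => j _; exact: step.
  have n0 : n.+1%:R != 0 :> R by [].
  have hE : h = pi / 2 / n.+1%:R by [].
  have q4 : (pi / 2) ^+ 2 <= 4 :> R by have := pihalf_lt2 R; nra.
  have sumc (x : \bar R) m : (0 <= x)%E -> (\sum_(j < m) x = m%:R%:E * x)%E.
    move=> x0; elim: m => [|m IH]; first by rewrite big_ord0 mul0e.
    by rewrite big_ord_recr/= IH -natr1 EFinD ge0_muleDl ?lee_fin// mul1e.
  rewrite sumc; last first.
    by rewrite adde_ge0// mule_ge0// lee_fin mulr_ge0// exprn_ge0.
  rewrite muleA -EFinM.
  rewrite ge0_muleDr; last 2 first.
  - by rewrite mule_ge0// lee_fin mulr_ge0// sqr_ge0.
  - by rewrite mule_ge0// lee_fin mulr_ge0// exprn_ge0.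
  rewrite !muleA -!EFinM; apply: leeD; apply: lee_wpmul2r => //; rewrite lee_fin.
    have -> : n.+1%:R * n.+1%:R * (2 * h ^+ 2) = 2 * (pi / 2) ^+ 2.
      by rewrite -nh; ring.
    by lra.
  have -> : n.+1%:R * n.+1%:R * (2 * h ^+ 4) = 2 * ((pi / 2) ^+ 2) ^+ 2 * n.+1%:R ^- 2.
    by rewrite hE; field.
  rewrite ler_wpM2r ?invr_ge0 ?exprn_ge0//.
  by have := sqr_ge0 (pi / 2 : R); nra.
case: (boolP (B \is a fin_num)) => [Bfin|]; last first.
  rewrite ge0_fin_numE// -leNgt leye_eq => /eqP ->.
  by rewrite gt0_muley ?lte_fin// leey.
apply/lee_addgt0Pr => e e0.
(* This [n] makes [32 E / e <= n.+1 <= n.+1 ^+ 2], so the remainder is at most [e]. *)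
pose n := Num.truncn (32 * fine E / e).
apply: (le_trans (H n)); apply: leeD => //.
rewrite -(fineK E_fin) -EFinM lee_fin.
have f0 : 0 <= fine E by rewrite fine_ge0.
have n1 : 32 * fine E / e <= n.+1%:R by apply/ltW; exact: truncnS_gt.
rewrite ler_pdivrMr// in n1.
rewrite mulrAC ler_pdivrMr ?exprn_gt0//; apply: (le_trans n1).
by rewrite mulrC ler_wpM2l ?(ltW e0)// expr2 ler_peMl// ler1n.
Qed.

End poincare.

(** * Variance through two independent copies *)

Section pair_variance.
Variables (R : realType) (d : measure_display) (T : measurableType d).
Variable P : probability T R.
Local Notation C := R[i].

Lemma integral_quadratic (f : T -> R) (a b c : R) :
  P.-integrable setT (EFin \o f) -> P.-integrable setT (EFin \o (fun t => f t ^+ 2)) ->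
  (\int[P]_t (a * f t ^+ 2 + b * f t + c)%:E =
   (a * fine (\int[P]_t (f t ^+ 2)%:E) + b * fine (\int[P]_t (f t)%:E) + c)%:E)%E.
Proof.
move=> if1 if2.
have i1 := integrableZl measurableT b if1.
have i2 := integrableZl measurableT a if2.
have i3 : P.-integrable setT (cst c%:E) := finite_measure_integrable_cst P c measurableT.
have i12 := integrableD measurableT i2 i1.
have -> : (\int[P]_t (a * f t ^+ 2 + b * f t + c)%:E =
  \int[P]_t ((a%:E * (f t ^+ 2)%:E + b%:E * (f t)%:E) + cst c%:E t))%E.
  by apply: eq_integral => t _; rewrite !EFinD !EFinM.
rewrite integralD//= integralD//= !integralZl//= integral_cst//= probability_setT mule1.
have e1 := integrable_fin_num measurableT if1.
have e2 := integrable_fin_num measurableT if2.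
by rewrite !EFinD !EFinM !fineK.
Qed.

(** Tonelli fixes one copy; each of the two successive integrands is then a quadratic polynomial in
    [f]. *)
Lemma pair_variance (f : T -> R) : measurable_fun setT f ->
  (\int[P]_t (f t ^+ 2)%:E < +oo)%E ->
  (\int[P \x P]_t ((f t.1 - f t.2) ^+ 2)%:E =
   (2 * (fine (\int[P]_t (f t ^+ 2)%:E) - fine (\int[P]_t (f t)%:E) ^+ 2))%:E)%E.
Proof.
move=> mf f2.
have if2 : P.-integrable setT (EFin \o (fun t => f t ^+ 2)).
  apply/integrableP; split; first by apply/measurable_EFinP; exact: measurable_funX.
  by under eq_integral do rewrite /= ger0_norm ?sqr_ge0//.
have if1 : P.-integrable setT (EFin \o f).
  have i3 : P.-integrable setT (cst 1%:E) := finite_measure_integrable_cst P 1 measurableT.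
  apply: (le_integrable measurableT _ _ (integrableD measurableT if2 i3)) => //.
    exact/measurable_EFinP.
  move=> t _; rewrite /= lee_fin [leRHS]ger0_norm ?addr_ge0 ?sqr_ge0//.
  have := sqr_ge0 (`|f t| - 1); rewrite sqrrB1 real_normK ?num_real// => h.
  by have := normr_ge0 (f t); lra.
have mg : measurable_fun setT (fun t : T * T => ((f t.1 - f t.2) ^+ 2)%:E).
  apply/measurable_EFinP; apply: measurable_funX; apply: measurable_funB.
    by apply: (measurableT_comp mf); exact: measurable_fst.
  by apply: (measurableT_comp mf); exact: measurable_snd.
have g0 (t : T * T) : (0 <= ((f t.1 - f t.2) ^+ 2)%:E)%E by rewrite lee_fin sqr_ge0.
rewrite (fubini_tonelli1 _ mg g0).
set m2 := fine _; set m := fine _.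
transitivity (\int[P]_s (1 * f s ^+ 2 + (- 2 * m) * f s + m2)%:E)%E.
  apply: eq_integral => s _; rewrite /fubini_F/=.
  transitivity (\int[P]_t (1 * f t ^+ 2 + (- 2 * f s) * f t + f s ^+ 2)%:E)%E.
    by apply: eq_integral => t _; congr (_%:E); ring.
  by rewrite integral_quadratic// -/m2 -/m; congr (_%:E); ring.
by rewrite integral_quadratic// -/m2 -/m; congr (_%:E); ring.
Qed.

(** Square integrability makes the difference defining [cvariance] one of finite numbers; real and
    imaginary parts are then handled by [pair_variance] and added. *)
Lemma cvariance_le_pair (X : T -> C) (B : R) : cmeasurable X ->
  (\int[P]_t (cmod (X t) ^+ 2)%:E < +oo)%E ->
  (\int[P \x P]_t (cmod (X t.1 - X t.2) ^+ 2)%:E <= (2 * B)%:E)%E ->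
  (cvariance P X <= B%:E)%E.
Proof.
move=> [mRe mIm] X2 XB.
have cut (f : T -> R) : measurable_fun setT f -> (forall t, f t ^+ 2 <= cmod (X t) ^+ 2) ->
    (\int[P]_t (f t ^+ 2)%:E < +oo)%E.
  move=> mf fX; apply: le_lt_trans X2; apply: ge0_le_integral => //.
  - by move=> t _; rewrite lee_fin sqr_ge0.
  - by apply/measurable_EFinP; exact: measurable_funX.
  - by apply/measurable_EFinP; exact: measurable_cmod_sqr.
  - by move=> t _; rewrite lee_fin.
have Re2 : (\int[P]_t (complex.Re (X t) ^+ 2)%:E < +oo)%E.
  by apply: cut => // t; rewrite cmod_sqr lerDl sqr_ge0.
have Im2 : (\int[P]_t (complex.Im (X t) ^+ 2)%:E < +oo)%E.
  by apply: cut => // t; rewrite cmod_sqr lerDr sqr_ge0.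
have msqr (f : T -> R) : measurable_fun setT f -> measurable_fun setT (fun t => (f t ^+ 2)%:E).
  by move=> mf; apply/measurable_EFinP; exact: measurable_funX.
have mpair (f : T -> R) : measurable_fun setT f ->
    measurable_fun setT (fun t : T * T => ((f t.1 - f t.2) ^+ 2)%:E).
  move=> mf; apply/measurable_EFinP; apply: measurable_funX; apply: measurable_funB.
    by apply: (measurableT_comp mf); exact: measurable_fst.
  by apply: (measurableT_comp mf); exact: measurable_snd.
have sq0 d' (T' : measurableType d') (f : T' -> R) t : (0 <= (f t ^+ 2)%:E)%E.
  by rewrite lee_fin sqr_ge0.
move: XB.
have -> : (\int[P \x P]_t (cmod (X t.1 - X t.2) ^+ 2)%:E =
    \int[P \x P]_t ((complex.Re (X t.1) - complex.Re (X t.2)) ^+ 2)%:E +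
    \int[P \x P]_t ((complex.Im (X t.1) - complex.Im (X t.2)) ^+ 2)%:E)%E.
  rewrite -(ge0_integralD _ measurableT (fun t _ => sq0 _ _ (fun t : T * T =>
    complex.Re (X t.1) - complex.Re (X t.2)) t) (mpair _ mRe) (fun t _ => sq0 _ _
    (fun t : T * T => complex.Im (X t.1) - complex.Im (X t.2)) t) (mpair _ mIm)).
  apply: eq_integral => t _; rewrite -EFinD; congr (_%:E).
  by rewrite cmod_sqr; case: (X t.1) (X t.2) => [? ?] [? ?].
rewrite (pair_variance mRe Re2) (pair_variance mIm Im2).
rewrite /cvariance unlock.
have -> : (\int[P]_t (cmod (X t) ^+ 2)%:E = \int[P]_t (complex.Re (X t) ^+ 2)%:E +
    \int[P]_t (complex.Im (X t) ^+ 2)%:E)%E.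
  rewrite -(ge0_integralD _ measurableT (fun t _ => sq0 _ _ _ t) (msqr _ mRe)
    (fun t _ => sq0 _ _ _ t) (msqr _ mIm)).
  by apply: eq_integral => t _; rewrite -EFinD cmod_sqr.
have f1 : (\int[P]_t (complex.Re (X t) ^+ 2)%:E)%E \is a fin_num.
  by rewrite ge0_fin_numE//; apply: integral_ge0 => t _; rewrite lee_fin sqr_ge0.
have f2 : (\int[P]_t (complex.Im (X t) ^+ 2)%:E)%E \is a fin_num.
  by rewrite ge0_fin_numE//; apply: integral_ge0 => t _; rewrite lee_fin sqr_ge0.
rewrite cmod_sqr /cexpectation/= unlock -{2}(fineK f1) -{2}(fineK f2).
rewrite -!EFinD !lee_fin; lra.
Qed.

Lemma ae_eq_integral_comp (g : C -> R) (X Y : T -> C) :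
  measurable_fun setT (g \o X) -> measurable_fun setT (g \o Y) ->
  {ae P, forall t, X t = Y t} -> (\int[P]_t (g (X t))%:E = \int[P]_t (g (Y t))%:E)%E.
Proof.
move=> gX gY XY; apply: ae_eq_integral => //; [exact/measurable_EFinP|exact/measurable_EFinP|].
by apply: filterS XY => t XYt _; rewrite XYt.
Qed.

Lemma ae_eq_cexpectation (X Y : T -> C) : cmeasurable X -> cmeasurable Y ->
  {ae P, forall t, X t = Y t} -> cexpectation P X = cexpectation P Y.
Proof.
move=> [rX iX] [rY iY] XY; rewrite /cexpectation unlock.
by rewrite (ae_eq_integral_comp rX rY XY) (ae_eq_integral_comp iX iY XY).
Qed.

(** A jointly Gaussian family is an affine image of a standard normal vector only almost surely;
    this carries the bounds from that image back to the given variables. *)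
Lemma ae_eq_cvariance (X Y : T -> C) : cmeasurable X -> cmeasurable Y ->
  {ae P, forall t, X t = Y t} -> cvariance P X = cvariance P Y.
Proof.
move=> mX mY XY; rewrite /cvariance (ae_eq_cexpectation mX mY XY) unlock.
by rewrite (@ae_eq_integral_comp (fun z => cmod z ^+ 2) _ _ _ _ XY) => //;
  exact: measurable_cmod_sqr.
Qed.

End pair_variance.

(** * Operator bounds for the resolvent *)

Section frobenius.
Variable R : realType.
Local Notation C := R[i].

(** The squared Frobenius norm; on column vectors it is the squared Euclidean norm. *)
Definition fro2 m n (A : 'M[C]_(m, n)) : R := \sum_i \sum_j cmod (A i j) ^+ 2.

Lemma fro2_ge0 m n (A : 'M[C]_(m, n)) : 0 <= fro2 A.
Proof. by apply: sumr_ge0 => i _; apply: sumr_ge0 => j _; exact: sqr_ge0. Qed.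

Lemma fro2_eq0 m n (A : 'M[C]_(m, n)) : fro2 A = 0 -> A = 0.
Proof.
move=> A0; apply/matrixP => i j; rewrite mxE; apply: Normc.eq0_normc.
apply/eqP; rewrite -sqrf_eq0; apply/eqP.
have s0 i' : 0 <= \sum_j cmod (A i' j) ^+ 2.
  by apply: sumr_ge0 => j' _; exact: sqr_ge0.
have Ai0 := psumr_eq0P (fun i' _ => s0 i') A0 (isT : i \in xpredT).
have q0 j' : true -> 0 <= cmod (A i j') ^+ 2 by move=> _; exact: sqr_ge0.
have Aij := psumr_eq0P q0 (Ai0 i) isT; exact: (Aij j).
Qed.

Lemma ctrmxE m n (A : 'M[C]_(m, n)) i j : ctrmx A i j = Num.conj (A j i).
Proof. by rewrite !mxE. Qed.

Lemma ctrmxK m n (A : 'M[C]_(m, n)) : ctrmx (ctrmx A) = A.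
Proof. by apply/matrixP => i j; rewrite !ctrmxE conjCK. Qed.

Lemma ctrmxM m n p (A : 'M[C]_(m, n)) (B : 'M[C]_(n, p)) :
  ctrmx (A *m B) = ctrmx B *m ctrmx A.
Proof. by rewrite /ctrmx trmx_mul map_mxM. Qed.

Lemma fro2_ctrmx m n (A : 'M[C]_(m, n)) : fro2 (ctrmx A) = fro2 A.
Proof.
rewrite /fro2 exchange_big; apply: eq_bigr => i _; apply: eq_bigr => j _.
by rewrite ctrmxE cmod_conj.
Qed.

Lemma fro2Z m n (z : C) (A : 'M[C]_(m, n)) : fro2 (z *: A) = cmod z ^+ 2 * fro2 A.
Proof.
rewrite /fro2 mulr_sumr; apply: eq_bigr => i _; rewrite mulr_sumr.
by apply: eq_bigr => j _; rewrite mxE cmodM exprMn.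
Qed.

Lemma fro20 m n : fro2 (0 : 'M[C]_(m, n)) = 0.
Proof. by rewrite -(scale0r (0 : 'M[C]_(m, n))) fro2Z cmod0 expr0n mul0r. Qed.

Lemma fro2D_le m n (A B : 'M[C]_(m, n)) : fro2 (A + B) <= 2 * fro2 A + 2 * fro2 B.
Proof.
rewrite /fro2 !mulr_sumr -big_split/=; apply: ler_sum => i _.
rewrite !mulr_sumr -big_split/=; apply: ler_sum => j _; rewrite mxE.
have := cmodD_le (A i j) (B i j); have := cmod_ge0 (A i j); have := cmod_ge0 (B i j).
have := cmod_ge0 (A i j + B i j).
set a := cmod (A i j); set b := cmod (B i j); set c := cmod _ => c0 b0 a0 cab.
by have := sqr_ge0 (a - b); nra.
Qed.

Lemma fro2_ntr n (A : 'M[C]_n) : complex.Re (ntr (A *m ctrmx A)) = n%:R^-1 * fro2 A.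
Proof.
rewrite /ntr; have -> : \tr (A *m ctrmx A) = ((fro2 A)%:C)%C.
  rewrite /mxtrace /fro2 rmorph_sum/=; apply: eq_bigr => i _.
  rewrite mxE rmorph_sum/=; apply: eq_bigr => j _.
  by rewrite ctrmxE mulr_conjC.
by rewrite -(rmorph_nat (real_complex R)) -fmorphV -rmorphM.
Qed.

(** Twice the difference of the two sides is the sum of [(a i * b j - a j * b i) ^+ 2] over all
    pairs. *)
Lemma cauchy_schwarz (I : finType) (a b : I -> R) :
  (\sum_i a i * b i) ^+ 2 <= (\sum_i a i ^+ 2) * (\sum_i b i ^+ 2).
Proof.
have E1 : \sum_i \sum_j a i ^+ 2 * b j ^+ 2 = (\sum_i a i ^+ 2) * (\sum_i b i ^+ 2).
  by rewrite mulr_suml; apply: eq_bigr => i _; rewrite mulr_sumr.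
have E2 : \sum_i \sum_j a j ^+ 2 * b i ^+ 2 = (\sum_i a i ^+ 2) * (\sum_i b i ^+ 2).
  by rewrite exchange_big.
have E3 : \sum_i \sum_j (a i * b i) * (a j * b j) = (\sum_i a i * b i) ^+ 2.
  by rewrite expr2 mulr_suml; apply: eq_bigr => i _; rewrite mulr_sumr.
suff : (\sum_i a i * b i) ^+ 2 *+ 2 <=
    (\sum_i a i ^+ 2) * (\sum_i b i ^+ 2) + (\sum_i a i ^+ 2) * (\sum_i b i ^+ 2).
  by rewrite -mulr2n ler_pMn2r.
rewrite -{1}E1 -{1}E2 -E3 -big_split/= -sumrMnl; apply: ler_sum => i _.
rewrite -big_split/= -sumrMnl; apply: ler_sum => j _.
by have := sqr_ge0 (a i * b j - a j * b i); nra.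
Qed.

Lemma cmod_cauchy_schwarz (I : finType) (a b : I -> C) :
  cmod (\sum_i a i * b i) ^+ 2 <= (\sum_i cmod (a i) ^+ 2) * (\sum_i cmod (b i) ^+ 2).
Proof.
apply: le_trans (cauchy_schwarz (fun i => cmod (a i)) (fun i => cmod (b i))).
have s0 : 0 <= \sum_i cmod (a i) * cmod (b i).
  by apply: sumr_ge0 => i _; rewrite mulr_ge0// cmod_ge0.
rewrite ler_sqr ?nnegrE ?cmod_ge0//; apply: le_trans (cmod_sum _ _ _) _.
by apply: ler_sum => i _; rewrite cmodM.
Qed.

Definition ip n (x y : 'cV[C]_n) : C := (ctrmx y *m x) 0 0.

Lemma fro2_cV n (x : 'cV[C]_n) : fro2 x = \sum_i cmod (x i 0) ^+ 2.
Proof. by apply: eq_bigr => i _; rewrite big_ord1. Qed.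

Lemma fro2_ip n (x : 'cV[C]_n) : ip x x = ((fro2 x)%:C)%C.
Proof.
rewrite /ip mxE fro2_cV rmorph_sum/=; apply: eq_bigr => i _.
by rewrite ctrmxE mulrC mulr_conjC.
Qed.

Lemma ip_le n (x y : 'cV[C]_n) : cmod (ip x y) ^+ 2 <= fro2 x * fro2 y.
Proof.
rewrite /ip mxE !fro2_cV mulrC; apply: le_trans (cmod_cauchy_schwarz _ _) _.
rewrite le_eqVlt; apply/orP; left; apply/eqP; congr (_ * _).
by apply: eq_bigr => i _; rewrite ctrmxE cmod_conj.
Qed.

Lemma ip_mulmx m n (A : 'M[C]_(m, n)) x y : ip (A *m x) y = ip x (ctrmx A *m y).
Proof. by rewrite /ip ctrmxM ctrmxK mulmxA. Qed.

Lemma ipD n (x y z : 'cV[C]_n) : ip (x + y) z = ip x z + ip y z.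
Proof. by rewrite /ip mulmxDr mxE. Qed.

Lemma ipZ n (a : C) (x z : 'cV[C]_n) : ip (a *: x) z = a * ip x z.
Proof. by rewrite /ip -scalemxAr mxE. Qed.

(** [c] bounds the squared operator norm. Stating this as an inequality avoids a supremum, and the
    square matches [fro2]. *)
Definition opnorm2_le m n (A : 'M[C]_(m, n)) (c : R) :=
  forall x : 'cV[C]_n, fro2 (A *m x) <= c * fro2 x.

Lemma fro2_col m n (A : 'M[C]_(m, n)) : fro2 A = \sum_j fro2 (col j A).
Proof.
rewrite /fro2 exchange_big; apply: eq_bigr => j _; apply: eq_bigr => i _.
by rewrite big_ord1 mxE.
Qed.

Lemma fro2_mull m n p (A : 'M[C]_(m, n)) (B : 'M[C]_(n, p)) c :
  opnorm2_le A c -> fro2 (A *m B) <= c * fro2 B.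
Proof.
move=> Ac; rewrite (fro2_col (A *m B)) (fro2_col B) mulr_sumr; apply: ler_sum => j _.
by rewrite !colE -mulmxA Ac.
Qed.

(** With [y = ctrmx A *m x], the number [fro2 y] is the inner product of [x] with [A *m y].
    Cauchy-Schwarz bounds its square by [fro2 x * (c * fro2 y)], and one factor [fro2 y] cancels. *)
Lemma opnorm2_le_ctrmx m n (A : 'M[C]_(m, n)) c :
  0 <= c -> opnorm2_le A c -> opnorm2_le (ctrmx A) c.
Proof.
move=> c0 Ac x; set y := ctrmx A *m x.
have h : (fro2 y) ^+ 2 <= fro2 x * (c * fro2 y).
  have -> : fro2 y ^+ 2 = cmod (ip x (A *m y)) ^+ 2.
    rewrite -[A in A *m y]ctrmxK -ip_mulmx -/y fro2_ip cmod_real ger0_norm//.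
    exact: fro2_ge0.
  by apply: (le_trans (ip_le _ _)); rewrite ler_wpM2l ?fro2_ge0.
have [y0|y0] := eqVneq (fro2 y) 0; first by rewrite y0 mulr_ge0 ?fro2_ge0.
have yp : 0 < fro2 y by rewrite lt_def y0 fro2_ge0.
by rewrite -(ler_pM2r yp) -expr2 (le_trans h)// mulrCA mulrA.
Qed.

Lemma fro2_mulr m n p (A : 'M[C]_(m, n)) (B : 'M[C]_(n, p)) c :
  0 <= c -> opnorm2_le B c -> fro2 (A *m B) <= c * fro2 A.
Proof.
move=> c0 Bc; rewrite -fro2_ctrmx ctrmxM -(fro2_ctrmx A).
by apply: fro2_mull; exact: opnorm2_le_ctrmx.
Qed.

Lemma opnorm2_le_fro2 m n (A : 'M[C]_(m, n)) : opnorm2_le A (fro2 A).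
Proof.
move=> x; rewrite fro2_cV {1}/fro2 mulr_suml; apply: ler_sum => i _.
by rewrite mxE fro2_cV; exact: cmod_cauchy_schwarz.
Qed.

Lemma l2normE n (x : 'cV[C]_n) : l2norm x = Num.sqrt (fro2 x).
Proof. by rewrite fro2_cV. Qed.

(** A real supremum bounds its elements only when the set is bounded, which the Frobenius norm
    ensures; a nonzero [x] is then scaled to a unit vector. *)
Lemma opnorm2_le_spectral m n (A : 'M[C]_(m, n)) c :
  spectral_norm A <= c -> opnorm2_le A (c ^+ 2).
Proof.
move=> Ac x.
have [x0|x0] := eqVneq (fro2 x) 0.
  by rewrite (fro2_eq0 x0) mulmx0 !fro20 mulr0.
have xp : 0 < fro2 x by rewrite lt_def x0 fro2_ge0.
pose s := Num.sqrt (fro2 x).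
have sp : 0 < s by rewrite sqrtr_gt0.
have s2 : s ^+ 2 = fro2 x by rewrite sqr_sqrtr// ltW.
pose y : 'cV[C]_n := ((s^-1)%:C)%C *: x.
have y1 : fro2 y = 1.
  by rewrite fro2Z cmod_real ger0_norm ?invr_ge0 ?(ltW sp)// exprVn s2 mulVf.
have ub : has_ubound [set l2norm (A *m x) | x in [set x : 'cV[C]_n | l2norm x <= 1]].
  exists (Num.sqrt (fro2 A)) => _ [v /= v1 <-].
  rewrite l2normE ler_wsqrtr// (le_trans (opnorm2_le_fro2 A v))//.
  rewrite ler_piMr ?fro2_ge0//.
  by move: v1; rewrite l2normE -[leRHS]sqrtr1 ler_sqrt.
have : l2norm (A *m y) <= c.
  apply: le_trans Ac; apply: ub_le_sup => //; exists y => //=.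
  by rewrite l2normE y1 sqrtr1.
rewrite l2normE -scalemxAr fro2Z cmod_real ger0_norm ?invr_ge0 ?(ltW sp)// => h.
have h2 : s^-1 ^+ 2 * fro2 (A *m x) <= c ^+ 2.
  have p0 : 0 <= s^-1 ^+ 2 * fro2 (A *m x) by rewrite mulr_ge0 ?sqr_ge0 ?fro2_ge0.
  have c0 : 0 <= c by apply: le_trans h; exact: sqrtr_ge0.
  by rewrite -(sqr_sqrtr p0) ler_sqr ?nnegrE ?sqrtr_ge0.
by move: h2; rewrite exprVn s2 mulrC ler_pdivrMr.
Qed.

End frobenius.

(** * Resolvent of a Gram matrix outside the half-line *)

Section resolvent_bounds.
Variable R : realType.
Local Notation C := R[i].
Variable z : C.
Hypothesis z_out : ~ Rnonneg z.
Let delta := dist z (@Rnonneg R).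

Let dist_has_inf : has_inf [set cmod (z - x) | x in @Rnonneg R].
Proof.
split; first by exists (cmod (z - 0)), 0 => //=; rewrite /Rnonneg /= lexx.
by exists 0 => _ [x _ <-]; exact: cmod_ge0.
Qed.

Lemma dist_Rnonneg_le (l : R) : 0 <= l -> delta <= cmod (z - (l%:C)%C).
Proof.
by move=> l0; apply: (ge_inf dist_has_inf.2); exists (l%:C)%C => //; rewrite /Rnonneg/= ler0c.
Qed.

(** A nonzero imaginary part bounds all the distances from below by its absolute value; otherwise
    [z] is a negative real and [- z] does so. *)
Lemma dist_Rnonneg_gt0 : 0 < delta.
Proof.
have lb (e : R) : 0 < e -> (forall x : C, 0 <= x -> e <= cmod (z - x)) -> 0 < delta.
  move=> e0 h; apply: (lt_le_trans e0); apply: lb_le_inf; first exact: dist_has_inf.1.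
  by move=> _ [x x0 <-]; exact: h.
have xE (x : C) : 0 <= x -> exists2 l : R, 0 <= l & x = (l%:C)%C.
  by case: x => a b; rewrite lecE /= => /andP[/eqP -> a0]; exists a.
case E : z => [a b].
have Im_le (u : C) : `|complex.Im u| <= cmod u.
  rewrite -ler_sqr ?nnegrE ?cmod_ge0// real_normK ?num_real// cmod_sqr lerDr.
  exact: sqr_ge0.
have [b0|b0] := eqVneq b 0.
  have a0 : a < 0.
    rewrite ltNge; apply/negP => a0; apply: z_out.
    by rewrite /Rnonneg /= E lecE /= b0 eqxx.
  apply: (lb (- a)); first by rewrite oppr_gt0.
  move=> _ /xE[l l0 ->]; rewrite E.
  rewrite -cmodN opprB; apply: (le_trans _ (Re_le_cmod _)) => /=.
  by rewrite lerDr.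
apply: (lb `|b|); first by rewrite normr_gt0.
move=> _ /xE[l l0 ->]; rewrite E; apply: (le_trans _ (Im_le _)) => /=.
by rewrite oppr0 addr0.
Qed.

Let q := delta^-1.

Let q_ge0 : 0 <= q.
Proof. by rewrite invr_ge0 ltW// dist_Rnonneg_gt0. Qed.

Section fixed_matrix.
Variables (n m : nat) (W : 'M[C]_(n, m)).
Let H := W *m ctrmx W.

Lemma ip_gram (y : 'cV[C]_n) : ip (H *m y) y = ((fro2 (ctrmx W *m y))%:C)%C.
Proof. by rewrite -mulmxA ip_mulmx fro2_ip. Qed.

(** The form of [H] at [y] equals [l * fro2 y] with a Rayleigh quotient [l >= 0]. Hence the form of
    [H - z] has modulus at least [delta * fro2 y], and Cauchy-Schwarz concludes without
    diagonalising [H]. *)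
Lemma shift_gram_ge (y : 'cV[C]_n) :
  delta ^+ 2 * fro2 y <= fro2 ((H - z%:M) *m y).
Proof.
have [y0|y0] := eqVneq (fro2 y) 0; first by rewrite y0 mulr0 fro2_ge0.
have yp : 0 < fro2 y by rewrite lt_def y0 fro2_ge0.
pose l := fro2 (ctrmx W *m y) / fro2 y.
have l0 : 0 <= l by rewrite divr_ge0 ?fro2_ge0.
have E : ip ((H - z%:M) *m y) y = ((fro2 y)%:C)%C * ((l%:C)%C - z).
  have fl : fro2 y * l = fro2 (ctrmx W *m y) by rewrite mulrC divfK.
  rewrite mulmxBl mul_scalar_mx -scaleN1r ipD !ipZ ip_gram fro2_ip mulrBr -rmorphM/= fl.
  by rewrite mulN1r [z * _]mulrC.
have := ip_le ((H - z%:M) *m y) y.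
rewrite E cmodM cmod_real (ger0_norm (ltW yp)) exprMn => h.
have d1 : delta <= cmod ((l%:C)%C - z) by rewrite -cmodN opprB dist_Rnonneg_le.
have d2 : delta ^+ 2 <= cmod ((l%:C)%C - z) ^+ 2.
  by rewrite ler_sqr ?nnegrE ?cmod_ge0// ltW// dist_Rnonneg_gt0.
rewrite -(ler_pM2r yp); apply: le_trans h.
by rewrite -mulrA -expr2 mulrC ler_wpM2l ?sqr_ge0.
Qed.

(** By [shift_gram_ge] the kernel is trivial; transposes appear because [det0P] produces a row
    vector. *)
Lemma shift_gram_unit : H - z%:M \in unitmx.
Proof.
rewrite unitmxE unitfE -det_tr; apply/negP => /det0P[v v0 vA].
case/negP: v0; rewrite -[v]trmxK; apply/eqP.
have A0 : (H - z%:M) *m v^T = 0 by apply: trmx_inj; rewrite trmx_mul trmxK trmx0.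
have := shift_gram_ge v^T; rewrite A0 fro20 pmulr_rle0 ?exprn_gt0 ?dist_Rnonneg_gt0//.
move=> h; have /fro2_eq0 -> : fro2 v^T = 0 by apply/eqP; rewrite eq_le h fro2_ge0.
exact: trmx0.
Qed.

Local Notation Q := (resolvent W z).

Lemma resolventK : (H - z%:M) *m Q = 1%:M.
Proof. exact: mulmxV shift_gram_unit. Qed.

Lemma resolventVK : Q *m (H - z%:M) = 1%:M.
Proof. exact: mulVmx shift_gram_unit. Qed.

Lemma gram_resolvent : H *m Q = 1%:M + z *: Q.
Proof. by rewrite -resolventK mulmxBl mul_scalar_mx subrK. Qed.

Lemma resolvent_opnorm : opnorm2_le Q (q ^+ 2).
Proof.
move=> x; have := shift_gram_ge (Q *m x).
have d0 : 0 < delta ^+ 2 by rewrite exprn_gt0// dist_Rnonneg_gt0.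
by rewrite mulmxA resolventK mul1mx exprVn ler_pdivlMl.
Qed.

(** For [y = Q *m x], the squared norm of [ctrmx W *m y] is the form of [H] at [y], and
    [H *m y = x + z *: y]. The size of [W] has disappeared. *)
Lemma ctr_resolvent_opnorm : opnorm2_le (ctrmx W *m Q) (q + cmod z * q ^+ 2).
Proof.
move=> x; set y := Q *m x.
have Hy : H *m y = x + z *: y by rewrite mulmxA gram_resolvent mulmxDl mul1mx -scalemxAl.
have yx := resolvent_opnorm x; rewrite -/y in yx.
have := ip_gram y; rewrite Hy ipD ipZ fro2_ip => E.
have -> : fro2 (ctrmx W *m Q *m x) = cmod (ip x y + z * ((fro2 y)%:C)%C).
  by rewrite E cmod_real ger0_norm ?fro2_ge0// mulmxA.
apply: (le_trans (cmodD_le _ _)); rewrite mulrDl; apply: lerD.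
  have p0 : 0 <= q * fro2 x by rewrite mulr_ge0 ?fro2_ge0.
  rewrite -ler_sqr ?nnegrE ?cmod_ge0//; apply: (le_trans (ip_le _ _)).
  rewrite exprMn expr2 mulrC (expr2 (fro2 x)) mulrA -expr2.
  by rewrite ler_wpM2r ?fro2_ge0.
rewrite cmodM cmod_real (ger0_norm (fro2_ge0 _)) -mulrA.
by rewrite ler_wpM2l ?cmod_ge0.
Qed.

End fixed_matrix.

Section push_through.
Variables (n m : nat) (W : 'M[C]_(n, m)).
Local Notation Q := (resolvent W z).
Local Notation Q' := (resolvent (ctrmx W) z).

(** Multiply [(W W^H - z) W = W (W^H W - z)] by the two resolvents. The factor [Q W] thereby takes
    the form treated in [ctr_resolvent_opnorm], for [ctrmx W] in place of [W]. *)
Lemma resolvent_push : Q *m W = W *m Q'.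
Proof.
have U := shift_gram_unit (ctrmx W).
rewrite -[LHS]mulmx1 -(resolventK (ctrmx W)) ctrmxK.
rewrite mulmxA -[Q *m W *m _]mulmxA mulmxBr mul_mx_scalar mulmxA.
rewrite -mul_scalar_mx -mulmxBl.
by rewrite mulmxA resolventVK mul1mx.
Qed.

Lemma resolvent_mul_opnorm : opnorm2_le (Q *m W) (q + cmod z * q ^+ 2).
Proof. by rewrite resolvent_push -{1}(ctrmxK W); exact: ctr_resolvent_opnorm. Qed.

Lemma ctr_resolvent_mulE : ctrmx W *m Q *m W = 1%:M + z *: Q'.
Proof. by rewrite -mulmxA resolvent_push mulmxA -gram_resolvent ctrmxK. Qed.

Lemma ctr_resolvent_mul_opnorm :
  opnorm2_le (ctrmx W *m Q *m W) (2 + 2 * (cmod z * q) ^+ 2).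
Proof.
move=> x; rewrite ctr_resolvent_mulE mulmxDl mul1mx -scalemxAl.
apply: (le_trans (fro2D_le _ _)); rewrite [leRHS]mulrDl; apply: lerD => //.
rewrite -mulrA ler_wpM2l//.
by rewrite fro2Z exprMn -(mulrA (cmod z ^+ 2)) ler_wpM2l ?sqr_ge0// resolvent_opnorm.
Qed.

End push_through.

End resolvent_bounds.

(** * Expansions with remainder of polynomial growth *)

Section growth.
Variables (R : realType) (I : finType).
Local Notation C := R[i].
Local Notation V := (I -> R).

(** The entrywise l1 norm, chosen for being submultiplicative. Its dependence on the dimensions is
    harmless: it only serves integrability and remainders, while the final constants come from
    [fro2]. *)
Definition sum_norm m n (A : 'M[C]_(m, n)) : R := \sum_i \sum_j cmod (A i j).

Lemma sum_norm_ge0 m n (A : 'M[C]_(m, n)) : 0 <= sum_norm A.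
Proof. by apply: sumr_ge0 => i _; apply: sumr_ge0 => j _; exact: cmod_ge0. Qed.

Lemma sum_normD_le m n (A B : 'M[C]_(m, n)) :
  sum_norm (A + B) <= sum_norm A + sum_norm B.
Proof.
rewrite -big_split; apply: ler_sum => i _; rewrite -big_split; apply: ler_sum => j _.
by rewrite mxE cmodD_le.
Qed.

Lemma sum_norm0 m n : sum_norm (0 : 'M[C]_(m, n)) = 0.
Proof. by apply: big1 => i _; apply: big1 => j _; rewrite mxE cmod0. Qed.

Lemma sum_normZ m n (a : C) (A : 'M[C]_(m, n)) : sum_norm (a *: A) = cmod a * sum_norm A.
Proof.
rewrite mulr_sumr; apply: eq_bigr => i _; rewrite mulr_sumr; apply: eq_bigr => j _.
by rewrite mxE cmodM.
Qed.

Lemma sum_norm_ctrmx m n (A : 'M[C]_(m, n)) : sum_norm (ctrmx A) = sum_norm A.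
Proof.
rewrite /sum_norm exchange_big; apply: eq_bigr => i _; apply: eq_bigr => j _.
by rewrite ctrmxE cmod_conj.
Qed.

Lemma sum_normM_le m n p (A : 'M[C]_(m, n)) (B : 'M[C]_(n, p)) :
  sum_norm (A *m B) <= sum_norm A * sum_norm B.
Proof.
rewrite /sum_norm mulr_suml; apply: ler_sum => i _.
apply: (@le_trans _ _ (\sum_k \sum_j cmod (A i j) * cmod (B j k))).
  apply: ler_sum => k _; rewrite mxE; apply: le_trans (cmod_sum _ _ _) _.
  by apply: ler_sum => j _; rewrite cmodM.
rewrite exchange_big/= mulr_suml; apply: ler_sum => j _.
rewrite -mulr_sumr ler_wpM2l ?cmod_ge0//.
rewrite [leRHS](bigD1 j)//= lerDl; apply: sumr_ge0 => i' _.
by apply: sumr_ge0 => k _; exact: cmod_ge0.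
Qed.

Lemma cmod_ntr_le n (A : 'M[C]_n) : cmod (ntr A) <= sum_norm A.
Proof.
rewrite /ntr cmodM cmodV cmod_nat.
apply: (@le_trans _ _ (cmod (\tr A))).
  case: n A => [|n] A; first by rewrite invr0 mul0r cmod_ge0.
  by rewrite ler_piMl ?cmod_ge0// invf_le1 ?ltr0n// ler1n.
apply: le_trans (cmod_sum _ _ _) _; apply: ler_sum => i _.
rewrite [leRHS](bigD1 i)//= lerDl; apply: sumr_ge0 => j _; exact: cmod_ge0.
Qed.

(** Order [k] in the increment [v], up to a polynomial factor in both arguments; [k = 0] is mere
    polynomial growth. *)
Definition vanishes (k : nat) m n (Phi : V -> V -> 'M[C]_(m, n)) :=
  exists K p, 0 <= K /\ forall x v,
    sum_norm (Phi x v) <= K * l1 v ^+ k * (1 + l1 x + l1 v) ^+ p.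

Let base_ge1 (x v : V) : 1 <= 1 + l1 x + l1 v.
Proof. by rewrite -addrA lerDl addr_ge0// l1_ge0. Qed.

Let le_base (x v : V) (p q : nat) : (p <= q)%N ->
  (1 + l1 x + l1 v) ^+ p <= (1 + l1 x + l1 v) ^+ q.
Proof. by move=> pq; apply: ler_weXn2l. Qed.

Lemma vanishesD k m n (Phi Psi : V -> V -> 'M[C]_(m, n)) :
  vanishes k Phi -> vanishes k Psi -> vanishes k (fun x v => Phi x v + Psi x v).
Proof.
move=> [K [p [K0 hK]]] [L [q [L0 hL]]]; exists (K + L), (p + q)%N.
split; first exact: addr_ge0.
move=> x v; apply: (le_trans (sum_normD_le _ _)); rewrite !mulrDl.
have v0 : 0 <= l1 v ^+ k by rewrite exprn_ge0// l1_ge0.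
apply: lerD.
  by apply: (le_trans (hK x v)); rewrite ler_wpM2l ?mulr_ge0// le_base// leq_addr.
by apply: (le_trans (hL x v)); rewrite ler_wpM2l ?mulr_ge0// le_base// leq_addl.
Qed.

Lemma vanishesM k l m n p (Phi : V -> V -> 'M[C]_(m, n)) (Psi : V -> V -> 'M[C]_(n, p)) :
  vanishes k Phi -> vanishes l Psi -> vanishes (k + l) (fun x v => Phi x v *m Psi x v).
Proof.
move=> [K [a [K0 hK]]] [L [b [L0 hL]]]; exists (K * L), (a + b)%N.
split; first exact: mulr_ge0.
move=> x v; apply: (le_trans (sum_normM_le _ _)).
apply: (le_trans (ler_pM (sum_norm_ge0 _) (sum_norm_ge0 _) (hK x v) (hL x v))).
by rewrite le_eqVlt; apply/orP; left; apply/eqP; rewrite !exprD; ring.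
Qed.

(** The surplus factor [l1 v] is absorbed by raising the degree of the polynomial factor by one. *)
Lemma vanishesW k m n (Phi : V -> V -> 'M[C]_(m, n)) : vanishes k.+1 Phi -> vanishes k Phi.
Proof.
move=> [K [p [K0 hK]]]; exists K, p.+1; split=> // x v.
apply: (le_trans (hK x v)); rewrite exprS (exprS _ p) !mulrA.
have v0 := l1_ge0 v.
have e0 : 0 <= K * l1 v ^+ k * (1 + l1 x + l1 v) ^+ p.
  by rewrite !mulr_ge0// exprn_ge0// (le_trans ler01).
have -> : K * l1 v * l1 v ^+ k * (1 + l1 x + l1 v) ^+ p =
  K * l1 v ^+ k * (1 + l1 x + l1 v) ^+ p * l1 v by ring.
have -> : K * l1 v ^+ k * (1 + l1 x + l1 v) * (1 + l1 x + l1 v) ^+ p =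
  K * l1 v ^+ k * (1 + l1 x + l1 v) ^+ p * (1 + l1 x + l1 v) by ring.
by rewrite ler_wpM2l// lerDr addr_ge0// l1_ge0.
Qed.

Lemma vanishesN k m n (Phi : V -> V -> 'M[C]_(m, n)) :
  vanishes k Phi -> vanishes k (fun x v => - Phi x v).
Proof.
move=> [K [p [K0 hK]]]; exists K, p; split=> // x v.
by rewrite -scaleN1r sum_normZ cmodN (cmod_nat R 1) mul1r.
Qed.

Lemma vanishes0_cst m n (A : 'M[C]_(m, n)) : vanishes 0 (fun _ _ => A).
Proof.
exists (sum_norm A), 0%N; split; first exact: sum_norm_ge0.
by move=> x v; rewrite !expr0 !mulr1.
Qed.

Lemma vanishes_zero k m n : vanishes k (fun _ _ => 0 : 'M[C]_(m, n)).
Proof. by exists 0, 0%N; split=> // x v; rewrite sum_norm0 !mul0r. Qed.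

Lemma vanishes_ctrmx k m n (Phi : V -> V -> 'M[C]_(m, n)) :
  vanishes k Phi -> vanishes k (fun x v => ctrmx (Phi x v)).
Proof. by move=> [K [p [K0 hK]]]; exists K, p; split=> // x v; rewrite sum_norm_ctrmx. Qed.

Lemma eq_vanishes k m n (Phi Psi : V -> V -> 'M[C]_(m, n)) :
  (forall x v, Phi x v = Psi x v) -> vanishes k Phi -> vanishes k Psi.
Proof. by move=> E [K [p [K0 hK]]]; exists K, p; split=> // x v; rewrite -E. Qed.

Local Notation "x \+v v" := (fun i => x i + v i) (at level 50).
Local Notation V1 := (family_space R I).
Local Notation V2 := (family_space R (I + I)%type).

(* First-order expansions with a quantitative remainder stand in for
   multivariate derivatives: they are closed under products and inverses, and
   are all that the rotation argument uses. *)
Record differentiable_poly m n (Phi : V -> 'M[C]_(m, n)) (DPhi : V -> V -> 'M[C]_(m, n)) :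
  Prop := DifferentiablePoly {
  dp_val : vanishes 0 (fun x _ => Phi x);
  dp_der : vanishes 1 DPhi;
  dp_rem : vanishes 2 (fun x v => Phi (x \+v v) - Phi x - DPhi x v);
  dp_lin : forall x y v a b, DPhi x (fun i => a * y i + b * v i) =
    (a%:C)%C *: DPhi x y + (b%:C)%C *: DPhi x v;
  dp_meas : forall i j, cmeasurable (fun x : V1 => Phi x i j);
  dp_dmeas : forall i j, cmeasurable (fun u : V2 => DPhi (u \o inl) (u \o inr) i j) }.

Lemma dp_shift m n (Phi : V -> 'M[C]_(m, n)) DPhi :
  differentiable_poly Phi DPhi -> vanishes 0 (fun x v => Phi (x \+v v)).
Proof.
move=> h; apply: (@eq_vanishes 0 _ _ (fun x v => (Phi (x \+v v) - Phi x - DPhi x v) +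
    (DPhi x v + Phi x))).
  by move=> x v; rewrite addrA subrK subrK.
apply: vanishesD; first by apply/vanishesW/vanishesW; exact: dp_rem h.
by apply: vanishesD; [apply/vanishesW; exact: dp_der h|exact: dp_val h].
Qed.

Lemma measurable_inl : measurable_fun setT (fun u : V2 => u \o inl : V1).
Proof. by apply: measurable_family => i; exact: measurable_coord. Qed.

Lemma dp_meas_inl m n (Phi : V -> 'M[C]_(m, n)) DPhi :
  differentiable_poly Phi DPhi ->
  forall i j, cmeasurable (fun u : V2 => Phi (u \o inl) i j).
Proof.
move=> h i j; have [m1 m2] := dp_meas h i j; split.
  exact: (measurableT_comp m1 measurable_inl).
exact: (measurableT_comp m2 measurable_inl).
Qed.

Lemma dp_cst m n (A : 'M[C]_(m, n)) : differentiable_poly (fun=> A) (fun _ _ => 0).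
Proof.
split.
- exact: vanishes0_cst.
- exact: vanishes_zero.
- apply: eq_vanishes (vanishes_zero 2 m n) => x v; by rewrite subrr subr0.
- by move=> *; rewrite !scaler0 addr0.
- by move=> i j; exact: cmeasurable_cst.
- by move=> i j; exact: cmeasurable_cst.
Qed.

Lemma cmeasurable_addmx d (T : measurableType d) m n (A B : T -> 'M[C]_(m, n)) :
  (forall i j, cmeasurable (fun t => A t i j)) ->
  (forall i j, cmeasurable (fun t => B t i j)) ->
  forall i j, cmeasurable (fun t => (A t + B t) i j).
Proof.
move=> mA mB i j; apply: (@eq_cmeasurable _ _ _ (fun t => A t i j + B t i j)).
  by move=> t; rewrite mxE.
exact: cmeasurableD.
Qed.

Lemma dpD m n (Phi Psi : V -> 'M[C]_(m, n)) DPhi DPsi :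
  differentiable_poly Phi DPhi -> differentiable_poly Psi DPsi ->
  differentiable_poly (fun x => Phi x + Psi x) (fun x v => DPhi x v + DPsi x v).
Proof.
move=> h1 h2; split.
- exact: (vanishesD (dp_val h1) (dp_val h2)).
- exact: (vanishesD (dp_der h1) (dp_der h2)).
- apply: eq_vanishes (vanishesD (dp_rem h1) (dp_rem h2)) => x v.
  by rewrite !opprD !addrA; apply/matrixP => i j; rewrite !mxE; ring.
- move=> x y v a b; rewrite (dp_lin h1) (dp_lin h2) !scalerDr.
  by rewrite addrACA.
- by apply: cmeasurable_addmx; [exact: dp_meas h1|exact: dp_meas h2].
- by apply: cmeasurable_addmx; [exact: dp_dmeas h1|exact: dp_dmeas h2].
Qed.

Lemma mulmx_lincombl m n p (a b : C) (A A' : 'M[C]_(m, n)) (B : 'M[C]_(n, p)) :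
  (a *: A + b *: A') *m B = a *: (A *m B) + b *: (A' *m B).
Proof. by rewrite mulmxDl -!scalemxAl. Qed.

Lemma mulmx_lincombr m n p (a b : C) (A : 'M[C]_(m, n)) (B B' : 'M[C]_(n, p)) :
  A *m (a *: B + b *: B') = a *: (A *m B) + b *: (A *m B').
Proof. by rewrite mulmxDr -!scalemxAr. Qed.

Lemma dpM m n p (Phi : V -> 'M[C]_(m, n)) (Psi : V -> 'M[C]_(n, p)) DPhi DPsi :
  differentiable_poly Phi DPhi -> differentiable_poly Psi DPsi ->
  differentiable_poly (fun x => Phi x *m Psi x)
    (fun x v => DPhi x v *m Psi x + Phi x *m DPsi x v).
Proof.
move=> h1 h2; split.
- exact: (vanishesM (dp_val h1) (dp_val h2)).
- apply: vanishesD; first exact: (vanishesM (dp_der h1) (dp_val h2)).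
  exact: (vanishesM (dp_val h1) (dp_der h2)).
(* With remainders [r] and [r'] of the two factors, the remainder of the product is [r Psi (x + v) +
   (Phi + DPhi) r' + DPhi DPsi], each term being of order two. *)
- have r1 := vanishesM (dp_rem h1) (dp_shift h2).
  have r2 := vanishesM (vanishesD (dp_val h1) (vanishesW (dp_der h1))) (dp_rem h2).
  have r3 := vanishesM (dp_der h1) (dp_der h2).
  apply: eq_vanishes (vanishesD r1 (vanishesD r2 r3)) => x v /=.
  set f := Phi x; set f' := Phi _; set g := Psi x; set g' := Psi _.
  rewrite !(mulmxDl, mulmxDr, mulmxBl, mulmxBr, mulmxN, mulNmx) !opprD.
  by apply/matrixP => i j; rewrite !mxE; ring.
- move=> x y v a b; rewrite (dp_lin h1) (dp_lin h2).
  rewrite mulmx_lincombl mulmx_lincombr (scalerDr (a%:C)%C) (scalerDr (b%:C)%C).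
  exact: addrACA.
- by apply: cmeasurable_mulmx; [exact: dp_meas h1|exact: dp_meas h2].
- apply: cmeasurable_addmx; apply: cmeasurable_mulmx.
  + exact: dp_dmeas h1.
  + exact: dp_meas_inl h2.
  + exact: dp_meas_inl h1.
  + exact: dp_dmeas h2.
Qed.

Lemma ctrmxD m n (A B : 'M[C]_(m, n)) : ctrmx (A + B) = ctrmx A + ctrmx B.
Proof. by apply/matrixP => i j; rewrite !mxE rmorphD. Qed.

Lemma ctrmxN m n (A : 'M[C]_(m, n)) : ctrmx (- A) = - ctrmx A.
Proof. by apply/matrixP => i j; rewrite !mxE rmorphN. Qed.

Lemma ctrmxZ m n (a : R) (A : 'M[C]_(m, n)) : ctrmx ((a%:C)%C *: A) = (a%:C)%C *: ctrmx A.
Proof.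
apply/matrixP => i j; rewrite !mxE rmorphM; congr (_ * _).
exact: (etrans (conjC_conjc _) (conjc_real a)).
Qed.

Lemma dp_ctrmx m n (Phi : V -> 'M[C]_(m, n)) DPhi :
  differentiable_poly Phi DPhi ->
  differentiable_poly (fun x => ctrmx (Phi x)) (fun x v => ctrmx (DPhi x v)).
Proof.
move=> h; split.
- exact: vanishes_ctrmx (dp_val h).
- exact: vanishes_ctrmx (dp_der h).
- apply: eq_vanishes (vanishes_ctrmx (dp_rem h)) => x v.
  by rewrite !ctrmxD !ctrmxN.
- by move=> x y v a b; rewrite (dp_lin h) ctrmxD !ctrmxZ.
- by apply: cmeasurable_ctrmx; exact: dp_meas h.
- by apply: cmeasurable_ctrmx; exact: dp_dmeas h.
Qed.

(** A bound on the inverses uniform in [x] also controls the inverse at the displaced point, so the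
    expansion needs no smallness of [v]. *)
Lemma dp_invmx n (Phi : V -> 'M[C]_n) DPhi :
  differentiable_poly Phi DPhi -> (forall x, Phi x \in unitmx) ->
  (exists K, forall x, sum_norm (invmx (Phi x)) <= K) ->
  differentiable_poly (fun x => invmx (Phi x))
    (fun x v => - (invmx (Phi x) *m DPhi x v *m invmx (Phi x))).
Proof.
move=> h uP [K hK]; pose Q x := invmx (Phi x).
have K0 : 0 <= K by apply: le_trans (hK (fun=> 0)); exact: sum_norm_ge0.
have vQ : vanishes 0 (fun x _ => Q x).
  by exists K, 0%N; split=> // x v; rewrite !expr0 !mulr1; exact: hK.
have vQ' : vanishes 0 (fun x v => Q (x \+v v)).
  by exists K, 0%N; split=> // x v; rewrite !expr0 !mulr1; exact: hK.
have mQ := @cmeasurable_invmx R _ V1 n Phi uP (dp_meas h).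
have mQ2 := @cmeasurable_invmx R _ V2 n (fun u => Phi (u \o inl)) (fun u => uP (u \o inl))
  (dp_meas_inl h).
have vD : vanishes 1 (fun x v => Phi (x \+v v) - Phi x).
  apply: eq_vanishes (vanishesD (vanishesW (dp_rem h)) (dp_der h)) => x v.
  by rewrite subrK.
split => //.
- apply: vanishesN; exact: (vanishesM (vanishesM vQ (dp_der h)) vQ).
(* The resolvent identity used twice: with [Delta] the increment of [Phi], [r] its remainder and
   [Q'] the inverse at the displaced point, the remainder of the inverse is
   [Q Delta Q Delta Q' - Q r Q]. *)
- have r1 := vanishesM (vanishesM (vanishesM vQ vD) (vanishesM vQ vD)) vQ'.
  have r2 := vanishesN (vanishesM (vanishesM vQ (dp_rem h)) vQ).
  apply: eq_vanishes (vanishesD r1 r2) => x v.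
  have E1 : Q x *m (Phi (x \+v v) - Phi x) *m Q (x \+v v) = Q x - Q (x \+v v).
    by rewrite mulmxBr mulmxBl mulVmx// mul1mx -mulmxA mulmxV// mulmx1.
  pose A := Q x *m (Phi (x \+v v) - Phi x) *m Q x.
  have -> : Q x *m (Phi (x \+v v) - Phi x) *m (Q x *m (Phi (x \+v v) - Phi x)) *m Q (x \+v v) =
      A - (Q x - Q (x \+v v)).
    by rewrite -mulmxA E1 mulmxBr E1.
  rewrite -/(Q x) -/(Q (x \+v v)); set B := Q x *m DPhi x v *m Q x.
  have -> : Q x *m (Phi (x \+v v) - Phi x - DPhi x v) *m Q x = A - B.
    by rewrite mulmxBr mulmxBl.
  move: A B (Q x) (Q _) => A B q q'; rewrite opprK !opprB.
  by rewrite addrC addrA subrK addrC.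
- move=> x y v a b; rewrite (dp_lin h) mulmx_lincombr mulmx_lincombl opprD.
  by rewrite !scalerN.
- move=> i j; apply: (@eq_cmeasurable _ _ _ (fun u : V2 => (-1) *
    (Q (u \o inl) *m DPhi (u \o inl) (u \o inr) *m Q (u \o inl)) i j)).
    by move=> u; rewrite mulN1r [RHS]mxE.
  apply: cmeasurableM; first exact: cmeasurable_cst.
  by apply: cmeasurable_mulmx => //; apply: cmeasurable_mulmx => //; exact: dp_dmeas h.
Qed.

Lemma dp_linear m n (B : I -> 'M[C]_(m, n)) :
  differentiable_poly (fun x => \sum_k ((x k)%:C)%C *: B k)
    (fun _ v => \sum_k ((v k)%:C)%C *: B k).
Proof.
pose L (v : V) := \sum_k ((v k)%:C)%C *: B k.
pose K := \sum_k sum_norm (B k).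
have K0 : 0 <= K by apply: sumr_ge0 => k _; exact: sum_norm_ge0.
have Lle v : sum_norm (L v) <= K * l1 v.
  apply: (@le_trans _ _ (\sum_k `|v k| * sum_norm (B k))).
    rewrite /L; elim/big_ind2: _ => [|A a A' a' h h'|k _].
    - by rewrite sum_norm0.
    - exact: le_trans (sum_normD_le _ _) (lerD h h').
    - by rewrite sum_normZ cmod_real.
  rewrite /K mulr_suml; apply: ler_sum => k _.
  rewrite mulrC ler_wpM2l ?sum_norm_ge0// /l1 (bigD1 k)//= lerDl.
  exact: sumr_ge0.
have mL d (T : measurableType d) (X : T -> V) :
    (forall k, measurable_fun setT (fun t => X t k)) ->
    forall i j, cmeasurable (fun t => L (X t) i j).
  move=> mX i j; apply: (@eq_cmeasurable _ _ _ (fun t => \sum_k ((X t k)%:C)%C * B k i j)).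
    by move=> t; rewrite /L summxE; apply: eq_bigr => k _; rewrite mxE.
  apply: cmeasurable_sum => k _; apply: cmeasurableM; last exact: cmeasurable_cst.
  by split => //; exact: mX.
split.
- exists K, 1%N; split=> // x v; apply: (le_trans (Lle x)).
  by rewrite expr0 mulr1 expr1 ler_wpM2l// addrAC lerDr addr_ge0// l1_ge0.
- by exists K, 0%N; split=> // x v; rewrite expr0 expr1 mulr1; exact: Lle.
- apply: eq_vanishes (vanishes_zero 2 m n) => x v.
  apply/esym/eqP; rewrite subr_eq add0r subr_eq addrC -big_split/=; apply/eqP.
  by apply: eq_bigr => k _; rewrite -scalerDl rmorphD.
- move=> _ y v a b; rewrite !scaler_sumr -big_split/=; apply: eq_bigr => k _.
  by rewrite rmorphD !rmorphM/= scalerDl !scalerA.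
- by apply: mL => k; exact: measurable_coord.
- by apply: (mL _ _ (fun u : V2 => u \o inr)) => k; exact: measurable_coord.
Qed.

End growth.

(** * From the Poincare inequality to normalised traces *)

Section variance_bound.
Variables (R : realType) (d : measure_display) (T : measurableType d).
Variable P : probability T R.
Variables (I : finType) (Z : I -> {RV P >-> R}).
Hypothesis Z_normal : forall j, standard_normal P (Z j).
Hypothesis Z_indep : mutually_independent P (fun j t => Z j t).
Local Notation C := R[i].
Let Zv (t : T) (i : I) : R := Z i t.

Lemma ntrD n (A B : 'M[C]_n) : ntr (A + B) = ntr A + ntr B.
Proof. by rewrite /ntr mxtraceD mulrDr. Qed.

Lemma ntrN n (A : 'M[C]_n) : ntr (- A) = - ntr A.
Proof. by rewrite /ntr raddfN mulrN. Qed.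

Lemma ntrZ n (a : C) (A : 'M[C]_n) : ntr (a *: A) = a * ntr A.
Proof. by rewrite /ntr mxtraceZ mulrCA. Qed.

(** The [4] is the [8] of the Poincare inequality halved, two independent copies producing twice the
    variance. Polynomial growth provides square integrability. *)
Lemma cvariance_gaussian_le n (Phi : (I -> R) -> 'M[C]_n) DPhi (B : R) :
  differentiable_poly Phi DPhi ->
  (\int[P \x P]_t (cmod (ntr (DPhi (Zv t.1) (Zv t.2))) ^+ 2)%:E <= B%:E)%E ->
  (cvariance P (fun t => ntr (Phi (Zv t))) <= (4 * B)%:E)%E.
Proof.
move=> h hB.
have mZ i : measurable_fun setT (fun t => Zv t i) by exact: measurable_funP.
have mF : cmeasurable (fun x : family_space R I => ntr (Phi x)).
  exact: cmeasurable_ntr (dp_meas h).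
have mX : cmeasurable (fun t => ntr (Phi (Zv t))).
  have mZv := measurable_family mZ; case: mF => m1 m2; split.
    exact: (measurableT_comp m1 mZv).
  exact: (measurableT_comp m2 mZv).
have [K0 [p0 [K00 hv]]] := dp_val h.
have [K1 [p1 [K10 hd]]] := dp_der h.
have [K2 [p2 [K20 hr]]] := dp_rem h.
have base (x v : I -> R) : 1 <= 1 + l1 x + l1 v.
  by rewrite -addrA lerDl addr_ge0// l1_ge0.
apply: cvariance_le_pair => //.
  (* The growth bound speaks of a point and an increment; integrating over both copies lets the
     second one play the increment. *)
  apply: (@le_lt_trans _ _ (\int[P \x P]_t ((K0 ^+ 2)%:E *
      ((1 + l1 (Zv t.1) + l1 (Zv t.2)) ^+ (p0 * 2))%:E))%E).
    have mX2 : measurable_fun setT (fun t => (cmod (ntr (Phi (Zv t))) ^+ 2)%:E).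
      by apply/measurable_EFinP; exact: measurable_cmod_sqr.
    rewrite -(@ge0_integral_fst _ _ _ P (fun t => (cmod (ntr (Phi (Zv t))) ^+ 2)%:E))//; last first.
      by move=> t; rewrite lee_fin sqr_ge0.
    have ml : measurable_fun setT (fun t : T * T => 1 + l1 (Zv t.1) + l1 (Zv t.2)).
      have mn (f : T * T -> R) : measurable_fun setT f -> measurable_fun setT (fun t => `|f t|).
        by move=> mf; exact: (measurableT_comp (@normr_measurable R setT)).
      apply: measurable_funD; first apply: measurable_funD => //.
        by apply: measurable_sum => i; apply: mn; exact: measurable_fst_RV.
      by apply: measurable_sum => i; apply: mn; exact: measurable_snd_RV.
    apply: ge0_le_integral => //.
    - by move=> t _; rewrite lee_fin sqr_ge0.
    - by apply: (measurableT_comp mX2); exact: measurable_fst.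
    - apply: emeasurable_funM; first exact: measurable_cst.
      by apply/measurable_EFinP; exact: measurable_funX.
    - move=> t _; rewrite -EFinM lee_fin exprM -exprMn ler_sqr ?nnegrE ?cmod_ge0//; last first.
        by rewrite mulr_ge0// exprn_ge0// (le_trans ler01).
      apply: (le_trans (cmod_ntr_le _)); apply: (le_trans (hv _ (Zv t.2))).
      by rewrite expr0 mulr1.
  rewrite ge0_integralZl_EFin//.
  - apply: lte_mul_pinfty; rewrite ?lee_fin ?sqr_ge0//.
    exact: gaussian_moment_lty.
  - by move=> t _; rewrite lee_fin exprn_ge0// (le_trans ler01).
  - apply/measurable_EFinP; apply: measurable_funX.
    have mn (f : T * T -> R) : measurable_fun setT f -> measurable_fun setT (fun t => `|f t|).
      by move=> mf; exact: (measurableT_comp (@normr_measurable R setT)).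
    apply: measurable_funD; first apply: measurable_funD => //.
      by apply: measurable_sum => i; apply: mn; exact: measurable_fst_RV.
    by apply: measurable_sum => i; apply: mn; exact: measurable_snd_RV.
  - exact: sqr_ge0.
have H := @gaussian_poincare R d T P I Z Z_normal Z_indep (fun x => ntr (Phi x))
  (fun x v => ntr (DPhi x v)) (K1 + K2) (p1 + p2).
apply: le_trans (H _ _ _ _ _ _) _.
- exact: addr_ge0.
- by move=> x y v a b; rewrite (dp_lin h) ntrD !ntrZ.
- move=> x v; apply: (le_trans (cmod_ntr_le _)); apply: (le_trans (hd x v)).
  rewrite expr1; apply: ler_pM => //.
  + by rewrite mulr_ge0// l1_ge0.
  + by rewrite exprn_ge0// (le_trans ler01).
  + by rewrite ler_wpM2r ?l1_ge0// lerDl.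
  + by apply: ler_weXn2l => //; rewrite leq_addr.
- move=> x v; rewrite -!ntrN -!ntrD; apply: (le_trans (cmod_ntr_le _)).
  apply: (le_trans (hr x v)); apply: ler_pM => //.
  + by rewrite mulr_ge0// exprn_ge0// l1_ge0.
  + by rewrite exprn_ge0// (le_trans ler01).
  + by rewrite ler_wpM2r ?exprn_ge0 ?l1_ge0// lerDr.
  + by apply: ler_weXn2l => //; rewrite leq_addl.
- exact: mF.
- exact: cmeasurable_ntr (dp_dmeas h).
apply: (@le_trans _ _ (8%:E * B%:E)%E); first exact: lee_wpmul2l.
by rewrite -EFinM lee_fin; lra.
Qed.

End variance_bound.

(** * Second moments of the Hankel entries *)

Section quadratic_forms.
Variables (R : realType) (d : measure_display) (T : measurableType d).
Variable P : probability T R.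
Local Notation C := R[i].

(** Split into real and imaginary parts because expectations and Fourier coefficients are pairs of
    real integrals. *)
Lemma cmod_sqr_sumE (J : finType) (c x : J -> C) :
  cmod (\sum_p c p * x p) ^+ 2 =
  \sum_p \sum_q (complex.Re (c p * Num.conj (c q)) * complex.Re (x p * Num.conj (x q)) -
                 complex.Im (c p * Num.conj (c q)) * complex.Im (x p * Num.conj (x q))).
Proof.
have ReM (u v : C) : complex.Re (u * v) =
    complex.Re u * complex.Re v - complex.Im u * complex.Im v by case: u v => [? ?] [? ?].
rewrite -ReM_conj rmorph_sum/= mulr_suml Re_sum; apply: eq_bigr => p _.
rewrite mulr_sumr Re_sum; apply: eq_bigr => q _.
by rewrite rmorphM mulrACA ReM.
Qed.

Lemma integral_cmod_sqr_sum (J : finType) (X : J -> T -> C) (c : J -> C) :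
  (forall p, cmeasurable (X p)) ->
  (forall p, (\int[P]_t (cmod (X p t) ^+ 2)%:E < +oo)%E) ->
  (\int[P]_t (cmod (\sum_p c p * X p t) ^+ 2)%:E =
   (complex.Re (\sum_p \sum_q c p * Num.conj (c q) *
      cexpectation P (fun t => X p t * Num.conj (X q t))))%:E)%E.
Proof.
move=> mX X2.
have int p q : P.-integrable setT (fun t => (complex.Re (X p t * Num.conj (X q t)))%:E) /\
    P.-integrable setT (fun t => (complex.Im (X p t * Num.conj (X q t)))%:E).
  have [m1 m2] : cmeasurable (fun t => X p t * Num.conj (X q t)).
    by apply: cmeasurableM => //; exact: cmeasurable_conj.
  have isq r : P.-integrable setT (fun t => (cmod (X r t) ^+ 2)%:E).
    apply/integrableP; split; first by apply/measurable_EFinP; exact: measurable_cmod_sqr.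
    by under eq_integral do rewrite /= ger0_norm ?sqr_ge0//.
  have idom := integrableD measurableT (isq p) (isq q).
  have bound t : cmod (X p t * Num.conj (X q t)) <= cmod (X p t) ^+ 2 + cmod (X q t) ^+ 2.
    rewrite cmodM cmod_conj; have := sqr_ge0 (cmod (X p t) - cmod (X q t)).
    have := sqr_ge0 (cmod (X p t)); have := sqr_ge0 (cmod (X q t)).
    by nra.
  have absc (u : C) : `|complex.Re u| <= cmod u /\ `|complex.Im u| <= cmod u.
    by split; rewrite -ler_sqr ?nnegrE ?cmod_ge0// real_normK ?num_real// cmod_sqr
      ?lerDl ?lerDr sqr_ge0.
  split; apply: (le_integrable measurableT _ _ idom) => //.
  - exact/measurable_EFinP.
  - move=> t _; rewrite /= lee_fin [leRHS]ger0_norm ?addr_ge0 ?sqr_ge0//.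
    exact: le_trans (absc _).1 (bound t).
  - exact/measurable_EFinP.
  - move=> t _; rewrite /= lee_fin [leRHS]ger0_norm ?addr_ge0 ?sqr_ge0//.
    exact: le_trans (absc _).2 (bound t).
pose a p q := complex.Re (c p * Num.conj (c q)).
pose b p q := complex.Im (c p * Num.conj (c q)).
pose f p q t := ((a p q)%:E * (complex.Re (X p t * Num.conj (X q t)))%:E -
  (b p q)%:E * (complex.Im (X p t * Num.conj (X q t)))%:E)%E.
have intf p q : P.-integrable setT (f p q).
  have [i1 i2] := int p q.
  by apply: integrableB => //; exact: integrableZl.
transitivity (\int[P]_t (\sum_p \sum_q f p q t))%E.
  apply: eq_integral => t _; rewrite cmod_sqr_sumE -sumEFin; apply: eq_bigr => p _.
  by rewrite -sumEFin; apply: eq_bigr => q _; rewrite EFinB !EFinM.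
rewrite integral_sum//; last by move=> p; apply: integrable_sum.
rewrite Re_sum -sumEFin; apply: eq_bigr => p _.
rewrite integral_sum// Re_sum -sumEFin; apply: eq_bigr => q _.
have [i1 i2] := int p q.
rewrite /f integralB//; [|exact: integrableZl|exact: integrableZl].
rewrite !integralZl//.
have e1 := integrable_fin_num measurableT i1.
have e2 := integrable_fin_num measurableT i2.
rewrite -(fineK e1) -(fineK e2) -!EFinM -EFinB; congr (_%:E).
rewrite /cexpectation unlock.
by rewrite /a /b; case: (c p * Num.conj (c q)).
Qed.

End quadratic_forms.

(** * Toeplitz forms of a bounded symbol *)

Section toeplitz.
Variable R : realType.
Local Notation C := R[i].
Local Notation mu := (@lebesgue_measure R).
Local Notation I01 := (`[0, 1]%classic : set R).

Lemma sin2pi_int (j : int) : sin (2 * pi * j%:~R) = 0 :> R.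
Proof.
have nat_case (n : nat) : sin (2 * pi * n%:R) = 0 :> R.
  elim: n => [|n IH]; first by rewrite mulr0 sin0.
  rewrite -(natr1 n) mulrDr mulr1 sinD IH mul0r add0r.
  have -> : 2 * pi = pi *+ 2 :> R by rewrite mulr_natl.
  by rewrite sin2pi mulr0.
case: j => n; first exact: nat_case.
by rewrite NegzE mulrNz mulrN sinN nat_case oppr0.
Qed.

Lemma cos2pi_int (j : int) : cos (2 * pi * j%:~R) = 1 :> R.
Proof.
have nat_case (n : nat) : cos (2 * pi * n%:R) = 1 :> R.
  elim: n => [|n IH]; first by rewrite mulr0 cos0.
  rewrite -(natr1 n) mulrDr mulr1 cosD IH mul1r.
  have -> : 2 * pi = pi *+ 2 :> R by rewrite mulr_natl.
  by rewrite cos2pi sin2pi mulr0 subr0.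
case: j => n; first exact: nat_case.
by rewrite NegzE mulrNz mulrN cosN nat_case.
Qed.


Lemma Rintegral01_derive (F f : R -> R) : (forall x : R, is_derive x 1 F (f x)) ->
  continuous f -> (\int[mu]_(x in I01) f x)%R = F 1 - F 0.
Proof.
move=> dF cf; rewrite /Rintegral.
have cF : continuous F.
  move=> x; apply: differentiable_continuous.
  by apply/derivable1_diffP; exact: (@ex_derive _ _ _ _ _ _ _ (dF x)).
have -> : (\int[mu]_(x in I01) (f x)%:E = (F 1)%:E - (F 0)%:E)%E.
  apply: continuous_FTC2 => //.
  - by apply: continuous_subspaceT => x; exact: cf.
  - split.
    + by move=> x _; exact: (@ex_derive _ _ _ _ _ _ _ (dF x)).
    + by apply: cvg_at_right_filter; exact: cF.
    + by apply: cvg_at_left_filter; exact: cF.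
  - by move=> x _; rewrite derive1E (@derive_val _ _ _ _ _ _ _ (dF x)).
by [].
Qed.

Let continuous_mulr (a : R) : continuous (fun x : R => a * x).
Proof. by move=> x; apply: cvgMr; exact: cvg_id. Qed.

Lemma Rintegral_cos2pi (j : int) :
  (\int[mu]_(x in I01) cos (2 * pi * x * j%:~R))%R = (j == 0)%:R :> R.
Proof.
have [->|j0] := eqVneq j 0.
  rewrite (@eq_Rintegral _ _ _ mu I01 (fun=> 1)).
    by rewrite Rintegral_cst//= lebesgue_measure_itv/= lte01 oppr0 adde0 mulr1.
  by move=> x _; rewrite mulr0 cos0.
pose a : R := 2 * pi * j%:~R.
have a0 : a != 0 by rewrite !mulf_neq0 ?intr_eq0// gt_eqF// pi_gt0.
rewrite (@eq_Rintegral _ _ _ mu I01 (fun x => cos (a * x))); last first.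
  by move=> x _; rewrite /a; congr cos; ring.
have dF (x : R) : is_derive x 1 (fun x => a^-1 * sin (a * x)) (cos (a * x)).
  by apply: is_derive_eq; rewrite /GRing.scale /=; field.
have cf : continuous (fun x : R => cos (a * x)).
  by move=> x; apply: (continuous_comp (@continuous_mulr a x)); exact: continuous_cos.
rewrite (Rintegral01_derive dF cf).
by rewrite !mulr1 mulr0 sin0 mulr0 /a sin2pi_int mulr0 subrr.
Qed.

Lemma Rintegral_sin2pi (j : int) :
  (\int[mu]_(x in I01) sin (2 * pi * x * j%:~R))%R = 0 :> R.
Proof.
have [->|j0] := eqVneq j 0.
  rewrite (@eq_Rintegral _ _ _ mu I01 (fun=> 0)).
    by rewrite Rintegral_cst// mul0r.
  by move=> x _; rewrite mulr0 sin0.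
pose a : R := 2 * pi * j%:~R.
have a0 : a != 0 by rewrite !mulf_neq0 ?intr_eq0// gt_eqF// pi_gt0.
rewrite (@eq_Rintegral _ _ _ mu I01 (fun x => sin (a * x))); last first.
  by move=> x _; rewrite /a; congr sin; ring.
have dF (x : R) : is_derive x 1 (fun x => - a^-1 * cos (a * x)) (sin (a * x)).
  by apply: is_derive_eq; rewrite /GRing.scale /=; field.
have cf : continuous (fun x : R => sin (a * x)).
  by move=> x; apply: (continuous_comp (@continuous_mulr a x)); exact: continuous_sin.
rewrite (Rintegral01_derive dF cf).
by rewrite !mulr1 mulr0 cos0 mulr1 /a cos2pi_int mulr1 subrr.
Qed.

Section form.
Variables (n : nat) (c : 'I_n -> C).
Let al k l := complex.Re (c k * Num.conj (c l)).
Let be k l := complex.Im (c k * Num.conj (c l)).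
Let co (k l : 'I_n) (x : R) := cos (2 * pi * x * (k%:Z - l%:Z)%:~R).
Let si (k l : 'I_n) (x : R) := sin (2 * pi * x * (k%:Z - l%:Z)%:~R).
Let g x := cmod (\sum_k c k * cis (2 * pi * x * k%:R)) ^+ 2.

Let gE x : g x = \sum_k \sum_l (al k l * co k l x - be k l * si k l x).
Proof.
rewrite /g cmod_sqr_sumE; apply: eq_bigr => k _; apply: eq_bigr => l _.
have -> : cis (2 * pi * x * k%:R) * Num.conj (cis (2 * pi * x * l%:R)) =
    Complex (co k l x) (si k l x) :> C.
  rewrite /co /si; have -> : 2 * pi * x * (k%:Z - l%:Z)%:~R =
      2 * pi * x * k%:R - 2 * pi * x * l%:R by rewrite rmorphB/= mulrBr.
  rewrite conjC_conjc cosB sinB; apply/eqP; rewrite eq_complex /=.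
  by apply/andP; split; apply/eqP; ring.
by [].
Qed.

Let integrable_mul (h u : R -> R) : mu.-integrable I01 (EFin \o h) ->
  measurable_fun setT u -> (forall x, `|u x| <= 1) ->
  mu.-integrable I01 (fun x => (h x * u x)%:E).
Proof.
move=> ih mu_ u1; have mh : measurable_fun I01 h.
  by apply/measurable_EFinP; exact: measurable_int ih.
apply: (le_integrable _ _ _ ih) => //.
- by apply/measurable_EFinP; apply: measurable_funM => //; exact: measurable_funTS.
- move=> x _; rewrite /= lee_fin normrM ler_piMr//.
Qed.

Let mco k l : measurable_fun setT (co k l).
Proof.
apply: continuous_measurable_fun => x.
apply: (@continuous_comp _ _ _ (fun x : R => 2 * pi * x * (k%:Z - l%:Z)%:~R) cos).
  by apply: cvgMl; apply: cvgMr; exact: cvg_id.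
exact: continuous_cos.
Qed.

Let msi k l : measurable_fun setT (si k l).
Proof.
apply: continuous_measurable_fun => x.
apply: (@continuous_comp _ _ _ (fun x : R => 2 * pi * x * (k%:Z - l%:Z)%:~R) sin).
  by apply: cvgMl; apply: cvgMr; exact: cvg_id.
exact: continuous_sin.
Qed.

Let term (h : R -> R) k l x := ((al k l)%:E * (h x * co k l x)%:E -
    (be k l)%:E * (h x * si k l x)%:E)%E.

Let hgE h x : (h x * g x)%:E = (\sum_k \sum_l term h k l x)%E.
Proof.
rewrite gE mulr_sumr -sumEFin; apply: eq_bigr => k _.
rewrite mulr_sumr -sumEFin; apply: eq_bigr => l _.
by rewrite /term -!EFinM -EFinB; congr (_%:E); ring.
Qed.

Let integrable_term h k l : mu.-integrable I01 (EFin \o h) ->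
  mu.-integrable I01 (term h k l).
Proof.
move=> ih; apply: integrableB => //; apply: integrableZl => //; apply: integrable_mul => //.
  by move=> x; exact: cos_max.
by move=> x; exact: sin_max.
Qed.

Let integrable_hg h : mu.-integrable I01 (EFin \o h) ->
  mu.-integrable I01 (fun x => (h x * g x)%:E).
Proof.
move=> ih; rewrite (_ : (fun x => (h x * g x)%:E) = (fun x => \sum_k \sum_l term h k l x)%E).
  by apply: integrable_sum => // k _; apply: integrable_sum => // l _; exact: integrable_term.
by apply/funext => x; exact: hgE.
Qed.

(** The coefficient at [k - l] integrates [h] against a product of [cis] at [k] and a conjugate
    [cis] at [l], so the double sum recombines under the integral into the squared modulus [g]. *)
Lemma fourier_formE (h : R -> R) : mu.-integrable I01 (EFin \o h) ->
  complex.Re (\sum_k \sum_l c k * Num.conj (c l) * fourier_coef h (k%:Z - l%:Z)) =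
  (\int[mu]_(x in I01) (h x * g x))%R.
Proof.
move=> ih; rewrite /Rintegral.
under eq_integral do rewrite hgE.
have it k l : mu.-integrable I01 (term h k l) by exact: integrable_term.
rewrite integral_sum//; last by move=> k; apply: integrable_sum.
rewrite Re_sum -sum_fine; last first.
  move=> k _; apply: integrable_fin_num => //; exact: integrable_sum.
apply: eq_bigr => k _; rewrite integral_sum// Re_sum -sum_fine; last first.
  by move=> l _; exact: integrable_fin_num.
apply: eq_bigr => l _.
have ic : mu.-integrable I01 (fun x => (h x * co k l x)%:E).
  by apply: integrable_mul => // x; exact: cos_max.
have is_ : mu.-integrable I01 (fun x => (h x * si k l x)%:E).
  by apply: integrable_mul => // x; exact: sin_max.
rewrite /term integralB//; [|exact: integrableZl|exact: integrableZl].
rewrite !integralZl//.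
have fint u : mu.-integrable I01 u -> (\int[mu]_(x in I01) u x)%E \is a fin_num.
  by move=> iu; exact: integrable_fin_num.
rewrite fineB; [|by apply: fin_numM => //; exact: fint|by apply: fin_numM => //; exact: fint].
rewrite !fineM//; [|exact: fint|exact: fint].
rewrite /al /be /fourier_coef /Rintegral /co /si.
by case: (c k * Num.conj (c l)).
Qed.

(* The Toeplitz form of f is the integral of f against a nonnegative
   trigonometric polynomial. *)
Lemma fourier_form_le (f : R -> R) (b : R) :
  mu.-integrable I01 (EFin \o f) -> (forall x, 0 <= x <= 1 -> f x <= b) ->
  complex.Re (\sum_k \sum_l c k * Num.conj (c l) * fourier_coef f (k%:Z - l%:Z)) <=
  b * \sum_k cmod (c k) ^+ 2.
Proof.
move=> if_ fb.
have ib : mu.-integrable I01 (EFin \o (fun=> b)).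
  apply: measurable_bounded_integrable => //.
    by rewrite /= lebesgue_measure_itv/= lte01 -EFinB ltry.
  by exists `|b|; split=> // M bM x _; exact: ltW.
rewrite fourier_formE//; apply: (@le_trans _ _ (\int[mu]_(x in I01) (b * g x))%R).
  apply: le_Rintegral => //; [exact: integrable_hg|exact: integrable_hg|].
  by move=> x; rewrite /= in_itv/= => x01; rewrite ler_wpM2r ?sqr_ge0// fb.
(* The majorant is the same form for the constant symbol [b], whose Toeplitz matrix is [b] times the
   identity by orthogonality of the exponentials. *)
rewrite -fourier_formE// le_eqVlt; apply/orP; left; apply/eqP.
have fc (j : int) : fourier_coef (fun=> b) j = ((b * (j == 0)%:R)%:C)%C.
  have cint (u : R -> R) : continuous u -> (forall x, `|u x| <= 1) ->
      mu.-integrable I01 (EFin \o u).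
    move=> cu u1; apply: measurable_bounded_integrable => //.
    - by rewrite /= lebesgue_measure_itv/= lte01 -EFinB ltry.
    - by apply: measurable_funTS; exact: continuous_measurable_fun.
    - by exists 1; split=> // M M1 x _; apply: (le_trans (u1 x)); exact: ltW.
  have clin : continuous (fun x : R => 2 * pi * x * j%:~R).
    by move=> x; apply: cvgMl; apply: cvgMr; exact: cvg_id.
  rewrite /fourier_coef !RintegralZl//.
  - by rewrite Rintegral_cos2pi Rintegral_sin2pi mulr0.
  - apply: cint => x; last exact: sin_max.
    by apply: (continuous_comp (clin x)); exact: continuous_sin.
  - apply: cint => x; last exact: cos_max.
    by apply: (continuous_comp (clin x)); exact: continuous_cos.
rewrite mulr_sumr Re_sum; apply: eq_bigr => k _.
rewrite (bigD1 k)//= big1 ?addr0 => [|l lk].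
  by rewrite subrr fc eqxx mulr1 mulr_conjC -rmorphM/= mulrC.
rewrite fc subr_eq0 eqz_nat eq_sym (negPf (_ : l != k :> nat)) ?mulr0 ?rmorph0 ?mulr0//.
Qed.

End form.
End toeplitz.

(** * Linear statistics of the block Hankel matrix *)

Section hankel_covariance.
Variables (R : realType) (d : measure_display) (T : measurableType d).
Variable P : probability T R.
Variables (I : finType) (Z : I -> {RV P >-> R}).
Hypothesis Z_normal : forall j, standard_normal P (Z j).
Local Notation C := R[i].
Local Notation mu := (@lebesgue_measure R).
Let Zv (t : T) (i : I) : R := Z i t.

Variables (M L N : nat).
Hypotheses (L_gt0 : (0 < L)%N) (N_gt0 : (0 < N)%N).
Local Notation idx := ('I_M * 'I_(N + L - 1))%type.
Variable al : idx -> I -> C.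

Definition linear_entry (p : idx) (x : I -> R) : C := \sum_j ((x j)%:C)%C * al p j.

Lemma row_block_proof (r : 'I_(M * L)) : (r %/ L < M)%N.
Proof. by rewrite ltn_divLR. Qed.

Lemma antidiagonal_proof (r : 'I_(M * L)) (j : 'I_N) : (r %% L + j < N + L - 1)%N.
Proof.
by move: (ltn_pmod r L_gt0) (ltn_ord j); clear; lia.
Qed.

(** Block and antidiagonal of an entry: two entries with the same index are the same random
    variable. *)
Definition hankel_idx (r : 'I_(M * L)) (j : 'I_N) : idx :=
  (Ordinal (row_block_proof r), Ordinal (antidiagonal_proof r j)).

Definition linear_hankel (x : I -> R) : 'M[C]_(M * L, N) :=
  \matrix_(r, j) linear_entry (hankel_idx r j) x.

Variables (f : 'I_M -> R -> R) (b : R).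
Hypothesis f_int : forall m, mu.-integrable `[0, 1] (EFin \o f m).
Hypothesis f_le : forall m x, 0 <= x <= 1 -> f m x <= b.
Hypothesis b_ge0 : 0 <= b.
Hypothesis cov : forall p q : idx,
  cexpectation P (fun t => linear_entry p (Zv t) * Num.conj (linear_entry q (Zv t))) =
  fourier_coef (f p.1) ((p.2 : nat)%:Z - (q.2 : nat)%:Z) / N%:R * (p.1 == q.1)%:R.

Lemma linear_entry_meas p : cmeasurable (fun t => linear_entry p (Zv t)).
Proof.
apply: cmeasurable_sum => j _; apply: cmeasurableM; last exact: cmeasurable_cst.
by split => //=; exact: measurable_funP.
Qed.

Lemma linear_entry_L2 p : (\int[P]_t (cmod (linear_entry p (Zv t)) ^+ 2)%:E < +oo)%E.
Proof.
have mZq j : measurable_fun setT (fun t => (`|Z j t| ^+ 2)%:E).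
  apply/measurable_EFinP; apply: measurable_funX.
  by apply: (measurableT_comp (@normr_measurable R setT)); exact: measurable_funP.
pose w j := cmod (al p j) ^+ 2.
have w0 j : 0 <= w j by exact: sqr_ge0.
have mt j : measurable_fun setT (fun t => (w j)%:E * (`|Z j t| ^+ 2)%:E)%E.
  by apply: emeasurable_funM => //; exact: measurable_cst.
have t0 j t : (0 <= (w j)%:E * (`|Z j t| ^+ 2)%:E)%E.
  by rewrite mule_ge0// lee_fin ?sqr_ge0.
apply: (@le_lt_trans _ _ (\int[P]_t (#|I|%:R%:E *
    \sum_j ((w j)%:E * (`|Z j t| ^+ 2)%:E)))%E).
  apply: ge0_le_integral => //.
  - by move=> t _; rewrite lee_fin sqr_ge0.
  - by apply/measurable_EFinP; apply: measurable_cmod_sqr; exact: linear_entry_meas.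
  - apply: emeasurable_funM; first exact: measurable_cst.
    exact: emeasurable_sum.
  - move=> t _; under eq_bigr do rewrite -EFinM.
    rewrite sumEFin -EFinM lee_fin.
    apply: (le_trans (cmod_sqr_sum_le I _)); rewrite ler_wpM2l//.
    apply: ler_sum => j _; rewrite cmodM cmod_real exprMn mulrC.
    by [].
rewrite ge0_integralZl_EFin//; last 2 first.
- by move=> t _; apply: sume_ge0.
- exact: emeasurable_sum.
rewrite ge0_integral_sum//.
apply: lte_mul_pinfty => //; apply: lte_sum_pinfty => j _.
rewrite ge0_integralZl_EFin//.
by apply: lte_mul_pinfty; rewrite ?lee_fin//; exact: standard_normal_moment.
Qed.

(** Distinct blocks are uncorrelated, so the second moment is a sum of [M] Toeplitz forms, each at
    most [b] times the squared norm of its coefficients. *)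
Lemma lincomb_variance_le (c : idx -> C) :
  (\int[P]_t (cmod (\sum_p c p * linear_entry p (Zv t)) ^+ 2)%:E <=
   (b / N%:R * \sum_p cmod (c p) ^+ 2)%:E)%E.
Proof.
rewrite integral_cmod_sqr_sum; [|exact: linear_entry_meas|exact: linear_entry_L2].
rewrite lee_fin.
have -> : \sum_p \sum_q c p * Num.conj (c q) * cexpectation P (fun t =>
      linear_entry p (Zv t) * Num.conj (linear_entry q (Zv t))) =
    \sum_m (((N%:R : R)^-1)%:C)%C * \sum_k \sum_l c (m, k) * Num.conj (c (m, l)) *
      fourier_coef (f m) ((k : nat)%:Z - (l : nat)%:Z).
  transitivity (\sum_m \sum_k \sum_q c (m, k) * Num.conj (c q) * cexpectation P (fun t =>
      linear_entry (m, k) (Zv t) * Num.conj (linear_entry q (Zv t)))).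
    by rewrite [RHS]pair_big/=; apply: eq_bigr => -[m k] _.
  apply: eq_bigr => m _; rewrite mulr_sumr; apply: eq_bigr => k _.
  transitivity (\sum_m' \sum_l c (m, k) * Num.conj (c (m', l)) * cexpectation P (fun t =>
      linear_entry (m, k) (Zv t) * Num.conj (linear_entry (m', l) (Zv t)))).
    by rewrite [RHS]pair_big/=; apply: eq_bigr => -[m' l] _.
  rewrite (bigD1 m)//= [X in _ + X]big1 ?addr0; last first.
    move=> m' mm'; apply: big1 => l _; rewrite cov/= eq_sym (negPf mm').
    by rewrite !mulr0.
  rewrite mulr_sumr; apply: eq_bigr => l _; rewrite cov/= eqxx mulr1.
  by rewrite fmorphV rmorph_nat; ring.
have -> : \sum_p cmod (c p) ^+ 2 = \sum_m \sum_k cmod (c (m, k)) ^+ 2.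
  by rewrite pair_big/=; apply: eq_bigr => -[m k] _.
rewrite Re_sum mulr_sumr; apply: ler_sum => m _.
have ReZ (u : R) (v : C) : complex.Re ((u%:C)%C * v) = u * complex.Re v.
  by case: v => v1 v2 /=; rewrite mul0r subr0.
rewrite ReZ mulrAC [leRHS]mulrC ler_wpM2l ?invr_ge0//.
by apply: (fourier_form_le (fun k => c (m, k))); [exact: f_int|exact: f_le].
Qed.

(** Coefficients of a repeated variable are first added up; by Cauchy-Schwarz this costs the number
    [s] of repetitions. It is applied with [s = L] to a whole matrix and [s = 1] to one column. *)
Lemma fiber_variance_le (J : finType) (e : J -> idx) (s : nat) (a : J -> C) :
  (forall p, #|[pred q | e q == p]| <= s)%N ->
  (\int[P]_t (cmod (\sum_q a q * linear_entry (e q) (Zv t)) ^+ 2)%:E <=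
   (b / N%:R * (s%:R * \sum_q cmod (a q) ^+ 2))%:E)%E.
Proof.
move=> es; pose c p := \sum_(q in [pred q | e q == p]) a q.
have -> : (\int[P]_t (cmod (\sum_q a q * linear_entry (e q) (Zv t)) ^+ 2)%:E =
    \int[P]_t (cmod (\sum_p c p * linear_entry p (Zv t)) ^+ 2)%:E)%E.
  apply: eq_integral => t _; congr ((cmod _ ^+ 2)%:E).
  rewrite (partition_big e xpredT)//=; apply: eq_bigr => p _.
  by rewrite /c mulr_suml; apply: eq_big => [q|q /eqP ->].
apply: (le_trans (lincomb_variance_le c)); rewrite lee_fin ler_wpM2l ?divr_ge0//.
rewrite (partition_big e xpredT)//= mulr_sumr; apply: ler_sum => p _.
apply: (le_trans (cmod_sqr_sum_le _ _)).
apply: (@le_trans _ _ (s%:R * \sum_(q in [pred q | e q == p]) cmod (a q) ^+ 2)).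
  rewrite ler_wpM2r ?ler_nat ?es//.
  by apply: sumr_ge0 => q _; exact: sqr_ge0.
by rewrite le_eqVlt; apply/orP; left; apply/eqP; congr (_ * _); apply: eq_bigl.
Qed.

(** Once block and antidiagonal are fixed, the row inside the block, one of [L], determines the
    entry. *)
Lemma hankel_fiber_le (p : idx) :
  (#|[pred q : 'I_(M * L) * 'I_N | hankel_idx q.1 q.2 == p]| <= L)%N.
Proof.
pose h (q : 'I_(M * L) * 'I_N) : 'I_L := Ordinal (ltn_pmod q.1 L_gt0).
rewrite -[X in (_ <= X)%N]card_ord; apply: (@leq_card_in _ _ h) => -[r j] [r' j'].
rewrite !inE/= => /eqP <- /eqP/esym E [hr].
case: E => Er Ej.
have rr : r = r'.
  by apply: val_inj; rewrite /= (divn_eq r L) (divn_eq r' L) Er hr.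
by congr (_, _) => //; apply: val_inj => /=; move: Ej; rewrite hr => /addnI.
Qed.

(** No variable is repeated within a column, hence no factor [L] in the moment of [W^H A] below. *)
Lemma hankel_idx_inj (j : 'I_N) : injective (hankel_idx ^~ j).
Proof.
move=> r r' [Er /addIn Em]; apply: val_inj.
by rewrite /= (divn_eq r L) (divn_eq r' L) Er Em.
Qed.

Lemma trace_hankel_variance_le (B : 'M[C]_(N, M * L)) :
  (\int[P]_t (cmod (\tr (B *m linear_hankel (Zv t))) ^+ 2)%:E <=
   (b / N%:R * (L%:R * fro2 B))%:E)%E.
Proof.
have := fiber_variance_le (fun q : 'I_(M * L) * 'I_N => B q.2 q.1) hankel_fiber_le.
have -> : \sum_(q : 'I_(M * L) * 'I_N) cmod (B q.2 q.1) ^+ 2 = fro2 B.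
  rewrite /fro2 exchange_big pair_big/=.
  by apply: eq_bigr => -[r j] _.
apply: le_trans; rewrite le_eqVlt; apply/orP; left; apply/eqP.
apply: eq_integral => t _; congr ((cmod _ ^+ 2)%:E).
rewrite /mxtrace; under eq_bigr do rewrite mxE.
rewrite exchange_big pair_big/=; apply: eq_bigr => -[r j] _.
by rewrite mxE.
Qed.

Lemma trace_ctr_hankel_variance_le (B : 'M[C]_(M * L, N)) :
  (\int[P]_t (cmod (\tr (ctrmx (linear_hankel (Zv t)) *m B)) ^+ 2)%:E <=
   (b / N%:R * (L%:R * fro2 B))%:E)%E.
Proof.
rewrite -(fro2_ctrmx B); apply: le_trans (trace_hankel_variance_le (ctrmx B)).
rewrite le_eqVlt; apply/orP; left; apply/eqP.
apply: eq_integral => t _; congr (_%:E).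
rewrite -[in LHS](ctrmxK B) -ctrmxM -cmod_conj; congr (cmod _ ^+ 2).
rewrite /mxtrace rmorph_sum/=; apply: eq_bigr => i _.
by rewrite ctrmxE conjCK.
Qed.

Lemma linear_hankel_meas i j : cmeasurable (fun t => linear_hankel (Zv t) i j).
Proof.
apply: (@eq_cmeasurable _ _ _ (fun t => linear_entry (hankel_idx i j) (Zv t))).
  by move=> t; rewrite mxE.
exact: linear_entry_meas.
Qed.

(** Each entry of [W^H A] pairs one column of [W] with one column of [A] and has second moment at
    most [b / N] times the squared norm of the latter; the [N] rows cancel the [1 / N]. *)
Lemma fro2_ctr_hankel_le (q : nat) (A : 'M[C]_(M * L, q)) :
  (\int[P]_t (fro2 (ctrmx (linear_hankel (Zv t)) *m A))%:E <= (b * fro2 A)%:E)%E.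
Proof.
pose g j l t := cmod ((ctrmx (linear_hankel (Zv t)) *m A) j l) ^+ 2.
have mg j l : measurable_fun setT (fun t => (g j l t)%:E).
  apply/measurable_EFinP; apply: measurable_cmod_sqr; apply: cmeasurable_mulmx.
    by apply: cmeasurable_ctrmx; exact: linear_hankel_meas.
  by move=> ? ?; exact: cmeasurable_cst.
have g0 j l t : (0 <= (g j l t)%:E)%E by rewrite lee_fin sqr_ge0.
have -> : (\int[P]_t (fro2 (ctrmx (linear_hankel (Zv t)) *m A))%:E =
    \int[P]_t (\sum_j \sum_l (g j l t)%:E))%E.
  apply: eq_integral => t _; rewrite /fro2 -sumEFin; apply: eq_bigr => j _.
  by rewrite -sumEFin.
rewrite ge0_integral_sum//; last 2 first.
- by move=> j; exact: emeasurable_sum.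
- by move=> j t _; exact: sume_ge0.
have H j l : (\int[P]_t (g j l t)%:E <=
    (b / N%:R * (1%:R * \sum_r cmod (Num.conj (A r l)) ^+ 2))%:E)%E.
  have fib p : (#|[pred r | hankel_idx r j == p]| <= 1)%N.
    rewrite leqNgt; apply/negP => /card_gt1P[r [r' [rp rp' /eqP]]]; apply.
    by apply: (@hankel_idx_inj j); move: rp rp'; rewrite !inE => /eqP -> /eqP ->.
  apply: (le_trans _ (fiber_variance_le (fun r => Num.conj (A r l)) fib)).
  rewrite le_eqVlt; apply/orP; left; apply/eqP; apply: eq_integral => t _.
  rewrite /g -cmod_conj; congr ((cmod _ ^+ 2)%:E).
  rewrite mxE rmorph_sum/=; apply: eq_bigr => r _.
  by rewrite rmorphM/= ctrmxE conjCK mulrC mxE.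
apply: (@le_trans _ _ (\sum_(j < N) \sum_(l < q) (b / N%:R * (1%:R * \sum_r cmod (Num.conj (A r l)) ^+ 2))%:E)%E).
  apply: lee_sum => j _; rewrite ge0_integral_sum//.
  by apply: lee_sum => l _; exact: H.
rewrite (eq_bigr (fun j : 'I_N => (b / N%:R * fro2 A)%:E)); last first.
  move=> j _; rewrite sumEFin -mulr_sumr; congr ((_ * _)%:E).
  rewrite /fro2 exchange_big/=; apply: eq_bigr => l _; rewrite mul1r.
  by apply: eq_bigr => r _; rewrite cmod_conj.
rewrite sumEFin sumr_const card_ord lee_fin -[leLHS]mulr_natr mulrAC divfK//.
by rewrite pnatr_eq0 -lt0n.
Qed.

Lemma linear_hankel_dp : differentiable_poly linear_hankel (fun _ v => linear_hankel v).
Proof.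
pose B j : 'M[C]_(M * L, N) := \matrix_(r, c) al (hankel_idx r c) j.
have E x : linear_hankel x = \sum_j ((x j)%:C)%C *: B j.
  apply/matrixP => r c; rewrite mxE summxE; apply: eq_bigr => j _.
  by rewrite !mxE.
have -> : linear_hankel = (fun x => \sum_j ((x j)%:C)%C *: B j) by apply/funext.
exact: dp_linear.
Qed.

End hankel_covariance.

(** * Variances of the two functionals *)

Section trace_derivatives.
Variable R : realType.
Local Notation C := R[i].

Lemma fro2N m n (A : 'M[C]_(m, n)) : fro2 (- A) = fro2 A.
Proof. by rewrite -scaleN1r fro2Z cmodN (cmod_nat R 1) expr1n mul1r. Qed.

Lemma mxtraceN k (X : 'M[C]_k) : \tr (- X) = - \tr X.
Proof. exact: raddfN. Qed.

Variables (n m : nat) (A Q : 'M[C]_n) (W D : 'M[C]_(n, m)) (G : 'M[C]_m).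
Local Notation W' := (ctrmx W).
Local Notation D' := (ctrmx D).
Local Notation DQ := (- (Q *m ((D *m W' + W *m D') + 0) *m Q)).

(** The zeros are derivatives of constant factors, left where the product and inverse rules put them
    so that the expansion can be used as it comes. Cyclicity of the trace isolates the increment. *)
Lemma ntr_derivative_AQ :
  ntr (0 *m Q + A *m DQ) = n%:R^-1 *
    (\tr (- (W' *m Q *m A *m Q) *m D) + \tr (D' *m - (Q *m A *m (Q *m W)))).
Proof.
rewrite /ntr; congr (_ * _).
have t1 : \tr (A *m (Q *m (D *m W') *m Q)) = \tr (W' *m Q *m A *m Q *m D).
  transitivity (\tr ((A *m Q *m D) *m (W' *m Q))); first by rewrite !mulmxA.
  by rewrite mxtrace_mulC !mulmxA.
have t2 : \tr (A *m (Q *m (W *m D') *m Q)) = \tr (D' *m (Q *m A *m (Q *m W))).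
  transitivity (\tr ((A *m Q *m W) *m (D' *m Q))); first by rewrite !mulmxA.
  by rewrite mxtrace_mulC !mulmxA.
rewrite mul0mx add0r addr0 mulmxN mulNmx mulmxN !mxtraceN -t1 -t2.
by rewrite mulmxDr mulmxDl mulmxDr mxtraceD opprD.
Qed.

(** The four terms come from the two increments inside [Q] and from the factors [W] and [W^H].
    Parentheses group the pieces whose norms are controlled: [Q W], [W^H Q W] and [W^H A]. *)
Lemma ntr_derivative_AQWGW :
  ntr ((((0 *m Q + A *m DQ) *m W + A *m Q *m D) *m G + A *m Q *m W *m 0) *m W' +
    (A *m Q *m W *m G) *m D') = n%:R^-1 *
    (\tr ((G *m (W' *m A) *m Q - (W' *m Q *m W) *m (G *m (W' *m A) *m Q)) *m D) +
     \tr (D' *m (A *m (Q *m W) *m G - (Q *m W) *m (G *m (W' *m A) *m (Q *m W))))).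
Proof.
rewrite /ntr; congr (_ * _).
have a1 : \tr (A *m (Q *m (D *m W') *m Q) *m W *m G *m W') =
    \tr ((W' *m Q *m W) *m (G *m (W' *m A) *m Q) *m D).
  transitivity (\tr ((A *m Q *m D) *m (W' *m Q *m W *m G *m W'))); first by rewrite !mulmxA.
  by rewrite mxtrace_mulC !mulmxA.
have a2 : \tr (A *m (Q *m (W *m D') *m Q) *m W *m G *m W') =
    \tr (D' *m ((Q *m W) *m (G *m (W' *m A) *m (Q *m W)))).
  transitivity (\tr ((A *m Q *m W) *m (D' *m Q *m W *m G *m W'))); first by rewrite !mulmxA.
  by rewrite mxtrace_mulC !mulmxA.
have a3 : \tr (A *m Q *m D *m G *m W') = \tr (G *m (W' *m A) *m Q *m D).
  transitivity (\tr ((A *m Q *m D) *m (G *m W'))); first by rewrite !mulmxA.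
  by rewrite mxtrace_mulC !mulmxA.
have a4 : \tr (A *m Q *m W *m G *m D') = \tr (D' *m (A *m (Q *m W) *m G)).
  by rewrite mxtrace_mulC !mulmxA.
have dq : A *m DQ = - (A *m (Q *m (D *m W') *m Q)) - A *m (Q *m (W *m D') *m Q).
  by rewrite addr0 mulmxN mulmxDr mulmxDl mulmxDr opprD.
have expand (X1 X2 : 'M[C]_n) (Y : 'M[C]_(n, m)) : ((- X1 - X2) *m W + Y) *m G *m W' =
    - (X1 *m W *m G *m W') - X2 *m W *m G *m W' + Y *m G *m W'.
  by rewrite mulmxDl mulmxDl mulmxBl mulNmx mulmxBl mulNmx mulmxBl mulNmx.
have -> : 0 *m Q + A *m DQ = - (A *m (Q *m (D *m W') *m Q)) - A *m (Q *m (W *m D') *m Q).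
  by rewrite mul0mx add0r dq.
have tr4 (X Y U V : 'M[C]_n) : \tr (- X - Y + U + V) = - \tr X - \tr Y + \tr U + \tr V.
  by rewrite !mxtraceD !mxtraceN.
have trB k (X Y : 'M[C]_k) : \tr (X - Y) = \tr X - \tr Y by rewrite mxtraceD mxtraceN.
rewrite mulmx0 addr0 expand; apply: (etrans (tr4 _ _ _ _)).
have -> (X Y : 'M[C]_(m, n)) : \tr ((X - Y) *m D) = \tr (X *m D) - \tr (Y *m D).
  by rewrite mulmxBl trB.
have -> (X Y : 'M[C]_(n, m)) : \tr (D' *m (X - Y)) = \tr (D' *m X) - \tr (D' *m Y).
  by rewrite mulmxBr trB.
have fin (T1 T2 T3 T4 S1 S2 S3 S4 : C) : T1 = S1 -> T2 = S2 -> T3 = S3 -> T4 = S4 ->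
    - T1 - T2 + T3 + T4 = (S3 - S1) + (S4 - S2) by move=> -> -> -> ->; ring.
exact: fin a1 a2 a3 a4.
Qed.

End trace_derivatives.

Section functional_variances.
Variables (R : realType) (d : measure_display) (T : measurableType d).
Variable P : probability T R.
Variables (I : finType) (Z : I -> {RV P >-> R}).
Hypothesis Z_normal : forall j, standard_normal P (Z j).
Hypothesis Z_indep : mutually_independent P (fun j t => Z j t).
Local Notation C := R[i].
Local Notation mu := (@lebesgue_measure R).
Let Zv (t : T) (i : I) : R := Z i t.

Variables (M L N : nat).
Hypotheses (M_gt0 : (0 < M)%N) (L_gt0 : (0 < L)%N) (N_gt0 : (0 < N)%N).
Local Notation idx := ('I_M * 'I_(N + L - 1))%type.
Variable al : idx -> I -> C.
Variables (f : 'I_M -> R -> R) (b : R).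
Hypothesis f_int : forall m, mu.-integrable `[0, 1] (EFin \o f m).
Hypothesis f_le : forall m x, 0 <= x <= 1 -> f m x <= b.
Hypothesis b_ge0 : 0 <= b.
Hypothesis cov : forall p q : idx,
  cexpectation P (fun t => linear_entry al p (Zv t) * Num.conj (linear_entry al q (Zv t))) =
  fourier_coef (f p.1) ((p.2 : nat)%:Z - (q.2 : nat)%:Z) / N%:R * (p.1 == q.1)%:R.

Variables (A : 'M[C]_(M * L)).
Local Notation W := (linear_hankel L_gt0 al).

(** The [8] is the [4] of [cvariance_gaussian_le] times the [2] of [|u + v|^2 <= 2 |u|^2 + 2 |v|^2].
    The part [e1] is weighted by [W^H A], whose mean square costs one further [b]. *)
Lemma trace_form_variance_le (Phi : (I -> R) -> 'M[C]_(M * L)) DPhi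
    (B1 : (I -> R) -> 'M[C]_(N, M * L)) (B2 : (I -> R) -> 'M[C]_(M * L, N)) (e0 e1 : R) :
  differentiable_poly Phi DPhi ->
  (forall x v, ntr (DPhi x v) = (M * L)%:R^-1 *
    (\tr (B1 x *m W v) + \tr (ctrmx (W v) *m B2 x))) ->
  0 <= e1 ->
  (forall x, fro2 (B1 x) + fro2 (B2 x) <= e0 * fro2 A + e1 * fro2 (ctrmx (W x) *m A)) ->
  (cvariance P (fun t => ntr (Phi (Zv t))) <=
    (8 * b * (e0 + e1 * b) / (M * N)%:R * ((M * L)%:R^-1 * fro2 A))%:E)%E.
Proof.
move=> dPhi DE e10 BA.
have MLN0 : [/\ M%:R != 0 :> R, L%:R != 0 :> R & N%:R != 0 :> R].
  by rewrite !pnatr_eq0 -!lt0n.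
have [M0 L0 N0] := MLN0.
pose k : R := 2 * ((M * L)%:R^-1) ^+ 2 * (b / N%:R * L%:R).
have k0 : 0 <= k by rewrite !mulr_ge0 ?sqr_ge0 ?invr_ge0.
have -> : 8 * b * (e0 + e1 * b) / (M * N)%:R * ((M * L)%:R^-1 * fro2 A) =
    4 * (k * (e0 * fro2 A + e1 * (b * fro2 A))).
  by rewrite /k !natrM; field; rewrite M0 L0 N0.
apply: (cvariance_gaussian_le Z_normal Z_indep dPhi).
have mU : measurable_fun setT (fun t : T * T =>
    pairing (Zv t.1) (Zv t.2) : family_space R (I + I)%type).
  apply: measurable_family => -[i|i].
    exact: measurable_fst_RV.
  exact: measurable_snd_RV.
have mD : measurable_fun setT (fun t : T * T =>
    (cmod (ntr (DPhi (Zv t.1) (Zv t.2))) ^+ 2)%:E).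
  apply/measurable_EFinP; apply: measurable_cmod_sqr.
  have [m1 m2] := cmeasurable_ntr (dp_dmeas dPhi).
  by split; [exact: (measurableT_comp m1 mU)|exact: (measurableT_comp m2 mU)].
have D0 (t : T * T) : (0 <= (cmod (ntr (DPhi (Zv t.1) (Zv t.2))) ^+ 2)%:E)%E.
  by rewrite lee_fin sqr_ge0.
rewrite (fubini_tonelli1 _ mD D0).
have mtr1 s : measurable_fun setT (fun t => (cmod (\tr (B1 (Zv s) *m W (Zv t))) ^+ 2)%:E).
  apply/measurable_EFinP; apply: measurable_cmod_sqr; apply: cmeasurable_sum => i _.
  apply: cmeasurable_mulmx; last exact: linear_hankel_meas.
  by move=> ? ?; exact: cmeasurable_cst.
have mtr2 s : measurable_fun setT (fun t =>
    (cmod (\tr (ctrmx (W (Zv t)) *m B2 (Zv s))) ^+ 2)%:E).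
  apply/measurable_EFinP; apply: measurable_cmod_sqr; apply: cmeasurable_sum => i _.
  apply: cmeasurable_mulmx; last by move=> ? ?; exact: cmeasurable_cst.
  by apply: cmeasurable_ctrmx; exact: linear_hankel_meas.
have sq0 (u : R) : (0 <= (u ^+ 2)%:E)%E by rewrite lee_fin sqr_ge0.
have inner s : (fubini_F P (fun t : T * T => (cmod (ntr (DPhi (Zv t.1) (Zv t.2))) ^+ 2)%:E) s <=
    (k * (e0 * fro2 A + e1 * fro2 (ctrmx (W (Zv s)) *m A)))%:E)%E.
  rewrite /fubini_F/=.
  pose c : R := 2 * ((M * L)%:R^-1) ^+ 2.
  have c0 : 0 <= c by rewrite mulr_ge0 ?sqr_ge0.
  apply: (@le_trans _ _ (\int[P]_t (c%:E * ((cmod (\tr (B1 (Zv s) *m W (Zv t))) ^+ 2)%:E +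
      (cmod (\tr (ctrmx (W (Zv t)) *m B2 (Zv s))) ^+ 2)%:E)))%E).
    apply: ge0_le_integral => //.
    - exact: measurableT_comp mD (pair1_measurable s).
    - by apply: emeasurable_funM; [exact: measurable_cst|exact: emeasurable_funD].
    - move=> t _; rewrite -EFinD -EFinM lee_fin DE cmodM cmodV cmod_nat exprMn /c.
      rewrite (mulrC 2) -(mulrA ((M * L)%:R^-1 ^+ 2)) ler_wpM2l ?sqr_ge0//.
      set u := \tr _; set v := \tr _; have := cmodD_le u v.
      have := cmod_ge0 (u + v); have := cmod_ge0 u; have := cmod_ge0 v.
      by have := sqr_ge0 (cmod u - cmod v); nra.
  rewrite ge0_integralZl_EFin//; last 2 first.
  - by move=> t _; exact: adde_ge0.
  - exact: emeasurable_funD.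
  rewrite ge0_integralD//.
  apply: (@le_trans _ _ (c%:E * ((b / N%:R * (L%:R * fro2 (B1 (Zv s))))%:E +
      (b / N%:R * (L%:R * fro2 (B2 (Zv s))))%:E))%E).
    apply: lee_wpmul2l; first by rewrite lee_fin.
    apply: leeD.
      exact: (@trace_hankel_variance_le R d T P I Z Z_normal M L N L_gt0 al f b f_int f_le b_ge0 cov).
    exact: (@trace_ctr_hankel_variance_le R d T P I Z Z_normal M L N L_gt0 al f b f_int f_le b_ge0 cov).
  rewrite -EFinD -EFinM lee_fin.
  apply: le_trans (ler_wpM2l k0 (BA (Zv s))).
  by rewrite /k /c le_eqVlt; apply/orP; left; apply/eqP; ring.
have mWA : measurable_fun setT (fun s => (fro2 (ctrmx (W (Zv s)) *m A))%:E).
  apply/measurable_EFinP; rewrite /fro2; apply: measurable_sum => i; apply: measurable_sum => j.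
  apply: measurable_cmod_sqr; apply: cmeasurable_mulmx.
    by apply: cmeasurable_ctrmx; exact: linear_hankel_meas.
  by move=> ? ?; exact: cmeasurable_cst.
(* The sign is read off the bound on [B1] and [B2] at [x = 0], where [W] vanishes. *)
have e0A : 0 <= e0 * fro2 A.
  have := BA (fun=> 0); have -> : W (fun=> 0) = 0.
    by apply/matrixP => i j; rewrite !mxE /linear_entry big1// => l _; rewrite mul0r.
  have -> : ctrmx (0 : 'M[C]_(M * L, N)) = 0.
    by apply/matrixP => i j; rewrite !mxE conjC0.
  by rewrite mul0mx fro20 mulr0 addr0; apply: le_trans; rewrite addr_ge0 ?fro2_ge0.
have WA0 s : (0 <= (e1 * fro2 (ctrmx (W (Zv s)) *m A))%:E)%E.
  by rewrite lee_fin mulr_ge0 ?fro2_ge0.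
apply: (@le_trans _ _ (\int[P]_s (k%:E * ((e0 * fro2 A)%:E +
    e1%:E * (fro2 (ctrmx (W (Zv s)) *m A))%:E)))%E).
  apply: ge0_le_integral => //.
  - by move=> s _; apply: integral_ge0 => t _; exact: sq0.
  - exact: measurable_fun_fubini_tonelli_F.
  - apply: emeasurable_funM; first exact: measurable_cst.
    by apply: emeasurable_funD => //; apply: emeasurable_funM => //; exact: measurable_cst.
rewrite ge0_integralZl_EFin//; last 2 first.
- by move=> s _; rewrite -EFinM adde_ge0.
- by apply: emeasurable_funD => //; apply: emeasurable_funM => //; exact: measurable_cst.
rewrite ge0_integralD//; last 2 first.
- by move=> s _; rewrite -EFinM.
- by apply: emeasurable_funM => //; exact: measurable_cst.
rewrite integral_cst//= probability_setT mule1.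
rewrite ge0_integralZl_EFin//; last by move=> s _; rewrite lee_fin fro2_ge0.
rewrite [leRHS]EFinM; apply: lee_wpmul2l; first by rewrite lee_fin.
rewrite [leRHS]EFinD; apply: leeD => //.
rewrite [leRHS]EFinM; apply: lee_wpmul2l; first by rewrite lee_fin.
exact: (@fro2_ctr_hankel_le R d T P I Z Z_normal M L N L_gt0 N_gt0 al f b f_int f_le b_ge0 cov).
Qed.

Variable z : C.
Hypothesis z_out : ~ Rnonneg z.
Local Notation q := (dist z (@Rnonneg R))^-1.
Local Notation Q x := (resolvent (W x) z).

(** Entrywise [c <= 1 + c ^+ 2]. This turns the Frobenius bound on the resolvent into the uniform
    bound that [dp_invmx] asks for. *)
Lemma sum_norm_le_fro2 m n (X : 'M[C]_(m, n)) : sum_norm X <= (m * n)%:R + fro2 X.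
Proof.
have -> : (m * n)%:R = \sum_(i < m) \sum_(j < n) 1 :> R.
  by rewrite !sumr_const !card_ord -mulrnA mulnC.
rewrite /sum_norm /fro2 -big_split/=; apply: ler_sum => i _.
rewrite -big_split/=; apply: ler_sum => j _.
by have := sqr_ge0 (cmod (X i j) - 1); have := cmod_ge0 (X i j); nra.
Qed.

Lemma resolvent_dp : differentiable_poly (fun x => Q x) (fun x v =>
  - (Q x *m ((W v *m ctrmx (W x) + W x *m ctrmx (W v)) + 0) *m Q x)).
Proof.
have dW := linear_hankel_dp L_gt0 al.
apply: (dp_invmx (dpD (dpM dW (dp_ctrmx dW)) (dp_cst _ (- z%:M)))).
  by move=> x; exact: shift_gram_unit.
exists ((M * L * (M * L))%:R + q ^+ 2 * fro2 (1%:M : 'M[C]_(M * L))) => x.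
apply: (le_trans (sum_norm_le_fro2 _)); rewrite lerD2l.
by rewrite -[X in fro2 X <= _]mulmx1; apply: fro2_mull; exact: resolvent_opnorm.
Qed.

Let q_ge0 : 0 <= q.
Proof. by rewrite invr_ge0 ltW// dist_Rnonneg_gt0. Qed.

Local Notation u := (q + cmod z * q ^+ 2).

Let u_ge0 : 0 <= u.
Proof. by rewrite addr_ge0// mulr_ge0 ?cmod_ge0// sqr_ge0. Qed.

(** In both coefficient matrices [W] or [W^H] stands next to a [Q], so [e1 = 0]; one side of [A]
    contributes [u], the other [q ^+ 2]. *)
Lemma resolvent_functional_variance_le :
  (cvariance P (fun t => ntr (A *m Q (Zv t))) <=
    (8 * b * (2 * (u * q ^+ 2)) / (M * N)%:R * ((M * L)%:R^-1 * fro2 A))%:E)%E.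
Proof.
have H := @trace_form_variance_le (fun x => A *m Q x) _
  (fun x => - (ctrmx (W x) *m Q x *m A *m Q x))
  (fun x => - (Q x *m A *m (Q x *m W x))) (2 * (u * q ^+ 2)) 0
  (dpM (dp_cst _ A) resolvent_dp).
rewrite mul0r addr0 in H; apply: H => // [x v|x]; first exact: ntr_derivative_AQ.
rewrite mul0r addr0 !fro2N.
have -> : 2 * (u * q ^+ 2) * fro2 A = q ^+ 2 * (u * fro2 A) + u * (q ^+ 2 * fro2 A) by ring.
have q20 : 0 <= q ^+ 2 by exact: sqr_ge0.
apply: lerD.
  apply: (le_trans (fro2_mulr _ q20 (resolvent_opnorm z_out (W x)))).
  rewrite ler_wpM2l//; apply: fro2_mull; exact: ctr_resolvent_opnorm.
apply: (le_trans (fro2_mulr _ u_ge0 (resolvent_mul_opnorm z_out (W x)))).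
by rewrite ler_wpM2l//; apply: fro2_mull; exact: resolvent_opnorm.
Qed.

(** Three of the four pieces contain [W^H A] and make up [e1]; the remaining one, [A Q W G], gives
    [e0]. *)
Lemma sandwich_functional_variance_le (G : 'M[C]_N) (g2 : R) :
  0 <= g2 -> opnorm2_le G g2 ->
  (cvariance P (fun t => ntr (A *m Q (Zv t) *m W (Zv t) *m G *m ctrmx (W (Zv t)))) <=
    (8 * b * (2 * (g2 * u) + 2 * (g2 * (q ^+ 2 + (2 + 2 * (cmod z * q) ^+ 2) * q ^+ 2 + u ^+ 2)) * b)
     / (M * N)%:R * ((M * L)%:R^-1 * fro2 A))%:E)%E.
Proof.
move=> g20 Gg; have dW := linear_hankel_dp L_gt0 al.
pose rho := 2 + 2 * (cmod z * q) ^+ 2.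
have rho0 : 0 <= rho by rewrite addr_ge0// mulr_ge0 ?sqr_ge0.
have q20 : 0 <= q ^+ 2 by exact: sqr_ge0.
apply: (@trace_form_variance_le (fun x => A *m Q x *m W x *m G *m ctrmx (W x)) _
  (fun x => G *m (ctrmx (W x) *m A) *m Q x -
    (ctrmx (W x) *m Q x *m W x) *m (G *m (ctrmx (W x) *m A) *m Q x))
  (fun x => A *m (Q x *m W x) *m G -
    (Q x *m W x) *m (G *m (ctrmx (W x) *m A) *m (Q x *m W x)))
  _ _ (dpM (dpM (dpM (dpM (dp_cst _ A) resolvent_dp) dW) (dp_cst _ G)) (dp_ctrmx dW))).
- by move=> x v; exact: ntr_derivative_AQWGW.
- by rewrite mulr_ge0// mulr_ge0// !addr_ge0 ?mulr_ge0 ?sqr_ge0.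
move=> x; set F := fro2 (ctrmx (W x) *m A).
have Qo := resolvent_opnorm z_out (W x).
have QWo := resolvent_mul_opnorm z_out (W x).
have GA : fro2 (G *m (ctrmx (W x) *m A)) <= g2 * F by exact: fro2_mull.
have b1 : fro2 (G *m (ctrmx (W x) *m A) *m Q x) <= q ^+ 2 * (g2 * F).
  by apply: (le_trans (fro2_mulr _ q20 Qo)); rewrite ler_wpM2l.
have b2 : fro2 ((ctrmx (W x) *m Q x *m W x) *m (G *m (ctrmx (W x) *m A) *m Q x)) <=
    rho * (q ^+ 2 * (g2 * F)).
  apply: (le_trans (fro2_mull _ (ctr_resolvent_mul_opnorm z_out (W x)))).
  by rewrite ler_wpM2l.
have b3 : fro2 (A *m (Q x *m W x) *m G) <= g2 * (u * fro2 A).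
  apply: (le_trans (fro2_mulr _ g20 Gg)); rewrite ler_wpM2l//.
  exact: fro2_mulr.
have b4 : fro2 ((Q x *m W x) *m (G *m (ctrmx (W x) *m A) *m (Q x *m W x))) <=
    u * (u * (g2 * F)).
  apply: (le_trans (fro2_mull _ QWo)); rewrite ler_wpM2l//.
  by apply: (le_trans (fro2_mulr _ u_ge0 QWo)); rewrite ler_wpM2l.
apply: (le_trans (lerD (fro2D_le _ _) (fro2D_le _ _))); rewrite !fro2N.
rewrite -/rho; have -> : 2 * (g2 * u) * fro2 A +
    2 * (g2 * (q ^+ 2 + rho * q ^+ 2 + u ^+ 2)) * F =
    2 * (q ^+ 2 * (g2 * F)) + 2 * (rho * (q ^+ 2 * (g2 * F))) +
    (2 * (g2 * (u * fro2 A)) + 2 * (u * (u * (g2 * F)))) by ring.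
by apply: lerD; apply: lerD; rewrite ler_wpM2l.
Qed.

End functional_variances.

Section affine_means.
Variables (R : realType) (d : measure_display) (T : measurableType d).
Variable P : probability T R.
Local Notation C := R[i].

Lemma normal_affine_mean (I : finType) (Z : I -> {RV P >-> R}) (m : R) (a : I -> R) :
  (forall j, standard_normal P (Z j)) ->
  (\int[P]_t (m + \sum_j a j * Z j t)%:E = m%:E)%E.
Proof.
move=> Zn.
have iZ j : P.-integrable setT (fun t => (a j)%:E * (Z j t)%:E)%E.
  by apply: integrableZl => //; exact: standard_normal_integrable.
have im : P.-integrable setT (cst m%:E) := finite_measure_integrable_cst P m measurableT.
have is_ : P.-integrable setT (fun t => \sum_j ((a j)%:E * (Z j t)%:E))%E.
  exact: integrable_sum.
transitivity (\int[P]_t (cst m%:E t + \sum_j ((a j)%:E * (Z j t)%:E)))%E.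
  by apply: eq_integral => t _; rewrite EFinD -sumEFin.
rewrite integralD// integral_cst//= probability_setT mule1 integral_sum// big1 ?adde0// => j _.
rewrite integralZl//; last exact: standard_normal_integrable.
by rewrite standard_normal_mean// mule0.
Qed.

End affine_means.

(** * Comparison with nice polynomials *)

Section polynomial_bounds.
Variable R : realType.

(** Equal coefficients make positivity immediate; a constant above the binomial coefficients
    suffices to dominate a power of [1 + x]. *)
Lemma poly_cst_nice (n : nat) (a : R) : 0 < a -> nice_poly (\poly_(i < n.+1) a).
Proof.
move=> a0; split.
  apply/eqP => /(congr1 (fun p : {poly R} => p`_0)); rewrite coef_poly coef0 /=.
  by move/eqP; rewrite gt_eqF.
move=> i isz; rewrite coef_poly (leq_trans isz) ?size_poly//.
Qed.

Lemma onem_sqr_le (x : R) : 0 <= x -> (1 + x) ^+ 2 <= (\poly_(i < 3) 2).[x].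
Proof.
move=> x0; rewrite horner_poly !big_ord_recl big_ord0 /= /bump /= expr0 expr1.
by have := sqr_ge0 (1 - x); nra.
Qed.

Lemma onem_pow4_le (x : R) : 0 <= x -> (1 + x) ^+ 4 <= (\poly_(i < 5) 8).[x].
Proof.
move=> x0; rewrite horner_poly !big_ord_recl big_ord0 /= /bump /= expr0 expr1.
have := sqr_ge0 (1 - x); have := sqr_ge0 (1 - x ^+ 2).
have : 0 <= x ^+ 3 by rewrite exprn_ge0.
have := sqr_ge0 x.
have -> : (1 + x) ^+ 4 = ((1 + x) ^+ 2) ^+ 2 by rewrite -exprM.
have -> : x ^+ 4 = (x ^+ 2) ^+ 2 by rewrite -exprM.
have -> : x ^+ 3 = x ^+ 2 * x by rewrite exprSr.
nra.
Qed.

(** Since [u <= (1 + y) * (1 + q) ^+ 2], every monomial that occurs is at most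
    [K = (1 + y) ^+ 2 * (1 + q) ^+ 4]. The bracket multiplied by [b] has total weight
    [1 + 2 + 2 + 1 = 6], whence the [12]. *)
Lemma resolvent_constants_le (y q b g2 : R) : 0 <= y -> 0 <= q -> 0 <= b -> 0 <= g2 ->
  let u := q + y * q ^+ 2 in
  2 * (u * q ^+ 2) <= (2 + g2 * (2 + 12 * b)) * ((1 + y) ^+ 2 * (1 + q) ^+ 4) /\
  2 * (g2 * u) + 2 * (g2 * (q ^+ 2 + (2 + 2 * (y * q) ^+ 2) * q ^+ 2 + u ^+ 2)) * b <=
  (2 + g2 * (2 + 12 * b)) * ((1 + y) ^+ 2 * (1 + q) ^+ 4).
Proof.
move=> y0 q0 b0 g0 u.
pose X := 1 + y; pose Y := 1 + q; pose K := X ^+ 2 * Y ^+ 4.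
have X1 : 1 <= X by rewrite lerDl.
have Y1 : 1 <= Y by rewrite lerDl.
have X0 : 0 <= X by apply: le_trans X1.
have Y0 : 0 <= Y by apply: le_trans Y1.
have u0 : 0 <= u by rewrite addr_ge0// mulr_ge0// sqr_ge0.
have qY : q <= Y by rewrite /Y; lra.
have yX : y <= X by rewrite /X; lra.
have uXY : u <= X * Y ^+ 2.
  have -> : u = q * (1 + y * q) by rewrite /u; ring.
  have -> : X * Y ^+ 2 = Y * (X * Y) by ring.
  apply: ler_pM => //; first by rewrite addr_ge0// mulr_ge0.
  by rewrite /X /Y; nra.
have q2 : q ^+ 2 <= Y ^+ 2 by rewrite ler_sqr ?nnegrE.
have Xe i j : (i <= j)%N -> X ^+ i <= X ^+ j by move=> ij; exact: ler_weXn2l.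
have Ye i j : (i <= j)%N -> Y ^+ i <= Y ^+ j by move=> ij; exact: ler_weXn2l.
have XY0 i j : 0 <= X ^+ i * Y ^+ j by rewrite mulr_ge0// exprn_ge0.
have XYe i j : (i <= 2)%N -> (j <= 4)%N -> X ^+ i * Y ^+ j <= K.
  by move=> hi hj; apply: ler_pM; rewrite ?exprn_ge0 ?Xe ?Ye.
have uq : u * q ^+ 2 <= K.
  apply: (@le_trans _ _ (X * Y ^+ 2 * Y ^+ 2)).
    by apply: ler_pM; rewrite ?sqr_ge0.
  have -> : X * Y ^+ 2 * Y ^+ 2 = X ^+ 1 * Y ^+ 4 by ring.
  exact: XYe.
have uK : u <= K.
  apply: (le_trans uXY); have -> : X * Y ^+ 2 = X ^+ 1 * Y ^+ 2 by ring.
  exact: XYe.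
have u2 : u ^+ 2 <= K.
  have -> : K = (X * Y ^+ 2) ^+ 2 by rewrite /K exprMn -exprM.
  by rewrite ler_sqr ?nnegrE ?mulr_ge0 ?sqr_ge0.
have q2K : q ^+ 2 <= K.
  by apply: (le_trans q2); have := XYe 0%N 2%N isT isT; rewrite expr0 mul1r.
have yq : (y * q) ^+ 2 * q ^+ 2 <= K.
  have -> : K = (X * Y) ^+ 2 * Y ^+ 2 by rewrite /K; ring.
  apply: ler_pM; rewrite ?sqr_ge0//.
  by rewrite ler_sqr ?nnegrE ?mulr_ge0//; apply: ler_pM.
have K0 : 0 <= K by rewrite /K.
have gb0 : 0 <= g2 * b by rewrite mulr_ge0.
split; rewrite -/X -/Y -/K.
  have : 0 <= g2 * (2 + 12 * b) * K by rewrite !mulr_ge0// addr_ge0// mulr_ge0.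
  have -> : (2 + g2 * (2 + 12 * b)) * K = 2 * K + g2 * (2 + 12 * b) * K by ring.
  lra.
have t1 : g2 * u <= g2 * K by rewrite ler_wpM2l.
have t2 : (g2 * b) * (q ^+ 2 + (2 + 2 * (y * q) ^+ 2) * q ^+ 2 + u ^+ 2) <= (g2 * b) * (6 * K).
  rewrite ler_wpM2l//; have -> : (2 + 2 * (y * q) ^+ 2) * q ^+ 2 =
    2 * q ^+ 2 + 2 * ((y * q) ^+ 2 * q ^+ 2) by ring.
  lra.
have -> : (2 + g2 * (2 + 12 * b)) * K = 2 * K + 2 * (g2 * K) + 2 * ((g2 * b) * (6 * K)) by ring.
have -> : 2 * (g2 * u) + 2 * (g2 * (q ^+ 2 + (2 + 2 * (y * q) ^+ 2) * q ^+ 2 + u ^+ 2)) * b =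
    2 * (g2 * u) + 2 * ((g2 * b) * (q ^+ 2 + (2 + 2 * (y * q) ^+ 2) * q ^+ 2 + u ^+ 2)) by ring.
lra.
Qed.

End polynomial_bounds.

(** * Passage from the given Gaussian entries to linear images *)

Section gaussian_model.
Variables (R : realType) (d : measure_display) (T : measurableType d).
Variable P : probability T R.
Local Notation C := R[i].

(** The mean of an affine image is its constant term, so centering removes it; the real coefficients
    of the real and imaginary parts combine into one complex coefficient. *)
Lemma centered_gaussian_linear (J : finType) (X : J -> T -> C) :
  jointly_complex_gaussian P X -> (forall p, cexpectation P (X p) = 0) ->
  exists (k : nat) (Z : 'I_k -> {RV P >-> R}) (al : J -> 'I_k -> C),
    [/\ forall j, standard_normal P (Z j), mutually_independent P (fun j t => Z j t) &
      {ae P, forall t, forall p, X p t = \sum_j ((Z j t)%:C)%C * al p j}].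
Proof.
move=> [mX [k [Z [m [a [Zn Zi XE]]]]]] X0; exists k, Z.
exists (fun p j => Complex (a (inl p) j) (a (inr p) j)); split => //.
have mE i : (\int[P]_t (re_im X i t)%:E = (m i)%:E)%E.
  rewrite -(normal_affine_mean (m i) (a i) Zn); apply: ae_eq_integral => //.
  - exact/measurable_EFinP.
  - apply/measurable_EFinP; apply: measurable_funD => //.
    by apply: measurable_sum => j; apply: measurable_funM.
  by apply: filterS (XE i) => t -> _.
have m0 i : m i = 0.
  apply: EFin_inj; rewrite -mE.
  case: i => p; have := X0 p; rewrite /cexpectation unlock; case=> r0 i0.
    by have := mE (inl p) => /= E; rewrite E; rewrite E/= in r0; rewrite r0.
  by have := mE (inr p) => /= E; rewrite E; rewrite E/= in i0; rewrite i0.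
have XA : {ae P, forall t, forall i, re_im X i t = m i + \sum_(j < k) a i j * Z j t}.
  by apply: filter_forall; exact: XE.
apply: filterS XA => t Xt p.
have Re_eq := Xt (inl p); have Im_eq := Xt (inr p).
rewrite !m0 !add0r /= in Re_eq Im_eq.
apply/eqP; rewrite eq_complex Re_sum Im_sum Re_eq Im_eq; apply/andP; split; apply/eqP.
  by apply: eq_bigr => j _ /=; rewrite mul0r subr0 mulrC.
by apply: eq_bigr => j _ /=; rewrite mul0r addr0 mulrC.
Qed.

Variables (M L N : nat).
Hypotheses (M_gt0 : (0 < M)%N) (L_gt0 : (0 < L)%N) (N_gt0 : (0 < N)%N).
Local Notation idx := ('I_M * 'I_(N + L - 1))%type.
Variable w : nat -> nat -> T -> C.
Hypothesis w_gauss : jointly_complex_gaussian P (fun p : idx => w p.1 p.2).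
Hypothesis w_mean : forall p : idx, cexpectation P (w p.1 p.2) = 0.
Variables (f : 'I_M -> R -> R) (b : R).
Hypothesis f_int : forall m, (@lebesgue_measure R).-integrable `[0, 1] (EFin \o f m).
Hypothesis f_le : forall m x, 0 <= x <= 1 -> f m x <= b.
Hypothesis b_ge0 : 0 <= b.
Hypothesis w_cov : forall p q : idx,
  cexpectation P (fun t => w p.1 p.2 t * Num.conj (w q.1 q.2 t)) =
  fourier_coef (f p.1) ((p.2 : nat)%:Z - (q.2 : nat)%:Z) / N%:R * (p.1 == q.1)%:R.
Variables (A : 'M[C]_(M * L)) (G : 'M[C]_N) (g2 : R) (z : C).
Hypotheses (g2_ge0 : 0 <= g2) (G_le : opnorm2_le G g2) (z_out : ~ Rnonneg z).
Local Notation W t := (block_hankel M L N (fun m n => w m n t)).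
Local Notation q := (dist z (@Rnonneg R))^-1.

Let w_meas (p : idx) : cmeasurable (w p.1 p.2).
Proof. by case: w_gauss => mX _; split; [exact: (mX (inl p))|exact: (mX (inr p))]. Qed.

Let W_meas i j : cmeasurable (fun t => W t i j).
Proof. by apply: eq_cmeasurable (w_meas (hankel_idx L_gt0 i j)) => t; rewrite mxE. Qed.

Let variance_bound : R := 8 * b * (2 + g2 * (2 + 12 * b)) *
  ((1 + cmod z) ^+ 2 * (1 + q) ^+ 4) / (M * N)%:R * complex.Re (ntr (A *m ctrmx A)).

(** Stated for any random matrix because it serves both the given Hankel matrix and its linear
    representative. *)
Lemma cmeasurable_functional (F : T -> 'M[C]_(M * L, N)) :
  (forall i j, cmeasurable (fun t => F t i j)) ->
  cmeasurable (fun t => ntr (A *m resolvent (F t) z)) /\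
  cmeasurable (fun t => ntr (A *m resolvent (F t) z *m F t *m G *m ctrmx (F t))).
Proof.
move=> mF.
have mQ i j : cmeasurable (fun t => resolvent (F t) z i j).
  apply: cmeasurable_invmx => [t|r s]; first exact: shift_gram_unit.
  have mFF := cmeasurable_mulmx mF (cmeasurable_ctrmx mF).
  apply: (@eq_cmeasurable _ _ _ (fun t =>
    (F t *m ctrmx (F t)) r s + (- z%:M : 'M[C]_(M * L)) r s)) => [t|].
    by rewrite [RHS]mxE.
  by apply: cmeasurableD; [exact: mFF|exact: cmeasurable_cst].
have mcst m n (B : 'M[C]_(m, n)) i j : cmeasurable (fun _ : T => B i j).
  exact: cmeasurable_cst.
have mAQ := cmeasurable_mulmx (mcst _ _ A) mQ.
split; apply: cmeasurable_ntr => //.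
exact: (cmeasurable_mulmx (cmeasurable_mulmx (cmeasurable_mulmx mAQ mF) (mcst _ _ G))
  (cmeasurable_ctrmx mF)).
Qed.

Lemma gaussian_functional_variances_le :
  (cvariance P (fun t => ntr (A *m resolvent (W t) z)) <= variance_bound%:E)%E /\
  (cvariance P (fun t => ntr (A *m resolvent (W t) z *m W t *m G *m ctrmx (W t)))
    <= variance_bound%:E)%E.
Proof.
have [k [Z [al [Zn Zi wE]]]] := centered_gaussian_linear w_gauss w_mean.
pose Zv (t : T) (i : 'I_k) : R := Z i t.
have mZ p : cmeasurable (fun t => linear_entry al p (Zv t)) by exact: linear_entry_meas.
have cov (p p' : idx) :
    cexpectation P (fun t => linear_entry al p (Zv t) * Num.conj (linear_entry al p' (Zv t))) =
    fourier_coef (f p.1) ((p.2 : nat)%:Z - (p'.2 : nat)%:Z) / N%:R * (p.1 == p'.1)%:R.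
  rewrite -w_cov; apply: ae_eq_cexpectation.
  - by apply: cmeasurableM => //; exact: cmeasurable_conj.
  - by apply: cmeasurableM => //; exact: cmeasurable_conj.
  by apply: filterS wE => t wt; rewrite !wt.
pose H (t : T) := linear_hankel L_gt0 al (Zv t).
have mH i j : cmeasurable (fun t => H t i j) by exact: linear_hankel_meas.
have WH : {ae P, forall t, W t = H t}.
  apply: filterS wE => t wt; apply/matrixP => i j; rewrite !mxE.
  exact: (wt (hankel_idx L_gt0 i j)).
have [mW1 mW2] := cmeasurable_functional W_meas.
have [mH1 mH2] := cmeasurable_functional mH.
have q0 : 0 <= q by rewrite invr_ge0 ltW// dist_Rnonneg_gt0.
have [K1 K2] := resolvent_constants_le (cmod_ge0 z) q0 b_ge0 g2_ge0.
have bound_le (e : R) : e <= (2 + g2 * (2 + 12 * b)) * ((1 + cmod z) ^+ 2 * (1 + q) ^+ 4) ->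
    8 * b * e / (M * N)%:R * ((M * L)%:R^-1 * fro2 A) <= variance_bound.
  move=> ele; rewrite /variance_bound fro2_ntr.
  rewrite ler_wpM2r ?mulr_ge0 ?fro2_ge0// ler_wpM2r// -[leRHS]mulrA.
  by rewrite ler_wpM2l// mulr_ge0.
split.
  have -> : cvariance P (fun t => ntr (A *m resolvent (W t) z)) =
      cvariance P (fun t => ntr (A *m resolvent (H t) z)).
    by apply: ae_eq_cvariance => //; apply: filterS WH => t ->.
  apply: (le_trans (resolvent_functional_variance_le Zn Zi M_gt0 L_gt0 N_gt0 f_int f_le b_ge0 cov A z_out)).
  by rewrite lee_fin; exact: bound_le.
have -> : cvariance P (fun t => ntr (A *m resolvent (W t) z *m W t *m G *m ctrmx (W t))) =
    cvariance P (fun t => ntr (A *m resolvent (H t) z *m H t *m G *m ctrmx (H t))).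
  by apply: ae_eq_cvariance => //; apply: filterS WH => t ->.
apply: (le_trans (sandwich_functional_variance_le Zn Zi M_gt0 L_gt0 N_gt0 f_int f_le b_ge0 cov A z_out g2_ge0 G_le)).
by rewrite lee_fin; exact: bound_le.
Qed.

End gaussian_model.

Theorem lemma3p1 (R : realType)
  (M L : nat -> nat) (c : R)
  (M_gt0 : forall N, (0 < N)%N -> (0 < M N)%N)
  (L_gt0 : forall N, (0 < N)%N -> (0 < L N)%N)
  (M_infty : M @ \oo --> \oo)
  (c_gt0 : 0 < c)
  (cN_cvg : (fun N => (M N * L N)%:R / N%:R : R) @ \oo --> c)
  (* S K m, for m < K, is the m-th of the K densities *)
  (S : nat -> nat -> R -> R)
  (S_pos : forall K m (nu : R), (m < K)%N -> 0 <= nu <= 1 -> 0 < S K m nu)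
  (S_int : forall K m, (m < K)%N ->
    lebesgue_measure.-integrable `[0, 1] (fun nu : R => (S K m nu)%:E))
  (S_sum : (ereal_sup
      [set \esum_(n in [set: int])
         (Num.sqrt (K%:R^-1 *
            \sum_(m < K) cmod (fourier_coef (S K m) n) ^+ 2))%:E
      | K in [set K | (0 < K)%N]] < +oo)%E)
  (S_upper : exists b : R, forall K m (nu : R), (m < K)%N -> 0 <= nu <= 1 ->
    S K m nu <= b)
  (S_lower : exists2 a : R, 0 < a & forall K m (nu : R), (m < K)%N -> 0 <= nu <= 1 ->
    a <= S K m nu)
  (* only w N m n with m < M N and n < N + L N - 1 is used *)
  (d : measure_display) (T : measurableType d) (P : probability T R)
  (w : nat -> nat -> nat -> T -> R[i])
  (w_gauss : forall N, (0 < N)%N ->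
    jointly_complex_gaussian P
      (fun p : 'I_(M N) * 'I_(N + L N - 1) => w N p.1 p.2))
  (w_circ : forall N, (0 < N)%N ->
    circularly_symmetric P
      (fun p : 'I_(M N) * 'I_(N + L N - 1) => w N p.1 p.2))
  (w_mean : forall N, (0 < N)%N ->
    forall (m : 'I_(M N)) (k : 'I_(N + L N - 1)),
      cexpectation P (w N m k) = 0)
  (w_cov : forall N, (0 < N)%N ->
    forall (m m' : 'I_(M N)) (k k' : 'I_(N + L N - 1)),
      cexpectation P (fun t => w N m k t * Num.conj (w N m' k' t)) =
      fourier_coef (S (M N) m) (k%:Z - k'%:Z) / N%:R * (m == m')%:R)
  (A : forall N, 'M[R[i]]_(M N * L N))
  (G : forall N, 'M[R[i]]_N)
  (G_bounded : has_ubound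
    [set spectral_norm (G N) | N in [set N | (0 < N)%N]]) :
  let W N t := block_hankel (M N) (L N) N (fun m n => w N m n t) in
  exists P1 P2 : {poly R},
    [/\ nice_poly P1, nice_poly P2 &
      forall (N : nat) (z : R[i]), (0 < N)%N -> ~ Rnonneg z ->
        let Q t := resolvent (W N t) z in
        let Cz := P1.[cmod z] * P2.[(dist z (@Rnonneg R))^-1] in
        let bound := Cz / (M N * N)%:R *
                     complex.Re (ntr (A N *m ctrmx (A N))) in
        (cvariance P (fun t => ntr (A N *m Q t)) <= bound%:E)%E /\
        (cvariance P (fun t =>
           ntr (A N *m Q t *m W N t *m G N *m ctrmx (W N t)))
           <= bound%:E)%E].
Proof.
move=> W; have [b0 Sb0] := S_upper; have [g0 Gg0] := G_bounded.
pose b := `|b0|; pose g2 := g0 ^+ 2.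
have b_ge0 : 0 <= b by exact: normr_ge0.
have g2_ge0 : 0 <= g2 by exact: sqr_ge0.
(* With [b + 1] in place of [b] the constant is positive from [b >= 0] alone, as the coefficients of
   a nice polynomial must be. *)
pose Ctot := 8 * (b + 1) * (2 + g2 * (2 + 12 * b)).
have C_gt0 : 0 < Ctot.
  have gb : 0 <= g2 * (2 + 12 * b) by rewrite mulr_ge0// addr_ge0// mulr_ge0.
  by rewrite /Ctot !mulr_gt0//; move: (g2 * _) gb b_ge0 => e; lra.
(* Degrees [2] and [4] are the exponents of [1 + |z|] and [1 + 1 / delta] in the bound; the
   constants of the model all go into the first polynomial. *)
exists (\poly_(i < 3) (Ctot * 2)), (\poly_(i < 5) 8); split.
- by apply: poly_cst_nice; rewrite mulr_gt0.
- exact: poly_cst_nice.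
move=> N z N_gt0 z_out Q Cz bound.
have G_le : opnorm2_le (G N) g2.
  by apply: opnorm2_le_spectral; apply: Gg0; exists N.
have f_int (m : 'I_(M N)) :
    (@lebesgue_measure R).-integrable `[0, 1] (EFin \o S (M N) m) by exact: S_int.
have f_le (m : 'I_(M N)) (x : R) : 0 <= x <= 1 -> S (M N) m x <= b.
  by move=> x01; apply: (le_trans (Sb0 _ _ _ (ltn_ord m) x01)); exact: ler_norm.
have [V1 V2] := gaussian_functional_variances_le (M_gt0 _ N_gt0) (L_gt0 _ N_gt0) N_gt0
  (w_gauss _ N_gt0) (fun p => w_mean _ N_gt0 p.1 p.2) f_int f_le b_ge0
  (fun p q => w_cov _ N_gt0 p.1 q.1 p.2 q.2) (A N) g2_ge0 G_le z_out.
suff bound_ge : 8 * b * (2 + g2 * (2 + 12 * b)) *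
    ((1 + cmod z) ^+ 2 * (1 + (dist z (@Rnonneg R))^-1) ^+ 4) / (M N * N)%:R *
    complex.Re (ntr (A N *m ctrmx (A N))) <= bound.
  by split; [apply: (le_trans V1)|apply: (le_trans V2)]; rewrite lee_fin.
have q_ge0 : 0 <= (dist z (@Rnonneg R))^-1 by rewrite invr_ge0 ltW// dist_Rnonneg_gt0.
have y_ge0 := cmod_ge0 z.
rewrite /bound fro2_ntr ler_wpM2r ?mulr_ge0 ?fro2_ge0// ler_wpM2r//.
have -> : Cz = Ctot * ((\poly_(i < 3) 2).[cmod z] *
    (\poly_(i < 5) 8).[(dist z (@Rnonneg R))^-1]).
  rewrite /Cz mulrA; congr (_ * _); rewrite !horner_poly mulr_sumr.
  by apply: eq_bigr => i _; rewrite mulrA.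
apply: ler_pM.
- by rewrite !mulr_ge0// addr_ge0// mulr_ge0// addr_ge0// mulr_ge0.
- by rewrite mulr_ge0// exprn_ge0// addr_ge0.
- rewrite ler_wpM2r//; last by rewrite ler_wpM2l// lerDl.
  by rewrite addr_ge0// mulr_ge0// addr_ge0// mulr_ge0.
apply: ler_pM; rewrite ?exprn_ge0 ?addr_ge0//; first exact: onem_sqr_le.
exact: onem_pow4_le.
Qed.
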